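(* There exist constants $C_1$ and $C_2$ independent of $n$ such that, for any sequence $\{Z^n\in\mathfrak Z^n,\ n\in\mathbb N\}$ of admissible scheduling policies, $$\limsup_{T\to\infty}\;\frac1T\,\mathbb E^{Z^n}\left[\int_0^T|\hat X^n(s)|^m\,ds\right]\;\le\;C_1+C_2\,J_{\mathsf o}(\hat X^n(0),Z^n)\qquad\forall\,n\in\mathbb N,$$ where $m\ge1$ is the exponent of the running cost $\hat r_{\mathsf o}$.
   Context: **Notation.** $a\wedge b=\min(a,b)$; $|\cdot|$ is the Euclidean norm. **N-network.** For each $n\in\mathbb N$ there are two customer classes $i=1,2$ and two server pools $j=1,2$ with $N_j^n$ identical servers in pool $j$. Pool 1 serves only class 1; pool 2 serves both classes. Class-$i$ jobs arrive as a Poisson process of rate $\lambda_i^n$; class-1 jobs are served at exponential rates $\mu_{11}^n,\mu_{12}^n$ in pools 1, 2, class-2 jobs at exponential rate $\mu_{22}^n$ in pool 2 ($\mu_{21}^n=\mu_{21}=0$); waiting class-$i$ jobs abandon at exponential rate $\gamma_i^n$. Standing assumption: as $n\to\infty$, for $i,j\in\{1,2\}$, $\lambda_i^n/n\to\lambda_i>0$, $(\lambda_i^n-n\lambda_i)/\sqrt n\to\hat\lambda_i$, $\gamma_i^n\to\gamma_i\ge0$, $N_j^n/n\to\nu_j>0$, $\sqrt n(n^{-1}N_j^n-\nu_j)\to0$; for $(i,j)\in\{(1,1),(1,2),(2,2)\}$, $\mu_{ij}^n\to\mu_{ij}>0$, $\sqrt n(\mu_{ij}^n-\mu_{ij})\to\hat\mu_{ij}$;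 and $\lambda_1>\mu_{11}\nu_1$, $\frac{\lambda_1-\mu_{11}\nu_1}{\mu_{12}\nu_2}+\frac{\lambda_2}{\mu_{22}\nu_2}=1$. Put $x_1^*=\nu_1+\frac{\lambda_1-\mu_{11}\nu_1}{\mu_{12}}$, $x_2^*=\frac{\lambda_2}{\mu_{22}}$. **Processes and policies.** $X_i^n(t)$, $Q_i^n(t)$ are the numbers of class-$i$ jobs in the system and in queue, $Y_j^n(t)$ the number of idle servers in pool $j$, $Z_{ij}^n(t)$ the number of class-$i$ jobs in service in pool $j$ ($Z_{21}^n\equiv0$). All are nonnegative, with $X_1^n=Q_1^n+Z_{11}^n+Z_{12}^n$, $X_2^n=Q_2^n+Z_{22}^n$, $N_1^n=Y_1^n+Z_{11}^n$, $N_2^n=Y_2^n+Z_{12}^n+Z_{22}^n$, and $X_i^n(t)=X_i^n(0)+A_i^n(\lambda_i^nt)-\sum_{j}S_{ij}^n(\mu_{ij}^n\int_0^tZ_{ij}^n(s)ds)-R_i^n(\gamma_i^n\int_0^tQ_i^n(s)ds)$, where $A_i^n,S_{ij}^n,R_i^n$ are mutually independent rate-1 Poisson processes independent of $X^n(0)$ (terms with $(i,j)=(2,1)$ vanish). The initial conditions are deterministic. For $x\in\mathbb Z_+^2$, $z\in\mathbb Z_+^{2\times2}$ let $q_1(x,z)=x_1-z_{11}-z_{12}$, $q_2(x,z)=x_2-z_{22}$, $y_1^n(x,z)=N_1^n-z_{11}$, $y_2^n(x,z)=N_2^n-z_{12}-z_{22}$, and let $\mathcal Z^n(x)$ be the set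 of $z\in\mathbb Z_+^{2\times2}$ with $z_{21}=0$, $q_1,q_2,y_1^n,y_2^n\ge0$, $q_1\wedge(y_1^n+y_2^n)=0$ and $q_2\wedge y_2^n=0$ (work conservation). Let $\tilde A_i^n(t)=A_i^n(\lambda_i^nt)$, $\tilde S_{ij}^n(t)=S_{ij}^n(\mu_{ij}^n\int_0^tZ_{ij}^n)$, $\tilde R_i^n(t)=R_i^n(\gamma_i^n\int_0^tQ_i^n)$, and $\delta\tilde A_i^n(t,r)=\tilde A_i^n(t+r)-\tilde A_i^n(t)$, $\delta\tilde S_{ij}^n(t,r)=S_{ij}^n(\mu_{ij}^n\int_0^tZ_{ij}^n+\mu_{ij}^nr)-\tilde S_{ij}^n(t)$, $\delta\tilde R_i^n(t,r)=R_i^n(\gamma_i^n\int_0^tQ_i^n+\gamma_i^nr)-\tilde R_i^n(t)$. $\mathcal F_t^n$ is the completed $\sigma$-field generated by $X^n(0)$ and $\tilde A_i^n(s),\tilde S_{ij}^n(s),\tilde R_i^n(s)$, $s\le t$; $\mathcal G_t^n$ is generated by $\delta\tilde A_i^n(t,r),\delta\tilde S_{ij}^n(t,r),\delta\tilde R_i^n(t,r)$, $r\ge0$. A policy $Z^n$ is admissible ($Z^n\in\mathfrak Z^n$) if $Z^n(t)\in\mathcal Z^n(X^n(t))$ for all $t$, $Z^n(t)$ is adapted to $\mathcal F_t^n$, $\mathcal F_t^n$ is independent of $\mathcal G_t^n$ for each $t$, and for each $t$, $\delta\tilde S_{ij}^n(t,\cdot)$ and $\delta\tilde R_i^n(t,\cdot)$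 agree in law with $S_{ij}^n(\mu_{ij}^n\,\cdot)$ and $R_i^n(\gamma_i^n\,\cdot)$. $\mathbb E^{Z^n}$ is expectation under $Z^n$. **Scaling and cost.** $\hat X_i^n=n^{-1/2}(X_i^n-nx_i^* )$, $\hat Q_i^n=n^{-1/2}Q_i^n$; fixed $m\ge1$, $\xi\in(0,\infty)^2$; $\hat r_{\mathsf o}(q)=\sum_{i=1}^2\xi_iq_i^m$; $J_{\mathsf o}(\hat X^n(0),Z^n)=\limsup_{T\to\infty}\frac1T\mathbb E^{Z^n}\int_0^T\hat r_{\mathsf o}(\hat Q^n(s))ds$. *)

(* Defs.v *)
From HB Require Import structures.
From mathcomp Require Import all_boot all_order all_algebra.
From mathcomp Require Import all_classical all_reals all_analysis.

Set Implicit Arguments.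
Unset Strict Implicit.
Unset Printing Implicit Defensive.

Import Order.TTheory GRing.Theory Num.Theory.
Import numFieldNormedType.Exports.

Local Open Scope classical_set_scope.
Local Open Scope ring_scope.

Inductive class := class1 | class2.
Inductive pool := pool1 | pool2.

(* The pair (class 2, pool 1) is not an activity: rather than carrying
   mu_21 = 0 and Z_21 = 0 along, service data are indexed by the three pairs
   that can occur. *)
Inductive activity := act11 | act12 | act22.

Definition class_of (a : activity) : class :=
  match a with act11 | act12 => class1 | act22 => class2 end.

Definition pool_of (a : activity) : pool :=
  match a with act11 => pool1 | act12 | act22 => pool2 end.

(* The event streams of the network, each driven by its own Poisson process. *)
Inductive flow :=
  | arrival of class
  | service of activity
  | abandonment of class.

Definition class_bool (i : class) := if i is class1 then true else false.
Definition bool_class b := if b then class1 else class2.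
Lemma class_boolK : cancel class_bool bool_class. Proof. by case. Qed.
HB.instance Definition _ := Finite.copy class (can_type class_boolK).

Definition pool_bool (j : pool) := if j is pool1 then true else false.
Definition bool_pool b := if b then pool1 else pool2.
Lemma pool_boolK : cancel pool_bool bool_pool. Proof. by case. Qed.
HB.instance Definition _ := Finite.copy pool (can_type pool_boolK).

Definition activity_opt (a : activity) : option bool :=
  match a with act11 => None | act12 => Some true | act22 => Some false end.
Definition opt_activity (o : option bool) : activity :=
  match o with None => act11 | Some true => act12 | Some false => act22 end.
Lemma activity_optK : cancel activity_opt opt_activity. Proof. by case. Qed.
HB.instance Definition _ := Finite.copy activity (can_type activity_optK).

Definition flow_sum (f : flow) : class + activity + class :=
  match f with
  | arrival i => inl (inl i)
  | service a => inl (inr a)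
  | abandonment i => inr i
  end.
Definition sum_flow (s : class + activity + class) : flow :=
  match s with
  | inl (inl i) => arrival i
  | inl (inr a) => service a
  | inr i => abandonment i
  end.
Lemma flow_sumK : cancel flow_sum sum_flow. Proof. by case. Qed.
HB.instance Definition _ := Finite.copy flow (can_type flow_sumK).

Section parameters.
Context {R : realType}.

Record network := Network {
  servers : pool -> nat;
  arrival_rate : class -> R;
  service_rate : activity -> R;
  abandonment_rate : class -> R
}.

Definition rate (nw : network) (f : flow) : R :=
  match f with
  | arrival i => arrival_rate nw i
  | service a => service_rate nw a
  | abandonment i => abandonment_rate nw i
  end.

Record limit_parameters := LimitParameters {
  lambda : class -> R;
  mu : activity -> R;
  gamma : class -> R;
  nu : pool -> R;
  lambda_hat : class -> R;
  mu_hat : activity -> R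
}.

Record standing_assumption (nw : nat -> network) (L : limit_parameters) : Prop
    := StandingAssumption {
  rate_ge0 : forall n f, (0 < n)%N -> 0 <= rate (nw n) f;
  lambda_gt0 : forall i, 0 < lambda L i;
  mu_gt0 : forall a, 0 < mu L a;
  gamma_ge0 : forall i, 0 <= gamma L i;
  nu_gt0 : forall j, 0 < nu L j;
  cvg_lambda : forall i,
    arrival_rate (nw n) i / n%:R @[n --> \oo] --> lambda L i;
  cvg_lambda_hat : forall i,
    (arrival_rate (nw n) i - n%:R * lambda L i) / Num.sqrt n%:R @[n --> \oo]
      --> lambda_hat L i;
  cvg_mu : forall a, service_rate (nw n) a @[n --> \oo] --> mu L a;
  cvg_mu_hat : forall a,
    Num.sqrt n%:R * (service_rate (nw n) a - mu L a) @[n --> \oo]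
      --> mu_hat L a;
  cvg_gamma : forall i, abandonment_rate (nw n) i @[n --> \oo] --> gamma L i;
  cvg_nu : forall j, (servers (nw n) j)%:R / n%:R @[n --> \oo] --> nu L j;
  cvg_nu_hat : forall j,
    Num.sqrt n%:R * ((servers (nw n) j)%:R / n%:R - nu L j) @[n --> \oo]
      --> (0 : R);
  pool1_overloaded : mu L act11 * nu L pool1 < lambda L class1;
  critical_load :
    (lambda L class1 - mu L act11 * nu L pool1) / (mu L act12 * nu L pool2)
    + lambda L class2 / (mu L act22 * nu L pool2) = 1
}.

Definition fluid_equilibrium (L : limit_parameters) (i : class) : R :=
  match i with
  | class1 =>
      nu L pool1 + (lambda L class1 - mu L act11 * nu L pool1) / mu L act12
  | class2 => lambda L class2 / mu L act22
  end.

End parameters.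
Arguments network : clear implicits.
Arguments limit_parameters : clear implicits.

Definition queue (x : class -> nat) (z : activity -> nat) (i : class) : int :=
  (x i)%:Z - \sum_(a | class_of a == i) (z a)%:Z.

Definition idle (N : pool -> nat) (z : activity -> nat) (j : pool) : int :=
  (N j)%:Z - \sum_(a | pool_of a == j) (z a)%:Z.

Record work_conserving (N : pool -> nat) (x : class -> nat)
    (z : activity -> nat) : Prop := WorkConserving {
  queue_ge0 : forall i, 0 <= queue x z i;
  idle_ge0 : forall j, 0 <= idle N z j;
  work_conserving1 :
    Num.min (queue x z class1) (idle N z pool1 + idle N z pool2) = 0;
  work_conserving2 : Num.min (queue x z class2) (idle N z pool2) = 0
}.

Section probability_notions.
Context {R : realType}.

Definition preimages {T I : Type} (D : set I) (U : I -> T -> nat) :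
    set (set T) :=
  \bigcup_(k in D) preimage_set_system setT (U k) measurable.

Context {d : measure_display} {T : measurableType d} (P : probability T R).

Definition independent_set_systems (F G : set (set T)) : Prop :=
  forall A B, F A -> G B -> P (A `&` B) = (P A * P B)%E.

Definition mutually_independent {I : finType} (F : I -> set (set T)) : Prop :=
  forall (J : {set I}) (B : I -> set T), (forall k, k \in J -> F k (B k)) ->
  P (\bigcap_(k in [set` J]) B k) = (\prod_(k in J) P (B k))%E.

(* Processes are indexed by all of R, but only times t >= 0 are meaningful. *)
Definition process_sigma (U : R -> T -> nat) : set (set T) :=
  <<s preimages [set t | 0 <= t] U >>.

Definition measurable_process (U : R -> T -> nat) : Prop :=
  measurable_fun ([set t : R | 0 <= t] `*` [set: T])
    (fun p : R * T => U p.1 p.2).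

(* Equality of the laws on the path space, for the cylinder sigma-algebra. *)
Definition same_law (U V : R -> T -> nat) : Prop :=
  forall C : set (R -> nat),
  <<s preimages [set t | 0 <= t] (fun (t : R) (path : R -> nat) => path t) >> C ->
  P [set w | C (U ^~ w)] = P [set w | C (V ^~ w)].

Record unit_poisson_process (U : R -> T -> nat) : Prop := UnitPoissonProcess {
  poisson_measurable : forall t : R, 0 <= t -> measurable_fun [set: T] (U t);
  poisson_start : forall w, U 0 w = 0%N;
  poisson_monotone : forall w (s t : R), 0 <= s -> s <= t -> (U s w <= U t w)%N;
  poisson_right_continuous : forall w (t : R), 0 <= t ->
    \forall s \near t^'+, U s w = U t w;
  poisson_increment_law : forall (s t : R) k, 0 <= s -> s < t ->
    P [set w | (U t w - U s w)%N = k] = (poisson_pmf (t - s) k)%:E;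
  poisson_independent_increments : forall s t : R, 0 <= s -> s <= t ->
    independent_set_systems
      <<s preimages [set u | 0 <= u <= s] U >>
      (g_sigma_algebra_preimage (fun w => U t w - U s w)%N)
}.

End probability_notions.

Section controlled_network.
Context {R : realType}.

(* A probability space with the driving processes, the state process and the
   scheduling policy; no relation between them is imposed here. *)
Record system := System {
  sys_display : measure_display;
  Omega : measurableType sys_display;
  Pr : probability Omega R;
  driver : flow -> R -> Omega -> nat;
  X : class -> R -> Omega -> nat;
  Z : activity -> R -> Omega -> nat
}.

Arguments Pr : clear implicits.
Arguments driver : clear implicits.
Arguments X : clear implicits.
Arguments Z : clear implicits.

Variables (nw : network R) (S : system).

Definition Q (i : class) (t : R) (w : Omega S) : int :=
  queue (fun k => X S k t w) (fun a => Z S a t w) i.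

(* Operational time of a flow: its driver is read at clock f t. *)
Definition clock (f : flow) (t : R) (w : Omega S) : R :=
  match f with
  | arrival i => arrival_rate nw i * t
  | service a => service_rate nw a *
      \int[lebesgue_measure]_(s in `[0, t]) (Z S a s w)%:R
  | abandonment i => abandonment_rate nw i *
      \int[lebesgue_measure]_(s in `[0, t]) (Q i s w)%:~R
  end.

Definition counts (f : flow) (t : R) (w : Omega S) : nat :=
  driver S f (clock f t w) w.

(* For arrivals this is counts (t + r) - counts t. The subtraction is never
   truncated for r >= 0, drivers being nondecreasing. *)
Definition increment (f : flow) (t r : R) (w : Omega S) : nat :=
  (driver S f (clock f t w + rate nw f * r) w - driver S f (clock f t w) w)%N.

(* Independence of the drivers from X(0) is implied by X(0) being
   deterministic. Joint measurability of X and Z is what gives a meaning to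
   the time integrals of Z and Q and to the expected costs. *)
Record network_dynamics : Prop := NetworkDynamics {
  driver_poisson : forall f, unit_poisson_process (Pr S) (driver S f);
  driver_independent :
    mutually_independent (Pr S) (fun f => process_sigma (driver S f));
  X_measurable : forall i, measurable_process (X S i);
  Z_measurable : forall a, measurable_process (Z S a);
  X_deterministic_start : forall i, exists x0 : nat, forall w, X S i 0 w = x0;
  X_balance : forall i (t : R) w, 0 <= t ->
    (X S i t w)%:Z = (X S i 0 w)%:Z + (counts (arrival i) t w)%:Z
      - (\sum_(a | class_of a == i) (counts (service a) t w)%:Z)
      - (counts (abandonment i) t w)%:Z
}.

(* Completion is by the null events of the underlying probability space. *)
Definition history (t : R) : set (set (Omega S)) :=
  <<s preimages [set: class] (fun i => X S i 0)
      `|` preimages [set fs : flow * R | 0 <= fs.2 <= t]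
            (fun fs => counts fs.1 fs.2)
      `|` [set A | measurable A /\ Pr S A = 0%E] >>.

Definition future (t : R) : set (set (Omega S)) :=
  <<s preimages [set fr : flow * R | 0 <= fr.2]
        (fun fr => increment fr.1 t fr.2) >>.

Record admissible : Prop := Admissible {
  Z_work_conserving : forall (t : R) w, 0 <= t ->
    work_conserving (servers nw) (fun i => X S i t w) (fun a => Z S a t w);
  Z_adapted : forall a (t : R), 0 <= t ->
    g_sigma_algebra_preimage (Z S a t) `<=` history t;
  history_future : forall t : R, 0 <= t ->
    independent_set_systems (Pr S) (history t) (future t);
  service_law : forall a (t : R), 0 <= t ->
    same_law (Pr S) (increment (service a) t)
      (fun r => driver S (service a) (service_rate nw a * r));
  abandonment_law : forall i (t : R), 0 <= t ->
    same_law (Pr S) (increment (abandonment i) t)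
      (fun r => driver S (abandonment i) (abandonment_rate nw i * r))
}.

Definition ergodic_mean (g : R -> Omega S -> R) : \bar R :=
  limf_esup (fun T : R => (T^-1)%:E *
    \int[Pr S]_w \int[lebesgue_measure]_(s in `[0%R, T]) (g s w)%:E)%E
    (pinfty_nbhs R).

Variable n : nat.

Definition X_hat (L : limit_parameters R) (i : class) (t : R) (w : Omega S) : R
  := ((X S i t w)%:R - n%:R * fluid_equilibrium L i) / Num.sqrt n%:R.

Definition X_hat_norm (L : limit_parameters R) (t : R) (w : Omega S) : R :=
  Num.sqrt (\sum_i X_hat L i t w ^+ 2).

Definition state_cost (m : R) (L : limit_parameters R) : \bar R :=
  ergodic_mean (fun s w => X_hat_norm L s w `^ m).

Definition Q_hat (i : class) (t : R) (w : Omega S) : R :=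
  (Q i t w)%:~R / Num.sqrt n%:R.

Definition running_cost (m : R) (xi q : class -> R) : R :=
  \sum_i xi i * q i `^ m.

Definition J (m : R) (xi : class -> R) : \bar R :=
  ergodic_mean (fun s w => running_cost m xi (fun i => Q_hat i s w)).

End controlled_network.
Arguments system : clear implicits.

(* Main.v *)
Require Import Defs.
From mathcomp Require Import all_boot all_order all_algebra.
From mathcomp Require Import all_classical all_reals all_analysis.
From mathcomp Require Import measurable_realfun zify ring lra.

(** The bound holds path by path, up to Poisson noise. Centre the state at its
    fluid equilibrium, x_i = X_i - n * x_i^*, and let y be the number of idle
    servers of pool 1. Writing the numbers of busy servers in terms of states
    and queues, the balance equations read, for t <= s,
      x_2(s) = x_2(t) - mu_22 * int x_2 + error,
      x_1(s) = x_1(t) - mu_12 * int x_1 - (mu_12 - mu_11) * int y + error,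
    where the integrals are over [t, s] and the errors consist of Poisson
    noise, of O(sqrt n) defects of the fluid balance, and of terms of the size
    of the integrals of the queues. Queues and idle servers being nonnegative,
      0 <= y <= q_1 + q_2 - x_1 - x_2 + O(sqrt n).
    Hence, apart from queues and x_2, y lies between 0 and the negative part
    of x_1, so that x_1 is restored at a rate between mu_11 and mu_12 at all
    times. Consequently V = |x_1| + K * |x_2| contracts over time windows of a
    short length h independent of n,
      V(t + h) <= theta * V(t) + C * (sqrt n * noise + int (q_1 + q_2)),
    and a similar bound holds for the supremum of |x_1| + |x_2| over the window
    ([window_contraction], [system_window]).

    The noise of a window is that of the driving processes, restarted at their
    operational clocks. For an admissible policy the increments of a restarted
    driver are Poisson, although the clock is random and depends on the policy.
    The clocks of arrivals and services advance by O(n) in a window, so it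
    suffices to bound the supremum of |D(r) - r| for r <= 2^J with 2^J of order
    n. Dyadic chaining does this by sqrt n times a variable whose moments are
    bounded uniformly in n and t ([dyadic_maximal_monotone],
    [expectation_dyadic_excess]): it reduces the supremum to a sum over single
    increments, whose laws are known. The clock of an abandonment flow is a
    multiple of the integral of a queue, for which there is no bound in terms
    of n; but the count exceeds a large multiple of that integral with
    exponentially small probability ([overshoot_bound], [expectation_exp_overshoot]).

    By convexity the contraction passes to m-th powers ([window_power]). Summed
    over the windows of [0, T], the powers of V telescope. In expectation this
    bounds the integral of |Xhat|^m by the sum of a term from the initial
    state, a multiple of T + 1 and a multiple of the expected integral of the
    powers of the queues ([expected_power_bound]). The running cost dominates
    the latter since the weights xi_i are positive, and division by T removes
    the initial state ([ergodic_limit]).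

    The constants involve the network only through the bounds collected in
    [well_scaled], which hold from some index on with the same c and B
    ([well_scaled_eventually]). Each of the remaining indices n has a constant
    of its own: |Xhat| <= Qhat_1 + Qhat_2 + const, since the number of servers
    is finite ([bounded_total_single]). There are finitely many of them. *)

Set Implicit Arguments.
Unset Strict Implicit.
Unset Printing Implicit Defensive.

Import Order.TTheory GRing.Theory Num.Theory.
Import numFieldNormedType.Exports.
Local Open Scope classical_set_scope.
Local Open Scope ring_scope.

(** * Power inequalities *)

Section real_inequalities.
Context {R : realType}.
Implicit Types (m x y a b c t : R).

Lemma le_powRD m a b : 0 <= m -> 0 <= a -> 0 <= b ->
  (a + b) `^ m <= 2 `^ m * (a `^ m + b `^ m).
Proof.
move=> m0 a0 b0; wlog ab : a b a0 b0 / a <= b => [H|].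
  case: (leP a b) => [|/ltW] ab; first exact: H.
  by rewrite addrC (addrC (a `^ m)); exact: H.
rewrite (@le_trans _ _ ((2 * b) `^ m))//.
  by rewrite ge0_ler_powR ?nnegrE ?addr_ge0 ?mulr_ge0//; lra.
rewrite powRM// ler_wpM2l ?powR_ge0//.
by rewrite lerDr powR_ge0.
Qed.

(** The summand 1 covers the empty sum with m = 0, where 0 `^ 0 = 1. *)
Lemma le_powR_sum (I : Type) (s : seq I) (F : I -> R) m : 0 <= m ->
  (forall i, 0 <= F i) ->
  (\sum_(i <- s) F i) `^ m <= 2 `^ (m *+ size s) * (1 + \sum_(i <- s) F i `^ m).
Proof.
move=> m0 F0; elim: s => [|i s IH].
  rewrite !big_nil addr0 mulr1 /= mulr0n powRr0.
  by have [->|/powR0->] := eqVneq m 0; rewrite ?powRr0.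
rewrite !big_cons /= [m *+ _]mulrS powRD; last by apply/implyP => _; rewrite pnatr_eq0.
apply: le_trans (le_powRD m0 (F0 i) _) _; first exact: sumr_ge0.
rewrite -mulrA ler_wpM2l ?powR_ge0//.
rewrite addrCA mulrDr lerD//.
rewrite -[leLHS]mul1r ler_wpM2r ?powR_ge0//.
by rewrite -[leLHS](powRr0 2) ler_powR// ?mulrn_wge0// ler1n.
Qed.

(** Convexity of the power at t * a + (1 - t) * (b / (1 - t)). The coefficient
    of the power of a is t itself, so that a contraction of a quantity remains
    one for its m-th power. *)
Lemma powR_contraction m t a b : 1 <= m -> 0 < t < 1 -> 0 <= a -> 0 <= b ->
  (t * a + b) `^ m <= t * a `^ m + (1 - t) `^ (1 - m) * b `^ m.
Proof.
move=> m1 /andP[t0 t1] a0 b0.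
have t1' : 0 < 1 - t by rewrite subr_gt0.
have c0 : 0 <= b / (1 - t) by rewrite divr_ge0// ltW.
have tI : 0 <= t <= 1 by rewrite !ltW.
have onemK' : 1 - (1 - t) = t by rewrite opprB addrC subrK.
pose u := Itv01 (ltW t0) (ltW t1).
have := convex_powR m1 u (x := a) (y := b / (1 - t)).
rewrite !inE /= !in_itv /= !andbT => /(_ a0 c0).
rewrite convRE [X in X `^ _ <= _ -> _]convRE /= /unstable.onem.
rewrite (mulrC (1 - t) (b / _)) divfK ?gt_eqF// => /le_trans; apply.
rewrite lerD2l powRM ?invr_ge0 ?(ltW t1')// -powR_inv1 ?(ltW t1')// -powRrM mulN1r.
rewrite mulrCA -{1}(powRr1 (ltW t1')) -powRD; last by rewrite (gt_eqF t1') implybT.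
by rewrite mulrC.
Qed.

Lemma le_pow_expR (p : nat) x : 0 <= x -> x ^+ p <= p`!%:R * expR x.
Proof.
move=> x0; case: p => [|p].
  by rewrite expr0 mul1r (le_trans _ (expR_ge1Dx _))// lerDl.
rewrite mulrC -ler_pdivrMr ?ltr0n ?fact_gt0//.
by rewrite (le_trans _ (expR_ge1Dxn p x0))// lerDr.
Qed.

(** From (1 - x) * expR x <= 1, since (1 - x) * (1 + x + 2 * x ^ 2) exceeds 1 by
    x ^ 2 * (1 - 2 * x). *)
Lemma expR_le_quad x : `|x| <= 2^-1 -> expR x <= 1 + x + 2 * x ^+ 2.
Proof.
rewrite ler_norml => /andP[x1 x2].
have := expR_ge1Dx (- x); rewrite expRN => h.
have e0 := expR_gt0 x.
have : (1 - x) * expR x <= 1.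
  by rewrite -ler_pdivlMr// mul1r.
move=> {}h; have: (1 - x) * expR x <= (1 - x) * (1 + x + 2 * x ^+ 2).
  apply: (le_trans h); rewrite -subr_ge0.
  have -> : (1 - x) * (1 + x + 2 * x ^+ 2) - 1 = x ^+ 2 * (1 - 2 * x) by ring.
  by rewrite mulr_ge0 ?sqr_ge0//; lra.
by rewrite ler_pM2l//; lra.
Qed.

(** For x > c the second summand is x * (x / c) ^ (m - 1) >= x. Being linear in
    x `^ m, the bound can be integrated; with c proportional to the mean of x it
    replaces Jensen's inequality, up to a constant. *)
Lemma le_truncated_powR m c x : 1 <= m -> 0 < c -> 0 <= x ->
  x <= c + x `^ m * c `^ (1 - m).
Proof.
move=> m1 c0 x0; have [xc|cx] := leP x c.
  by rewrite ler_wpDr// mulr_ge0 ?powR_ge0.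
have x0' : 0 < x by exact: lt_trans cx.
rewrite ler_wpDl ?(ltW c0)//.
have e : x = x `^ m * x `^ (1 - m).
  by rewrite -powRD ?(gt_eqF x0') ?implybT// subrKC powRr1.
rewrite {1}e ler_wpM2l ?powR_ge0//.
rewrite -(opprB m 1) !powRN lef_pV2 ?posrE ?powR_gt0//.
by rewrite ge0_ler_powR ?nnegrE ?subr_ge0 ?(ltW c0) ?(ltW x0') ?(ltW cx).
Qed.

End real_inequalities.

(** * Moments of a Poisson variable *)

Section poisson_moments.
Context {R : realType} {d : measure_display} {T : measurableType d}
  (P : probability T R).
Implicit Types (N : T -> nat) (a z : R).

Lemma poisson_generating_function N a z : measurable_fun setT N ->
  0 < a -> 0 < z ->
  (forall k, P [set w | N w = k] = (poisson_pmf a k)%:E) ->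
  (\int[P]_w (z ^+ N w)%:E = (expR (a * (z - 1)))%:E)%E.
Proof.
move=> mN a0 z0 PN.
have mNk k : measurable (N @^-1` [set k]) by rewrite -[X in measurable X]setTI; exact: mN.
have mzN : measurable_fun setT (fun w => z ^+ N w).
  exact: (@measurableT_comp _ _ _ _ _ _ (fun k => z ^+ k)).
rewrite (_ : [set: T] = \bigcup_k (N @^-1` [set k])); last first.
  by apply/seteqP; split => // w _; exists (N w).
rewrite ge0_integral_bigcup//; first last.
- exact: trivIset_preimage1.
- by move=> w _; rewrite lee_fin exprn_ge0// ltW.
- exact/measurable_EFinP/measurable_funTS.
transitivity (\sum_(0 <= k <oo) ((expR (- a))%:E * ((a * z) ^+ k / k`!%:R)%:E))%E.
  apply: eq_eseriesr => k _.
  rewrite (eq_integral (fun=> (z ^+ k)%:E)); last first.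
    by move=> w; rewrite inE /= => ->.
  rewrite integral_cst//.
  transitivity ((z ^+ k)%:E * (poisson_pmf a k)%:E)%E; first by congr (_ * _)%E; exact: PN.
  rewrite -!EFinM /poisson_pmf a0 exprMn; congr EFin.
  by ring.
rewrite nneseriesZl; last first.
  by move=> k _; rewrite lee_fin divr_ge0// exprn_ge0// ltW// mulr_gt0.
rewrite (_ : a * (z - 1) = - a + a * z); last by ring.
rewrite expRD EFinM; congr (_ * _)%E.
rewrite expRE -EFin_lim; last first.
  rewrite /pseries/=; under eq_fun do rewrite mulrC.
  exact: is_cvg_series_exp_coeff.
apply/congr_lim/funext => n/=; rewrite /pseries/= /series/= -sumEFin//.
by under eq_bigr do rewrite mulrC.
Qed.

(** For e = 1 / (2 * sqrt a) or its opposite, the centred variable N - a has E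
    exp (e * (N - a)) = exp (a * (expR e - 1 - e)) <= exp (2 * a * e ^ 2), which
    does not depend on a. The moments follow from x ^ p <= p! * exp x. *)
Lemma poisson_centered_moment N a (p : nat) : measurable_fun setT N ->
  1 <= a ->
  (forall k, P [set w | N w = k] = (poisson_pmf a k)%:E) ->
  (\int[P]_w ((`|(N w)%:R - a| / Num.sqrt a) ^+ p)%:E
     <= (2 ^+ p * p`!%:R * (2 * expR 1))%:E)%E.
Proof.
move=> mN a1 PN.
have a0 : 0 < a by exact: lt_le_trans a1.
have s1 : 1 <= Num.sqrt a by rewrite -[leLHS]sqrtr1 ler_wsqrtr.
have s0 : 0 < Num.sqrt a by exact: lt_le_trans s1.
pose t := (2 * Num.sqrt a)^-1.
have t0 : 0 < t by rewrite invr_gt0 mulr_gt0.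
have mexp (c e : R) : measurable_fun [set: T] (fun w => expR c * expR e ^+ N w).
  exact: (@measurableT_comp _ _ _ _ _ _ (fun k => expR c * expR e ^+ k)).
have mgf (e : R) : `|e| = t ->
    (\int[P]_w ((expR (- (a * e)) * expR e ^+ N w)%:E) <= (expR 1)%:E)%E.
  move=> et; under eq_integral do rewrite EFinM.
  rewrite ge0_integralZl_EFin//=; first last.
  - by apply/measurable_EFinP; exact: (@measurableT_comp _ _ _ _ _ _ (fun k => expR e ^+ k)).
  rewrite (poisson_generating_function mN a0 (expR_gt0 e) PN) -EFinM lee_fin.
  rewrite -expRD ler_expR.
  have e2 : a * e ^+ 2 = 4^-1.
    rewrite -real_normK ?num_real// et /t exprVn exprMn sqr_sqrtr ?ltW//.
    by rewrite invfM mulrCA mulfV ?gt_eqF// mulr1 -natrX.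
  have eh : `|e| <= 2^-1.
    by rewrite et /t lef_pV2 ?posrE ?mulr_gt0// ler_peMr.
  have := expR_le_quad eh; rewrite -(ler_pM2l a0) => h.
  have -> : - (a * e) + a * (expR e - 1) = a * expR e - a * (1 + e) by ring.
  rewrite lerBlDr (le_trans h)//.
  have -> : a * (1 + e + 2 * e ^+ 2) = 2 * (a * e ^+ 2) + a * (1 + e) by ring.
  by rewrite lerD2r e2; lra.
apply: (@le_trans _ _ (\int[P]_w ((2 ^+ p * p`!%:R)%:E *
  ((expR (- (a * t)) * expR t ^+ N w)%:E +
   (expR (- (a * (- t))) * expR (- t) ^+ N w)%:E)))%E).
  apply: ge0_le_integral => //.
  - apply/measurable_EFinP.
    exact: (@measurableT_comp _ _ _ _ _ _ (fun k : nat => (`|k%:R - a| / Num.sqrt a) ^+ p)).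
  - apply/measurable_EFinP/measurable_funM => //.
    by apply: measurable_funD; exact: mexp.
  - move=> w _; rewrite -EFinD -EFinM lee_fin.
    have -> : (`|(N w)%:R - a| / Num.sqrt a) ^+ p =
        2 ^+ p * (`|t * ((N w)%:R - a)|) ^+ p.
      rewrite -exprMn normrM (gtr0_norm t0) /t; congr (_ ^+ _).
      by rewrite invfM; field; rewrite gt_eqF.
    rewrite -mulrA ler_wpM2l ?exprn_ge0//.
    rewrite (le_trans (le_pow_expR _ (normr_ge0 _)))// ler_wpM2l//.
    rewrite -!expRM_natr -!expRD.
    have [x0|x0] := ger0P (t * ((N w)%:R - a)).
      rewrite (_ : _ + t * _ = t * ((N w)%:R - a)); last by ring.
      by rewrite lerDl expR_ge0.
    rewrite (_ : - (a * - t) + _ = - (t * ((N w)%:R - a))); last by ring.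
    by rewrite lerDr expR_ge0.
rewrite ge0_integralZl_EFin//; first last.
- by apply/measurable_EFinP/measurable_funD; exact: mexp.
- by move=> w _; rewrite adde_ge0// lee_fin mulr_ge0 ?exprn_ge0 ?expR_ge0.
rewrite [leRHS]EFinM lee_wpmul2l ?lee_fin ?mulr_ge0 ?exprn_ge0//.
rewrite ge0_integralD//; first last.
- exact/measurable_EFinP/mexp.
- exact/measurable_EFinP/mexp.
rewrite [2 * _]mulr_natl mulr2n EFinD; apply: leeD; apply: mgf.
  by rewrite gtr0_norm.
by rewrite normrN gtr0_norm.
Qed.

End poisson_moments.

(** * Dyadic chaining *)

Section chaining.
Context {R : realType}.
Implicit Types (f c : nat -> R) (p J : nat).

(** Go from k down to 0 by clearing its binary digits, lowest first: each scale
    contributes at most one increment. *)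
Lemma dyadic_chaining c J f :
  (forall j i, (j <= J)%N -> (i < 2 ^ (J - j))%N ->
     `|f (i.+1 * 2 ^ j)%N - f (i * 2 ^ j)%N| <= c j) ->
  forall k, (k <= 2 ^ J)%N -> `|f k - f 0%N| <= \sum_(j < J.+1) c j.
Proof.
elim: J c f => [|J IH] c f fc k.
  rewrite expn0 leq_eqVlt ltnS leqn0 big_ord1 /= => /orP[|] /eqP ->.
    by have := fc 0%N 0%N (leqnn _); rewrite expn0 => /(_ isT).
  rewrite subrr normr0.
  by have := fc 0%N 0%N (leqnn _); rewrite expn0 => /(_ isT); apply: le_trans.
move=> kJ; rewrite big_ord_recl /=.
have c0 i : (i < 2 ^ J.+1)%N -> `|f i.+1 - f i| <= c 0%N.
  by move=> iJ; have := fc 0%N i isT; rewrite subn0 expn0 !muln1 => /(_ iJ).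
(* The lowest digit of k; the others are handled at step 2. *)
have hk : `|f k - f (k./2 * 2)%N| <= c 0%N.
  rewrite -{1}(odd_double_half k) -muln2.
  case: (boolP (odd k)) => ok; last first.
    rewrite add0n subrr normr0.
    by apply: le_trans (c0 0%N _); rewrite ?expn_gt0.
  rewrite add1n; apply: c0.
  rewrite (leq_trans _ kJ)// -[leqRHS](odd_double_half k) ok muln2 add1n//.
have hg : `|f (k./2 * 2)%N - f (0 * 2)%N| <= \sum_(j < J.+1) c (lift ord0 j).
  apply: (IH (fun j => c j.+1) (fun i => f (i * 2)%N)).
    move=> j i jJ iJ; have := fc j.+1 i jJ.
    by rewrite subSS => /(_ iJ); rewrite expnSr !mulnA.
  by rewrite -(leq_pmul2r (ltn0Sn 1)) -expnSr muln2 (leq_trans _ kJ)//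
    -[leqRHS](odd_double_half k) leq_addl.
rewrite mul0n in hg.
by rewrite -(subrKA (f (k./2 * 2)%N)) (le_trans (ler_normD _ _))// lerD.
Qed.

(** Scale j of the chaining has weight root4_2 ^ (J + j), which lies between the
    size sqrt (2 ^ j) = root4_2 ^ (j + j) of an increment over 2 ^ j steps and
    the target sqrt (2 ^ J). The p-th power of an increment, normalised by its
    weight, is of order root4_2 ^ (- p * (J - j)); for p >= 8 this outweighs the
    number 2 ^ (J - j) of increments of the scale. The weights themselves add up
    to O(sqrt (2 ^ J)). *)
Definition root4_2 : R := Num.sqrt (Num.sqrt 2).
Local Notation beta := root4_2.

(** The value 11 / 10 is what the induction in [sum_root4_2] takes: 11 + root4_2
    <= 11 * root4_2. *)
Lemma root4_2_ge : 11 / 10 <= beta.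
Proof.
rewrite /root4_2.
have h (x y : R) : 0 <= y -> y ^+ 2 <= x -> y <= Num.sqrt x.
  by move=> y0 yx; rewrite -(ger0_norm y0) -sqrtr_sqr ler_wsqrtr.
by apply: (h); [lra|apply: (h); lra].
Qed.

Lemma root4_2_gt0 : 0 < beta.
Proof. by apply: lt_le_trans root4_2_ge; lra. Qed.

Lemma sqr_root4_2 : beta ^+ 2 = Num.sqrt 2.
Proof. by rewrite /root4_2 sqr_sqrtr// sqrtr_ge0. Qed.

Lemma sqrt_pow2 J : Num.sqrt (2 ^+ J) = beta ^+ (J + J).
Proof.
have b2 : 2 = (beta ^+ 2) ^+ 2 :> R by rewrite sqr_root4_2 sqr_sqrtr.
rewrite [in LHS]b2 -!exprM (_ : (2 * 2 * J = (J + J) * 2)%N); last by lia.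
by rewrite exprM sqrtr_sqr ger0_norm// exprn_ge0// ltW// root4_2_gt0.
Qed.

(** A sum stands in for the maximum over all scales and positions, since its
    expectation is computed termwise. *)
Definition dyadic_excess p J f : R :=
  \sum_(j < J.+1) \sum_(i < 2 ^ (J - j))
     (`|f (i.+1 * 2 ^ j)%N - f (i * 2 ^ j)%N| / beta ^+ (J + j)) ^+ p.

Lemma dyadic_excess_ge0 p J f : 0 <= dyadic_excess p J f.
Proof.
apply: sumr_ge0 => j _; apply: sumr_ge0 => i _.
by rewrite exprn_ge0// divr_ge0// exprn_ge0// ltW// root4_2_gt0.
Qed.

Lemma sum_root4_2 J : \sum_(j < J.+1) beta ^+ j <= 11 * beta ^+ J.
Proof.
have b1 := root4_2_ge.
elim: J => [|J IH]; first by rewrite big_ord1 expr0; lra.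
rewrite big_ord_recr /= (le_trans (lerD IH (lexx _)))// exprS.
have : 0 <= beta ^+ J by rewrite exprn_ge0// ltW// root4_2_gt0.
by nra.
Qed.

Lemma dyadic_maximal p J f : (0 < p)%N ->
  exists w, [/\ 0 <= w, w ^+ p <= dyadic_excess p J f &
    forall k, (k <= 2 ^ J)%N ->
      `|f k - f 0%N| <= 11 * Num.sqrt (2 ^+ J) * w].
Proof.
move=> p0; set e := dyadic_excess p J f.
have e0 : 0 <= e := dyadic_excess_ge0 p J f.
have wp : (e `^ (p%:R^-1)) ^+ p = e.
  by rewrite -powR_mulrn ?powR_ge0// -powRrM mulVf ?powRr1// pnatr_eq0 -lt0n.
(* Every normalised increment is at most the p-th root of the excess, being a
   term of it. *)
exists (e `^ (p%:R^-1)); split; rewrite ?powR_ge0 ?wp//.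
set w := e `^ _ in wp *.
have w0 : 0 <= w by exact: powR_ge0.
have b0 := root4_2_gt0.
move=> k kJ; have := @dyadic_chaining (fun j => beta ^+ (J + j) * w) J f.
move=> /(_ _ k kJ) h; apply: (le_trans (h _)).
  move=> j i jJ iJ; rewrite mulrC -ler_pdivrMr ?exprn_gt0//.
  rewrite -(@ler_pXn2r _ p)// ?nnegrE//; last first.
    by rewrite divr_ge0// exprn_ge0// ltW.
  rewrite wp /e /dyadic_excess.
  have t0 (j' i' : nat) :
      0 <= (`|f (i'.+1 * 2 ^ j')%N - f (i' * 2 ^ j')%N| / beta ^+ (J + j')) ^+ p.
    by rewrite exprn_ge0// divr_ge0// exprn_ge0// ltW.
  have jJ' : (j < J.+1)%N by [].
  rewrite (bigD1 (Ordinal jJ'))//= (bigD1 (Ordinal iJ))//= -addrA lerDl.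
  by rewrite addr_ge0// ?sumr_ge0// => ? _; rewrite sumr_ge0.
rewrite -mulr_suml ler_wpM2r// sqrt_pow2.
under eq_bigr do rewrite exprD.
rewrite -mulr_sumr exprD mulrCA ler_wpM2l ?exprn_ge0 ?(ltW b0)//.
exact: sum_root4_2.
Qed.

(** Between consecutive integers both D and r grow monotonically, whence an
    error of at most 1: the integers control all real r. *)
Lemma dyadic_maximal_monotone p J (D : R -> nat) : (0 < p)%N ->
  (forall r s, 0 <= r -> r <= s -> (D r <= D s)%N) ->
  exists w, [/\ 0 <= w,
    w ^+ p <= dyadic_excess p J (fun k => (D k%:R)%:R - k%:R) &
    forall r, 0 <= r -> r <= 2 ^+ J ->
      `|(D r)%:R - (D 0)%:R - r| <= 11 * Num.sqrt (2 ^+ J) * w + 1].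
Proof.
move=> p0 Dmono; have [w [w0 wp wk]] :=
  dyadic_maximal J (fun k => (D k%:R)%:R - k%:R) p0.
exists w; split => // r r0 rJ.
have [->|r1] := eqVneq r (2 ^+ J).
  have := wk _ (leqnn (2 ^ J)); rewrite natrX !subr0 => h.
  rewrite (le_trans _ (le_trans h _))//; last by rewrite lerDl.
  by rewrite addrAC lexx.
have {r1 rJ}rJ : r < 2 ^+ J by rewrite lt_neqAle r1.
set k := Num.truncn r.
have kr : k%:R <= r by rewrite truncn_le.
have rk : r < k.+1%:R by rewrite truncnS_gt.
have kJ : (k.+1 <= 2 ^ J)%N.
  by rewrite -(ltr_nat R) natrX (le_lt_trans kr).
have := wk k (ltnW kJ); have := wk k.+1 kJ.
rewrite /= !subr0 !ler_norml.
have : ((D k%:R)%:R <= (D r)%:R :> R) by rewrite ler_nat Dmono.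
have : ((D r)%:R <= (D k.+1%:R)%:R :> R) by rewrite ler_nat Dmono// ltW.
move: rk; rewrite -natr1.
by move=> *; lra.
Qed.

End chaining.

(** * Fluctuations and overshoots of Poisson increments *)

Section noise_expectations.
Context {R : realType} {d : measure_display} {T : measurableType d}
  (P : probability T R).

Definition poisson_moment_bound (p : nat) : R := 2 ^+ p * p`!%:R * (2 * expR 1).

Lemma measurable_dyadic_excess (D : nat -> T -> nat) p J :
  (forall k, measurable_fun setT (D k)) ->
  measurable_fun setT
    (fun w => dyadic_excess p J (fun k => (D k w)%:R - k%:R : R)).
Proof.
move=> mD; apply: measurable_sum => j; apply: measurable_sum => i.
apply: measurable_funX; apply: measurable_funM => //.
apply: measurableT_comp => //.
have mf k : measurable_fun setT (fun w => (D k w)%:R - k%:R : R).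
  exact: (@measurableT_comp _ _ _ _ _ _ (fun l : nat => l%:R - k%:R : R)).
exact: measurable_funB.
Qed.

Lemma sum_halves n : \sum_(k < n) (2^-1 : R) ^+ k <= 2.
Proof.
suff -> : \sum_(k < n) (2^-1 : R) ^+ k = 2 - 2 * 2^-1 ^+ n.
  by rewrite gerBl mulr_ge0// exprn_ge0.
elim: n => [|n IH]; first by rewrite big_ord0 expr0 mulr1 subrr.
by rewrite big_ord_recr /= IH exprS; field.
Qed.

(** An increment over 2 ^ j steps has moment at most poisson_moment_bound p
    after division by sqrt (2 ^ j). Its weight is larger by the factor root4_2 ^
    (J - j), whose p-th power is at least 4 ^ (J - j) as root4_2 ^ 8 = 4. Over
    the 2 ^ (J - j) increments of the scale this leaves 2 ^ - (J - j), summable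
    in j. *)
Lemma expectation_dyadic_excess (D : nat -> T -> nat) p J : (8 <= p)%N ->
  (forall k, measurable_fun setT (D k)) ->
  (forall w k l, (k <= l)%N -> (D k w <= D l w)%N) ->
  (forall k l n, (k < l)%N ->
    P [set w | (D l w - D k w)%N = n] = (poisson_pmf (l - k)%:R n)%:E) ->
  (\int[P]_w (dyadic_excess p J (fun k => (D k w)%:R - k%:R))%:E <=
    (2 * poisson_moment_bound p)%:E)%E.
Proof.
move=> p8 mD Dmono DP.
have b0 := @root4_2_gt0 R.
have C0 : 0 <= poisson_moment_bound p.
  by rewrite !mulr_ge0 ?exprn_ge0 ?expR_ge0.
pose G (j i : nat) (w : T) : R := (`|(D (i.+1 * 2 ^ j)%N w)%:R - (i.+1 * 2 ^ j)%:R -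
  ((D (i * 2 ^ j)%N w)%:R - (i * 2 ^ j)%:R)| / @root4_2 R ^+ (J + j)) ^+ p.
have G0 j i w : 0 <= G j i w.
  by rewrite exprn_ge0// divr_ge0// exprn_ge0// ltW.
have mG j i : measurable_fun setT (G j i).
  apply: measurable_funX; apply: measurable_funM => //.
  apply: measurableT_comp => //.
  have mf k : measurable_fun setT (fun w => (D k w)%:R - k%:R : R).
    exact: (@measurableT_comp _ _ _ _ _ _ (fun l : nat => l%:R - k%:R : R)).
  exact: measurable_funB.
have EG (j : 'I_J.+1) (i : 'I_(2 ^ (J - j))) :
    (\int[P]_w (G j i w)%:E <=
     (poisson_moment_bound p * (4^-1) ^+ (J - j))%:E)%E.
  set a := (2 ^+ j : R).
  have a1 : 1 <= a by rewrite exprn_ege1// ler1n.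
  have sa : Num.sqrt a = @root4_2 R ^+ (j + j) by exact: sqrt_pow2.
  pose N w := (D (i.+1 * 2 ^ j)%N w - D (i * 2 ^ j)%N w)%N.
  have ij : (i * 2 ^ j < i.+1 * 2 ^ j)%N by rewrite ltn_pmul2r ?expn_gt0.
  have mN : measurable_fun setT N.
    exact: measurable_fun_subn.
  have PN n : P [set w | N w = n] = (poisson_pmf a n)%:E.
    by rewrite DP// -mulnBl subSnn mul1n natrX.
  have Ja : (j <= J)%N by rewrite -ltnS.
  have bn : 1 <= @root4_2 R ^+ (J - j).
    by rewrite exprn_ege1// (le_trans _ (@root4_2_ge R))//; lra.
  have b8 : @root4_2 R ^+ 8 = 4.
    rewrite (exprM _ 2 4) sqr_root4_2 (exprM _ 2 2) sqr_sqrtr//; ring.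
  apply: (@le_trans _ _ (\int[P]_w (((4^-1) ^+ (J - j))%:E *
      ((`|(N w)%:R - a| / Num.sqrt a) ^+ p)%:E))%E).
    apply: ge0_le_integral => //.
    - by move=> w _; rewrite lee_fin.
    - exact/measurable_EFinP.
    - apply/measurable_EFinP/measurable_funM => //.
      exact: (@measurableT_comp _ _ _ _ _ _ (fun k : nat => (`|k%:R - a| / Num.sqrt a) ^+ p)).
    - move=> w _; rewrite lee_fin /G.
      have -> : (D (i.+1 * 2 ^ j)%N w)%:R - (i.+1 * 2 ^ j)%:R -
          ((D (i * 2 ^ j)%N w)%:R - (i * 2 ^ j)%:R) = (N w)%:R - a.
        rewrite /N natrB ?Dmono 1?ltnW// mulSn natrD natrX -/a; ring.
      rewrite (_ : (J + j = (J - j) + (j + j))%N); last by lia.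
      rewrite exprD invfM mulrCA -sa exprMn ler_wpM2r//.
      apply: (@le_trans _ _ ((@root4_2 R ^+ (J - j))^-1 ^+ 8)).
        by rewrite ler_wiXn2l// ?invr_ge0 ?exprn_ge0 ?(ltW b0)// invf_le1// exprn_gt0.
      by rewrite exprVn -exprM mulnC exprM b8 exprVn.
  rewrite ge0_integralZl_EFin//; first last.
  - apply/measurable_EFinP.
    exact: (@measurableT_comp _ _ _ _ _ _ (fun k : nat => (`|k%:R - a| / Num.sqrt a) ^+ p)).
  rewrite [leRHS]EFinM muleC lee_wpmul2r ?lee_fin ?exprn_ge0//.
  exact: poisson_centered_moment.
rewrite [leLHS](_ : _ =
  \sum_(j < J.+1) \sum_(i < 2 ^ (J - j)) \int[P]_w (G j i w)%:E)%E; last first.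
  under eq_integral do rewrite -sumEFin.
  rewrite ge0_integral_sum//; first last.
    by move=> j w _; rewrite lee_fin; apply: sumr_ge0 => i _; exact: G0.
    by move=> j; apply/measurable_EFinP; apply: measurable_sum => i; exact: mG.
  apply: eq_bigr => j _.
  under eq_integral do rewrite -sumEFin.
  rewrite ge0_integral_sum//.
    by move=> i; apply/measurable_EFinP; exact: mG.
  by move=> i w _; rewrite lee_fin; exact: G0.
apply: (@le_trans _ _ (\sum_(j < J.+1) ((2^-1) ^+ (J - j) * poisson_moment_bound p)%:E)%E).
  apply: lee_sum => j _; apply: le_trans (lee_sum _ (fun i _ => EG j i)) _.
  rewrite sumEFin lee_fin sumr_const card_ord -[leLHS]mulr_natr natrX -mulrA.
  rewrite [leRHS]mulrC ler_wpM2l// -exprMn mulrC.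
  by rewrite (_ : 2 * 4^-1 = 2^-1)//; field.
rewrite sumEFin lee_fin -mulr_suml ler_wpM2r//.
rewrite (reindex_inj rev_ord_inj)/=.
rewrite (eq_bigr (fun j : 'I_J.+1 => 2^-1 ^+ j)) ?sum_halves// => j _.
by rewrite subSS subKn// -ltnS ltn_ord.
Qed.

(** A series over all k, so as to dominate the term at an index that depends on
    the path. *)
Definition exp_overshoot (C : R) (N : nat -> nat) : \bar R :=
  (\sum_(0 <= k <oo) (expR ((N k)%:R - C * k%:R))%:E)%E.

Lemma exp_overshoot_ge C (N : nat -> nat) k :
  ((expR ((N k)%:R - C * k%:R))%:E <= exp_overshoot C N)%E.
Proof.
apply: le_trans (@nneseries_lim_ge _ _ predT 0 k.+1 _); last first.
  by move=> i _ _; rewrite lee_fin expR_ge0.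
by rewrite big_nat_recr//= leeDr// sume_ge0// => i _; rewrite lee_fin expR_ge0.
Qed.

Lemma exp_overshoot_ge0 C (N : nat -> nat) : (0 <= exp_overshoot C N)%E.
Proof. by apply: nneseries_ge0 => k _ _; rewrite lee_fin expR_ge0. Qed.

Lemma measurable_exp_overshoot C (N : nat -> T -> nat) :
  (forall k, measurable_fun setT (N k)) ->
  measurable_fun setT (fun w => exp_overshoot C (N ^~ w)).
Proof.
move=> mN; apply: ge0_emeasurable_sum => [k x _ _|k _].
  by rewrite lee_fin expR_ge0.
apply/measurable_EFinP.
exact: (@measurableT_comp _ _ _ _ _ _ (fun l : nat => expR (l%:R - C * k%:R))).
Qed.

(** A Poisson variable N k of mean g * k has E exp (N k - C * k) = exp (g * k *
    (expR 1 - 1) - C * k) <= exp (- k). *)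
Lemma expectation_exp_overshoot (N : nat -> T -> nat) g C : 0 <= g ->
  g * (expR 1 - 1) + 1 <= C ->
  (forall k, measurable_fun setT (N k)) ->
  (forall k n, 0 < g * k%:R ->
    P [set w | N k w = n] = (poisson_pmf (g * k%:R) n)%:E) ->
  (forall k w, g * k%:R = 0 -> N k w = 0%N) ->
  (\int[P]_w exp_overshoot C (N ^~ w) <= 2%:E)%E.
Proof.
move=> g0 gC mN PN N0.
have e2 : 2 <= expR 1 :> R by rewrite (le_trans _ (expR_ge1Dx 1)).
have C1 : 1 <= C by rewrite (le_trans _ gC)// lerDr mulr_ge0//; lra.
have mk k : measurable_fun setT (fun w => expR ((N k w)%:R - C * k%:R)).
  exact: (@measurableT_comp _ _ _ _ _ _ (fun l : nat => expR (l%:R - C * k%:R))).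
rewrite integral_nneseries//; first last.
- by move=> k; exact/measurable_EFinP.
have term k : (\int[P]_w (expR ((N k w)%:R - C * k%:R))%:E <= ((2^-1) ^+ k)%:E)%E.
  apply: (@le_trans _ _ (expR (- k%:R))%:E); last first.
    rewrite lee_fin -[X in expR (- X)]mulr1 -mulrN expRM_natl lerXn2r//.
    - by rewrite nnegrE expR_ge0.
    - by rewrite nnegrE.
    - by rewrite expRN lef_pV2 ?posrE ?expR_gt0.
  have k0 : 0 <= k%:R :> R by [].
  have : 0 <= g * k%:R by rewrite mulr_ge0.
  rewrite le_eqVlt => /predU1P[/esym gk|gk].
    under eq_integral do rewrite N0// sub0r.
    rewrite integral_cst// [X in (_ * X)%E](_ : _ = 1%E); last exact: probability_setT.
    by rewrite mule1 lee_fin ler_expR lerN2 ler_peMl.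
  under eq_integral => w _.
    rewrite addrC expRD -[X in _ * expR X]mulr1 expRM_natl EFinM; over.
  rewrite ge0_integralZl_EFin//; first last.
  - by apply/measurable_EFinP; exact: (@measurableT_comp _ _ _ _ _ _ (fun l => expR 1 ^+ l)).
  rewrite (poisson_generating_function (mN k) gk (expR_gt0 1))//; last first.
    by move=> n; exact: PN.
  rewrite -EFinM lee_fin -expRD ler_expR.
  by move: gC k0; nra.
apply: lime_le.
  by apply: is_cvg_nneseries => k _ _; rewrite integral_ge0// => w _; rewrite lee_fin expR_ge0.
near=> n; rewrite /= (le_trans (lee_sum _ (fun k _ => term k)))//.
by rewrite sumEFin lee_fin big_mkord sum_halves.
Unshelve. all: by end_near.
Qed.

End noise_expectations.

(** * Integrals of bounded measurable paths *)

Section tame_paths.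
Context {R : realType}.
Implicit Types (a b s u v k : R) (f g : R -> R).
Local Notation mu := lebesgue_measure.

Definition tame a b f :=
  measurable_fun `[a, b] f /\ exists G, forall u, a <= u <= b -> `|f u| <= G.

Definition path_integral f a b : R := \int[mu]_(u in `[a, b]) f u.
Local Notation I := path_integral.

Lemma tameS a b a' b' f : a <= a' -> b' <= b -> tame a b f -> tame a' b' f.
Proof.
move=> aa bb [mf [G fG]]; split.
  apply: measurable_funS mf => //.
  by apply: subset_itv; rewrite bnd_simp.
by exists G => u /andP[u1 u2]; apply: fG; rewrite (le_trans aa)// (le_trans u2).
Qed.

Lemma tame_cst a b k : tame a b (fun=> k).
Proof. by split; [exact: measurable_cst|exists `|k|]. Qed.

Lemma tameD a b f g : tame a b f -> tame a b g -> tame a b (fun u => f u + g u).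
Proof.
move=> [mf [F fF]] [mg [G gG]]; split; first exact: measurable_funD.
exists (F + G) => u uab.
by rewrite (le_trans (ler_normD _ _))// lerD ?fF ?gG.
Qed.

Lemma tameZ a b f k : tame a b f -> tame a b (fun u => k * f u).
Proof.
move=> [mf [F fF]]; split; first exact: measurable_funM.
by exists (`|k| * F) => u uab; rewrite normrM ler_wpM2l ?fF.
Qed.

Lemma tameB a b f g : tame a b f -> tame a b g -> tame a b (fun u => f u - g u).
Proof.
move=> tf /(tameZ (-1)) tg; have := tameD tf tg.
by congr tame; apply/funext => u; rewrite mulN1r.
Qed.

Lemma tame_integrable a b f : tame a b f -> mu.-integrable `[a, b] (EFin \o f).
Proof.
move=> [mf [G fG]]; apply: measurable_bounded_integrable => //.
  rewrite /= lebesgue_measure_itv /=; case: ifP => // _.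
  by rewrite -EFinB ltry.
exists G; split; first exact: num_real.
by move=> M GM u /=; rewrite in_itv/= => /fG /le_trans; apply; exact: ltW.
Qed.

Lemma path_integralD a b f g : tame a b f -> tame a b g ->
  I (fun u => f u + g u) a b = I f a b + I g a b.
Proof. by move=> tf tg; rewrite /I RintegralD//; exact: tame_integrable. Qed.

Lemma path_integralB a b f g : tame a b f -> tame a b g ->
  I (fun u => f u - g u) a b = I f a b - I g a b.
Proof. by move=> tf tg; rewrite /I RintegralB//; exact: tame_integrable. Qed.

Lemma path_integralZ a b f k : tame a b f ->
  I (fun u => k * f u) a b = k * I f a b.
Proof. by move=> tf; rewrite /I RintegralZl//; exact: tame_integrable. Qed.

Lemma path_integral_cst a b k : a <= b -> I (fun=> k) a b = k * (b - a).
Proof.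
move=> ab; rewrite /I Rintegral_cst//= lebesgue_measure_itv /= lte_fin.
by move: ab; rewrite le_eqVlt => /predU1P[->|->]; rewrite ?ltxx ?subrr.
Qed.

Lemma le_path_integral a b f g : tame a b f -> tame a b g ->
  (forall u, a <= u <= b -> f u <= g u) -> I f a b <= I g a b.
Proof.
move=> tf tg fg; by apply: le_Rintegral => //; exact: tame_integrable.
Qed.

Lemma path_integral_near a b f v k : a <= b -> tame a b f ->
  (forall u, a <= u <= b -> `|f u - v| <= k) ->
  `|I f a b - v * (b - a)| <= k * (b - a).
Proof.
move=> ab tf fv.
rewrite -!path_integral_cst// -path_integralB//; last exact: tame_cst.
have t := tameB tf (tame_cst a b v).
rewrite ler_norml -mulN1r -path_integralZ; last exact: tame_cst.
apply/andP; split; apply: le_path_integral => //.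
- exact/tameZ/tame_cst.
- by move=> u /fv; rewrite mulN1r ler_norml => /andP[].
- exact: tame_cst.
- by move=> u /fv; rewrite ler_norml => /andP[].
Qed.

Lemma path_integral_split a s b f : a <= s -> s <= b -> tame a b f ->
  I f a b - I f a s = I f s b.
Proof.
move=> as_ sb tf; have ti := tame_integrable tf.
rewrite /path_integral Rintegral_itvB ?bnd_simp//.
rewrite Rintegral_itv_obnd_cbnd//; apply: integrableS ti => //.
by apply: subset_itv; rewrite bnd_simp.
Qed.

(** Applied to the supremum of f, the step bounds it by k plus half of itself.
    On a short window this replaces Gronwall's inequality. *)
Lemma bootstrap_bound (A : set R) (f : R -> R) k :
  (exists G, forall u, A u -> f u <= G) ->
  (forall G, (forall u, A u -> f u <= G) -> forall u, A u -> f u <= k + G / 2) ->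
  forall u, A u -> f u <= 2 * k.
Proof.
move=> [G fG] step u Au.
have ub : has_ubound (f @` A) by exists G => _ [v Av <-]; exact: fG.
have le_s v : A v -> f v <= sup (f @` A) by move=> Av; apply: ub_le_sup => //; exists v.
have : sup (f @` A) <= k + sup (f @` A) / 2.
  apply: ge_sup; first by exists (f u); exists u.
  by move=> _ [v Av <-]; exact: step.
by have := le_s u Au; lra.
Qed.

End tame_paths.

(** * Contraction over a short window *)

Section window.
Context {R : realType}.
Local Notation I := path_integral.

Lemma scaled_error_le (m B z h w : R) : 0 <= m <= B -> 0 <= h -> 0 <= w ->
  `|z| <= w * h -> `|m * z| <= B * h * w.
Proof.
move=> /andP[m0 mB] h0 w0 zw; rewrite normrM (ger0_norm m0).
by rewrite -mulrA (mulrC h) ler_pM.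
Qed.

(** Over the window x changes by O(e * |x t0| + rho), so that m22 * I x differs
    from m22 * h * x t0 by O(e ^ 2 * |x t0| + e * rho). This error is smaller
    than the gain m22 * h * |x t0| >= 16 * e ^ 2 * |x t0|, because c * h = 16 *
    e ^ 2. *)
Lemma linear_window (t0 h e c B m22 rho : R) (x : R -> R) :
  0 <= h -> e = B * h -> c * h = 16 * e ^+ 2 -> e <= 16^-1 ->
  0 < c -> c <= m22 <= B -> tame t0 (t0 + h) x ->
  (forall s, t0 <= s <= t0 + h ->
     `|x s - x t0 + m22 * I x t0 s| <= rho) ->
  `|x (t0 + h)| <= (1 - 8 * e ^+ 2) * `|x t0| + 2 * rho /\
  forall s, t0 <= s <= t0 + h -> `|x s| <= 2 * (`|x t0| + rho).
Proof.
move=> h0 eE ce e16 c0 /andP[cm mB] tx xE.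
have m0 : 0 <= m22 by lra.
have B0 : 0 <= B by lra.
have e0 : 0 <= e by rewrite eE mulr_ge0.
have rho0 : 0 <= rho.
  by apply: le_trans (xE t0 _); rewrite ?normr_ge0// lexx lerDl.
have x_le G : 0 <= G -> (forall s, t0 <= s <= t0 + h -> `|x s| <= G) ->
    forall s, t0 <= s <= t0 + h -> `|x s - x t0| <= rho + e * G.
  move=> G0 xG s /andP[ts sh].
  have sI : t0 <= s <= t0 + h by rewrite ts.
  have : `|I x t0 s - 0 * (s - t0)| <= G * (s - t0).
    apply: path_integral_near => //; first exact: tameS tx.
    by move=> u /andP[u1 u2]; rewrite subr0; apply: xG; rewrite u1 (le_trans u2).
  rewrite mul0r subr0 => IG.
  have IG' : `|I x t0 s| <= G * h by apply: (le_trans IG); rewrite ler_wpM2l//; lra.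
  have := @scaled_error_le m22 B _ h G _ h0 G0 IG'; rewrite m0 mB -eE => /(_ isT).
  by have := xE s sI; rewrite !ler_norml; lra.
have x_bd s : t0 <= s <= t0 + h -> `|x s| <= 2 * (`|x t0| + rho).
  apply: (@bootstrap_bound _ [set u | t0 <= u <= t0 + h] (fun u => `|x u|)).
    by have [_ [G xG]] := tx; exists G.
  move=> G xG u uI.
  have G0 : 0 <= G by apply: le_trans (xG u uI); rewrite normr_ge0.
  have := x_le G G0 xG u uI.
  have : `|x u| <= `|x t0| + `|x u - x t0|.
    by rewrite -{1}(subrK (x t0) (x u)) addrC ler_normD.
  have : e * G <= G / 2 by nra.
  by lra.
split => //.
pose a := `|x t0|.
have a0 : 0 <= a by exact: normr_ge0.
pose dd := rho + e * (2 * (a + rho)).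
have d0 : 0 <= dd by rewrite /dd; nra.
have xd s : t0 <= s <= t0 + h -> `|x s - x t0| <= dd.
  by apply: x_le => //; rewrite mulr_ge0// addr_ge0.
have thI : t0 <= t0 + h <= t0 + h by rewrite lexx lerDl h0.
have := @path_integral_near _ t0 (t0 + h) x (x t0) dd _ tx xd.
rewrite lerDl h0 addrAC subrr add0r => /(_ isT) Id.
have := @scaled_error_le m22 B _ h dd _ h0 d0 Id; rewrite m0 mB -eE => /(_ isT).
rewrite mulrBr => Im.
have := xE (t0 + h) thI.
have mh1 : 16 * e ^+ 2 <= m22 * h by rewrite -ce ler_wpM2r.
have mh2 : m22 * h <= 1.
  by apply: (@le_trans _ _ e); [rewrite eE ler_wpM2r|lra].
have : `|(1 - m22 * h) * x t0| <= (1 - 16 * e ^+ 2) * a.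
  by rewrite normrM ger0_norm ?subr_ge0// ler_wpM2r// lerB.
have : e * dd <= 6 * e ^+ 2 * a + rho.
  by rewrite /dd; nra.
have : 0 <= e ^+ 2 * a by rewrite mulr_ge0// exprn_ge0.
move: Im; rewrite !ler_norml -/a.
by lra.
Qed.

(** Here X and J stand for the integrals of the deviation and of the idleness of
    pool 1 over the window. If x0 >= 0 then J is negligible and m12 acts alone.
    If x0 < 0 then J lies between 0 and |x0| * h, up to z, so that m12 * X +
    (m12 - m11) * J lies between m11 * x0 * h and m12 * x0 * h, up to errors.
    Either way |x0| loses at least the fraction k, whatever the sign of m12 -
    m11. *)
Lemma dissipative_step (x0 xh X J m11 m12 h k w z u rho : R) :
  k <= m11 * h <= 1 -> k <= m12 * h <= 1 -> 0 <= w -> 0 <= u ->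
  `|m12 * X - m12 * (x0 * h)| <= w ->
  `|xh - x0 + m12 * X + (m12 - m11) * J| <= rho ->
  0 <= J -> J <= Num.max 0 (- x0) * h + z -> `|m12 - m11| * z <= u ->
  `|xh| <= (1 - k) * `|x0| + w + u + rho.
Proof.
move=> /andP[k1 h1] /andP[k2 h2] w0 u0; rewrite ler_norml => /andP[X1 X2].
rewrite ler_norml => /andP[E1 E2] J0 Jz zu.
have x00 : 0 <= `|x0| by exact: normr_ge0.
have p11 := ler_wpM2r x00 k1; have p12 := ler_wpM2r x00 k2.
have q11 := ler_wpM2r x00 h1; have q12 := ler_wpM2r x00 h2.
have [D0|D0] := leP m11 m12.
  have DJ0 : 0 <= (m12 - m11) * J by rewrite mulr_ge0// subr_ge0.
  have := ler_wpM2l (_ : 0 <= m12 - m11) Jz; rewrite subr_ge0 => /(_ D0).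
  move: zu; rewrite ger0_norm ?subr_ge0//.
  move: p11 p12 q11 q12; have [xx|xx] := leP 0 x0.
    rewrite max_l; last by rewrite oppr_le0.
    by rewrite ger0_norm// ler_norml; clear -X1 X2 E1 E2 DJ0 w0 u0 xx; lra.
  rewrite max_r; last by rewrite oppr_ge0 ltW.
  by rewrite ltr0_norm// ler_norml; clear -X1 X2 E1 E2 DJ0 w0 u0 xx; lra.
have D0' : 0 <= m11 - m12 by rewrite subr_ge0 ltW.
have DJ0 : 0 <= (m11 - m12) * J by rewrite mulr_ge0.
have := ler_wpM2l D0' Jz.
move: zu; rewrite distrC ger0_norm//.
move: p11 p12 q11 q12; have [xx|xx] := leP 0 x0.
  rewrite max_l; last by rewrite oppr_le0.
  by rewrite ger0_norm// ler_norml; clear -X1 X2 E1 E2 DJ0 w0 u0 xx; lra.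
rewrite max_r; last by rewrite oppr_ge0 ltW.
by rewrite ltr0_norm// ler_norml; clear -X1 X2 E1 E2 DJ0 w0 u0 xx; lra.
Qed.

(** The idleness y is an unknown of the equation for x1, but the constraint y <=
    q - x1 + g bounds its integral by those of q and of the negative part of x1.
    This yields first a bound on x1 over the window by bootstrap, then the
    decrease at its end by [dissipative_step]. *)
Lemma driven_window (t0 h e c B m11 m12 rho1 g Iq : R) (x1 y q : R -> R) :
  0 < h -> e = B * h -> c * h = 16 * e ^+ 2 -> 0 < e <= 16^-1 ->
  0 < c -> c <= m11 <= B -> c <= m12 <= B -> 0 <= g ->
  tame t0 (t0 + h) x1 -> tame t0 (t0 + h) y -> tame t0 (t0 + h) q ->
  (forall s, t0 <= s <= t0 + h -> 0 <= q s /\ 0 <= y s <= q s - x1 s + g) ->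
  I q t0 (t0 + h) <= Iq ->
  (forall s, t0 <= s <= t0 + h ->
     `|x1 s - x1 t0 + m12 * I x1 t0 s + (m12 - m11) * I y t0 s| <= rho1) ->
  let b := B * Iq + e * g + rho1 in
  `|x1 (t0 + h)| <= (1 - 8 * e ^+ 2) * `|x1 t0| + 2 * b /\
  forall s, t0 <= s <= t0 + h -> `|x1 s| <= 2 * (`|x1 t0| + b).
Proof.
move=> h0 eE ce /andP[e0 e16] c0 /andP[cm11 m11B] /andP[cm12 m12B] g0.
move=> tx1 ty tq yq qI x1E b.
have B0 : 0 < B by exact: lt_le_trans c0 (le_trans cm11 m11B).
have thI : t0 <= t0 + h <= t0 + h by rewrite lexx lerDl ltW.
set a1 := `|x1 t0|; have a1E : a1 = `|x1 t0| by [].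
have a10 : 0 <= a1 by exact: normr_ge0.
have rho10 : 0 <= rho1.
  by apply: le_trans (x1E _ thI); rewrite normr_ge0.
have q0 : 0 <= I q t0 (t0 + h).
  by apply: Rintegral_ge0 => u; rewrite /= in_itv /= => /yq[].
have Iq0 : 0 <= Iq by exact: le_trans qI.
have b0 : 0 <= b.
  by rewrite /b !addr_ge0// mulr_ge0// ltW.
have bE : b = B * Iq + e * g + rho1 by [].
clearbody b a1.
have Iq_le s : t0 <= s <= t0 + h -> I q t0 s <= Iq.
  move=> /andP[ts sh]; apply: le_trans qI.
  rewrite -subr_ge0 (path_integral_split ts sh tq).
  apply: Rintegral_ge0 => u; rewrite /= in_itv /= => /andP[su uh].
  by have [] := yq u; rewrite ?uh ?(le_trans ts).
have Iy_ge0 s : t0 <= s <= t0 + h -> 0 <= I y t0 s.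
  move=> /andP[ts sh].
  apply: Rintegral_ge0 => u; rewrite /= in_itv /= => /andP[su uh].
  by have [_ /andP[]] := yq u ltac:(by rewrite su (le_trans uh)).
have Iy_le s L : 0 <= L -> t0 <= s <= t0 + h ->
    (forall u, t0 <= u <= t0 + h -> - x1 u <= L) ->
    I y t0 s <= Iq + h * (L + g).
  move=> L0 sI x1L; have /andP[ts sh] := sI.
  have tqs : tame t0 s q by exact: tameS tq.
  have Iyq : I y t0 s <= I (fun u => q u + (L + g)) t0 s.
    apply: le_path_integral; first exact: tameS ty.
      by apply: tameD => //; exact: tame_cst.
    move=> u /andP[u1 u2].
    have uI : t0 <= u <= t0 + h by rewrite u1 (le_trans u2).
    have [_ /andP[_]] := yq u uI.
    by have := x1L u uI; clear; lra.
  apply: (le_trans Iyq).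
  rewrite path_integralD//; last exact: tame_cst.
  rewrite path_integral_cst// lerD ?Iq_le// mulrC ler_wpM2r ?addr_ge0//.
  by rewrite lerBlDl.
have Dm : `|m12 - m11| <= B.
  by rewrite ler_norml; clear -cm11 m11B cm12 m12B c0; lra.
have Bh z : B * (h * z) = e * z by rewrite mulrA eE.
have x1_le G : 0 <= G -> (forall s, t0 <= s <= t0 + h -> `|x1 s| <= G) ->
    forall s, t0 <= s <= t0 + h -> `|x1 s - x1 t0| <= b + 2 * e * G.
  move=> G0 xG s sI; have /andP[ts sh] := sI.
  have IG : `|I x1 t0 s| <= G * h.
    rewrite -[I x1 t0 s]subr0 -(mul0r (s - t0)).
    apply: (@le_trans _ _ (G * (s - t0))); last by rewrite ler_wpM2l// lerBlDl.
    apply: path_integral_near => //; first exact: tameS tx1.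
    by move=> u /andP[u1 u2]; rewrite subr0; apply: xG; rewrite u1 (le_trans u2).
  have := @scaled_error_le m12 B _ h G _ (ltW h0) G0 IG.
  rewrite m12B (le_trans (ltW c0) cm12) -eE => /(_ isT) h1.
  have Iyl : I y t0 s <= Iq + h * (G + g).
    apply: Iy_le => // u /xG; rewrite ler_norml => /andP[+ _].
    by rewrite lerNl.
  have h2 : `|(m12 - m11) * I y t0 s| <= B * (Iq + h * (G + g)).
    by rewrite normrM ler_pM// ger0_norm// Iy_ge0.
  move: h1 h2; rewrite mulrDr Bh; have := x1E s sI.
  by rewrite bE !ler_norml; clear; lra.
have x1s s : t0 <= s <= t0 + h -> `|x1 s| <= 2 * (a1 + b).
  apply: (@bootstrap_bound _ [set u | t0 <= u <= t0 + h] (fun u => `|x1 u|)).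
    by have [_ [G xG]] := tx1; exists G.
  move=> G xG u uI.
  have G0 : 0 <= G by apply: le_trans (xG u uI); rewrite normr_ge0.
  have := x1_le G G0 xG u uI.
  have : `|x1 u| <= a1 + `|x1 u - x1 t0|.
    by rewrite a1E -{1}(subrK (x1 t0) (x1 u)) addrC ler_normD.
  by have := ler_wpM2l G0 e16; clear -G0; lra.
split => //.
pose dd := b + 4 * e * (a1 + b).
have ea0 : 0 <= e * (a1 + b) by rewrite mulr_ge0 ?(ltW e0)// addr_ge0.
have d0 : 0 <= dd by rewrite /dd; clear -ea0 b0; lra.
have x1d s : t0 <= s <= t0 + h -> `|x1 s - x1 t0| <= dd.
  move=> sI; have := x1_le (2 * (a1 + b)) _ x1s s sI.
  rewrite (_ : b + 2 * e * (2 * (a1 + b)) = dd); last by rewrite /dd; ring.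
  by apply; rewrite mulr_ge0// addr_ge0.
have ddE : dd = b + 4 * e * (a1 + b) by [].
clearbody dd.
have := @path_integral_near _ t0 (t0 + h) x1 (x1 t0) dd _ tx1 x1d.
rewrite lerDl ltW// addrAC subrr add0r => /(_ isT) Id.
have := @scaled_error_le m12 B _ h dd _ (ltW h0) d0 Id.
rewrite m12B (le_trans (ltW c0) cm12) -eE => /(_ isT).
rewrite mulrBr => Im.
have E1 := x1E _ thI.
have J0 := Iy_ge0 _ thI.
pose L := Num.max 0 (- x1 t0).
have L0 : 0 <= L by rewrite /L le_max lexx.
have JL : I y t0 (t0 + h) <= Iq + h * (L + dd + g).
  apply: Iy_le => //; first by rewrite addr_ge0.
  move=> u /x1d; rewrite ler_norml => /andP[u1 _].
  have : - x1 t0 <= L by rewrite /L le_max lexx orbT.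
  by clear -u1; lra.
have rest0 : 0 <= e * dd + (b - rho1).
  rewrite addr_ge0//; first by rewrite mulr_ge0// ltW.
  by rewrite bE addrK addr_ge0// mulr_ge0// ltW.
have mh1 m : c <= m -> m <= B -> 16 * e ^+ 2 <= m * h <= 1.
  move=> cm mB; rewrite -ce ler_wpM2r//= ?(ltW h0)//.
  apply: (@le_trans _ _ e); first by rewrite eE ler_wpM2r// ltW.
  by clear -e16; lra.
have := @dissipative_step (x1 t0) (x1 (t0 + h)) (I x1 t0 (t0 + h))
  (I y t0 (t0 + h)) m11 m12 h (16 * e ^+ 2) (e * dd)
  (Iq + h * (dd + g)) (e * dd + (b - rho1)) rho1
  (mh1 _ cm11 m11B) (mh1 _ cm12 m12B) _ rest0 Im E1 J0.
rewrite -a1E mulr_ge0 ?(ltW e0)// => /(_ isT) step.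
apply: (le_trans (step _ _)).
- apply: (le_trans JL); rewrite -/L -subr_ge0 [X in 0 <= X](_ : _ = 0)//; ring.
- have z0 : 0 <= Iq + h * (dd + g).
    by rewrite addr_ge0// mulr_ge0 ?(ltW h0)// addr_ge0.
  apply: (@le_trans _ _ (B * (Iq + h * (dd + g)))); first by rewrite ler_wpM2r.
  by rewrite mulrDr Bh bE; clear; lra.
have e1 : 2 * e + 8 * e ^+ 2 <= 1 by clear -e0 e16; nra.
by rewrite ddE; have := ler_wpM2r b0 e1; clear; lra.
Qed.

(** The equation for x2 is autonomous, while x2 enters the equation for x1
    through the bound on y, with a coefficient of order e = B * h. As K * e = 1,
    the loss of order e ^ 2 * K * |x2| = e * |x2| pays for it. *)
Lemma window_contraction (t0 h c B m11 m12 m22 rho1 rho2 dlt Iq : R)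
    (x1 x2 y q : R -> R) :
  0 < c -> c <= m11 <= B -> c <= m12 <= B -> c <= m22 <= B -> 1 <= B ->
  h = c / (16 * B ^+ 2) -> 0 <= dlt ->
  tame t0 (t0 + h) x1 -> tame t0 (t0 + h) x2 ->
  tame t0 (t0 + h) y -> tame t0 (t0 + h) q ->
  (forall s, t0 <= s <= t0 + h ->
     0 <= q s /\ 0 <= y s <= q s - x1 s - x2 s + dlt) ->
  I q t0 (t0 + h) <= Iq ->
  (forall s, t0 <= s <= t0 + h ->
     `|x2 s - x2 t0 + m22 * I x2 t0 s| <= rho2) ->
  (forall s, t0 <= s <= t0 + h ->
     `|x1 s - x1 t0 + m12 * I x1 t0 s + (m12 - m11) * I y t0 s| <= rho1) ->
  let K := 16 * B / c in
  let V s := `|x1 s| + K * `|x2 s| in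
  let r := 2 * (B * Iq + B * h * dlt + rho1) + (1 + 2 * K) * rho2 in
  V (t0 + h) <= (1 - c * h / 4) * V t0 + r /\
  forall s, t0 <= s <= t0 + h -> `|x1 s| + `|x2 s| <= 4 * V t0 + 2 * r.
Proof.
move=> c0 m11I m12I m22I B1 hE dlt0 tx1 tx2 ty tq yq qI x2E x1E K V r.
have B0 : 0 < B by exact: lt_le_trans B1.
have cB : c <= B by have /andP[cm mB] := m11I; exact: le_trans mB.
pose e := B * h.
have h0 : 0 < h by rewrite hE divr_gt0// mulr_gt0// exprn_gt0.
have eB : c = 16 * B * e by rewrite /e hE; field; rewrite gt_eqF.
have ce : c * h = 16 * e ^+ 2 by rewrite {1}eB /e; ring.
have e0 : 0 < e by rewrite mulr_gt0.
have e16 : e <= 16^-1.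
  rewrite -(@ler_pM2l _ (16 * B)) ?mulr_gt0// -eB.
  by rewrite mulrAC mulfV ?mul1r.
have Ke : K * e = 1 by rewrite /K {1}eB; field; rewrite !gt_eqF.
have K0 : 0 <= K by rewrite divr_ge0 ?mulr_ge0 ?(ltW B0) ?(ltW c0).
have K1 : 1 <= K.
  by rewrite -[leLHS]Ke ler_piMr//; clear -e16; lra.
have thI : t0 <= t0 + h <= t0 + h by rewrite lexx lerDl ltW.
have [x2h x2s] := linear_window (ltW h0) (erefl e) ce e16 c0 m22I tx2 x2E.
have rho20 : 0 <= rho2.
  by apply: le_trans (x2E _ thI); rewrite normr_ge0.
have rho10 : 0 <= rho1.
  by apply: le_trans (x1E _ thI); rewrite normr_ge0.
pose g := 2 * (`|x2 t0| + rho2) + dlt.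
have g0 : 0 <= g by rewrite addr_ge0// mulr_ge0// addr_ge0.
have yq' s : t0 <= s <= t0 + h -> 0 <= q s /\ 0 <= y s <= q s - x1 s + g.
  move=> sI; have [qs /andP[y0 ys]] := yq s sI; split => //; rewrite y0.
  have := x2s s sI; rewrite ler_norml => /andP[+ _].
  by rewrite /g; move: ys; clear; lra.
have e016 : 0 < e <= 16^-1 by rewrite e0.
have [x1h x1s] := driven_window h0 (erefl e) ce e016 c0 m11I m12I g0 tx1 ty tq yq' qI x1E.
have Iq0 : 0 <= Iq.
  apply: le_trans qI.
  by apply: Rintegral_ge0 => u; rewrite /= in_itv /= => /yq[].
pose z := B * Iq + e * dlt + rho1.
have z0 : 0 <= z by rewrite !addr_ge0// mulr_ge0// ltW.
have rE : r = 2 * z + (1 + 2 * K) * rho2 by [].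
have bE : B * Iq + e * g + rho1 = z + 2 * e * `|x2 t0| + 2 * e * rho2.
  by rewrite /z /g; ring.
rewrite {}bE in x1h x1s.
rewrite {}/V rE; clearbody K e z.
have er := ler_wpM2r rho20 e16.
move: (normr_ge0 (x1 t0)) (normr_ge0 (x2 t0)) x1h x2h x1s x2s.
set a1 := `|x1 t0|; set a2 := `|x2 t0|; move=> a10 a20 x1h x2h x1s x2s.
have ea := ler_wpM2r a20 e16.
split.
  rewrite ce.
  (* The sum of x1h and K times x2h; the term 4 * e * |x2 t0| of the former is
     covered by 8 * e ^ 2 * K * |x2 t0| = 8 * e * |x2 t0|. *)
  have x2h' := ler_wpM2l K0 x2h.
  have e1 : 0 <= e ^+ 2 * a1 by rewrite mulr_ge0// exprn_ge0// ltW.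
  have e2 : K * (e ^+ 2 * a2) = e * a2 by rewrite mulrA exprS expr1 mulrA Ke mul1r.
  by move: x1h x2h' e1 e2 er; clear -rho20; lra.
move=> s sI; have := x1s s sI; have := x2s s sI.
have : a2 <= K * a2 by rewrite ler_peMl.
have : rho2 <= K * rho2 by rewrite ler_peMl.
by move: er ea z0 a10 a20 rho20; clear; lra.
Qed.

End window.

(** * Measurability at random times *)

Section measurability.
Context {R : realType} {d : measure_display} {T : measurableType d}.

Lemma measurable_half_line : measurable [set t : R | 0 <= t].
Proof.
rewrite (_ : [set t : R | 0 <= t] = `[0, +oo[%classic)//.
by apply/seteqP; split => x /=; rewrite in_itv /= andbT.
Qed.

(** By monotonicity and right-continuity, U is at most k at the random time if
    and only if it is at most k at some later rational time: a countable union
    of measurable events. *)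
Lemma measurable_random_time (P : probability T R) (U : R -> T -> nat)
    (c : T -> R) : unit_poisson_process P U -> measurable_fun setT c ->
  (forall w, 0 <= c w) -> measurable_fun setT (fun w => U (c w) w).
Proof.
move=> PU mc c0.
have le_set k : measurable [set w | (U (c w) w <= k)%N].
  (* The absolute value keeps the rational times in the half-line on which U is
     a Poisson process. *)
  pose v (q : rat) : R := `|ratr q|.
  pose A (q : rat) := [set w | c w < v q] `&` [set w | (U (v q) w <= k)%N].
  rewrite (_ : [set _ | _] = \bigcup_q A q).
    apply: bigcupT_measurable_rat => q; apply: measurableI.
      have := mc measurableT _ (measurable_itv `]-oo, v q[).
      by rewrite setTI; congr measurable; apply/seteqP; split => w /=; rewrite in_itv.
    have := poisson_measurable PU (normr_ge0 (ratr q : R)) measurableT.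
    by move=> /(_ [set j | (j <= k)%N]); rewrite setTI; apply.
  apply/seteqP; split => w /=; last first.
    move=> [q _ [/= cq Uq]]; apply: leq_trans Uq.
    by apply: (poisson_monotone PU) => //; exact: ltW.
  move=> Uk; have [e /= e0 He] := poisson_right_continuous PU w (c0 w).
  have [q] : exists q : rat, ratr q \in `]c w, (c w + e)[.
    by apply: rat_in_itvoo; rewrite ltrDl.
  rewrite in_itv /= => /andP[cq qe].
  have q0 : 0 <= ratr q :> R by rewrite (le_trans (c0 w))// ltW.
  exists q => //; rewrite /A /= /v ger0_norm//; split => //.
  rewrite He//= ltr_norml; apply/andP; split; lra.
move=> _ B _; rewrite setTI.
rewrite (_ : _ @^-1` B = \bigcup_(k in B) [set w | U (c w) w = k]); last first.
  by apply/seteqP; split => [w /= Bw|w [k Bk /= ->]]//; exists (U (c w) w).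
apply: bigcup_measurable => k _.
case: k => [|k].
  have := le_set 0%N; congr measurable; apply/seteqP; split => w /=; rewrite leqn0.
    by move/eqP.
  by move=> ->.
rewrite (_ : [set _ | _] = [set w | (U (c w) w <= k.+1)%N] `\` [set w | (U (c w) w <= k)%N]).
  exact: measurableD.
apply/seteqP; split => w /=; first by move=> ->; rewrite leqnn; split => //; rewrite ltnn.
by move=> [h1 /negP]; rewrite -ltnNge => h2; apply/eqP; rewrite eqn_leq h1.
Qed.

Lemma measurable_path (f : R -> T -> R) w :
  measurable_fun ([set t : R | 0 <= t] `*` [set: T]) (fun p => f p.1 p.2) ->
  measurable_fun [set t : R | 0 <= t] (f ^~ w).
Proof.
move=> mf.
apply: (@measurable_comp _ _ _ _ _ _ ([set t : R | 0 <= t] `*` [set: T])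
  (fun p => f p.1 p.2) _ (fun t => (t, w))) => //.
- by apply: measurableX => //; exact: measurable_half_line.
- by move=> _ [t t0 <-].
- exact/measurable_funTS/pair2_measurable.
Qed.

(** Joint measurability is available for nonnegative times only; extending the
    integrand by 0 outside the window brings Tonelli's theorem to bear. *)
Lemma measurable_time_integral (a b : R) (f : R -> T -> R) : 0 <= a ->
  measurable_fun ([set t : R | 0 <= t] `*` [set: T]) (fun p => f p.1 p.2) ->
  (forall t w, 0 <= t -> 0 <= f t w) ->
  measurable_fun setT
    (fun w => \int[lebesgue_measure]_(s in `[a, b]) (f s w)%:E)%E.
Proof.
move=> a0 mf f0.
have abS : `[a, b] `<=` [set t : R | 0 <= t].
  by move=> t /=; rewrite in_itv /= => /andP[/(le_trans a0)].
pose g := ((fun p : R * T => (f p.1 p.2)%:E) \_ (`[a, b] `*` setT))%E.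
have mab : measurable (`[a, b] `*` [set: T]) by exact: measurableX.
have mg : measurable_fun setT g.
  rewrite /g; apply/(measurable_restrictT _ mab).
  apply/measurable_EFinP; apply: measurable_funS mf.
    by apply: measurableX => //; exact: measurable_half_line.
  by move=> [t w] /= [/abS].
have g0 p : (0 <= g p)%E.
  rewrite /g patchE; case: ifPn => //; rewrite inE => -[/abS/= p0 _].
  by rewrite lee_fin f0.
have := @measurable_fun_fubini_tonelli_G _ _ _ _ R
  (lebesgue_measure : {sigma_finite_measure set _ -> \bar R}) g mg g0.
congr measurable_fun; apply/funext => w; rewrite /fubini_G /=.
rewrite [RHS]integral_mkcond; apply: eq_integral => t _.
rewrite /g !patchE; congr (if _ then _ else _).
by apply/idP/idP; rewrite !inE; [case|split].
Qed.

End measurability.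

(** * Paths of a controlled network *)

Section activity_sums.
Context {V : nmodType} (F : activity -> V).

Lemma sum_class1 : \sum_(a | class_of a == class1) F a = F act11 + F act12.
Proof.
rewrite (bigD1 act11)//= (bigD1 act12)//= big_pred0 ?addr0//.
by case.
Qed.

Lemma sum_class2 : \sum_(a | class_of a == class2) F a = F act22.
Proof. by rewrite (bigD1 act22)//= big_pred0 ?addr0//; case. Qed.

Lemma sum_pool1 : \sum_(a | pool_of a == pool1) F a = F act11.
Proof. by rewrite (bigD1 act11)//= big_pred0 ?addr0//; case. Qed.

Lemma sum_pool2 : \sum_(a | pool_of a == pool2) F a = F act12 + F act22.
Proof.
rewrite (bigD1 act12)//= (bigD1 act22)//= big_pred0 ?addr0//.
by case.
Qed.

Lemma sum_classes (G : class -> V) : \sum_i G i = G class1 + G class2.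
Proof.
rewrite (bigD1 class1)//= (bigD1 class2)//= big_pred0 ?addr0//.
by case.
Qed.

End activity_sums.

Section system_paths.
Context {R : realType} (nw : network R) (S : system R).
Hypotheses (dyn : network_dynamics nw S) (adm : admissible nw S)
  (rate0 : forall f, 0 <= rate nw f).
Implicit Types (s t : R) (w : Omega S) (i : class) (a : activity).

Definition state i t w : R := (X i t w)%:R.
Definition busy a t w : R := (Z a t w)%:R.
Definition waiting i t w : R := (Q i t w)%:~R.
Definition idle1 t w : R := (servers nw pool1)%:R - busy act11 t w.

Lemma waiting1E t w :
  waiting class1 t w = state class1 t w - busy act11 t w - busy act12 t w.
Proof.
rewrite /waiting /Q /queue sum_class1 intrB intrD /state /busy.
by rewrite opprD addrA.
Qed.

Lemma waiting2E t w : waiting class2 t w = state class2 t w - busy act22 t w.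
Proof. by rewrite /waiting /Q /queue sum_class2 intrB. Qed.

Lemma waiting_ge0 i t w : 0 <= t -> 0 <= waiting i t w.
Proof.
by move=> t0; rewrite ler0z; exact: queue_ge0 (Z_work_conserving adm w t0) i.
Qed.

Lemma pool1_le t w : 0 <= t -> busy act11 t w <= (servers nw pool1)%:R.
Proof.
move=> t0; have := idle_ge0 (Z_work_conserving adm w t0) pool1.
by rewrite /idle sum_pool1 subr_ge0 lez_nat ler_nat.
Qed.

Lemma pool2_le t w : 0 <= t ->
  busy act12 t w + busy act22 t w <= (servers nw pool2)%:R.
Proof.
move=> t0; have := idle_ge0 (Z_work_conserving adm w t0) pool2.
by rewrite /idle sum_pool2 subr_ge0 -PoszD lez_nat /busy -natrD ler_nat.
Qed.

Lemma busy_ge0 a t w : 0 <= busy a t w.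
Proof. exact: ler0n. Qed.

Lemma state_ge0 i t w : 0 <= state i t w.
Proof. exact: ler0n. Qed.

Lemma busy_le a t w : 0 <= t -> busy a t w <= (servers nw (pool_of a))%:R.
Proof.
move=> t0; case: a => /=; first exact: pool1_le.
  by have := pool2_le w t0; have := busy_ge0 act22 t w; lra.
by have := pool2_le w t0; have := busy_ge0 act12 t w; lra.
Qed.

Lemma measurable_natr_process (U : R -> Omega S -> nat) :
  measurable_process U ->
  measurable_fun ([set t : R | 0 <= t] `*` [set: Omega S])
    (fun p => (U p.1 p.2)%:R : R).
Proof.
by move=> mU; exact: (@measurableT_comp _ _ _ _ _ _ (fun k : nat => k%:R : R)).
Qed.

Lemma measurable_state i :
  measurable_fun ([set t : R | 0 <= t] `*` [set: Omega S])
    (fun p => state i p.1 p.2).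
Proof. exact: (measurable_natr_process (X_measurable dyn i)). Qed.

Lemma measurable_busy a :
  measurable_fun ([set t : R | 0 <= t] `*` [set: Omega S])
    (fun p => busy a p.1 p.2).
Proof. exact: (measurable_natr_process (Z_measurable dyn a)). Qed.

Lemma measurable_waiting i :
  measurable_fun ([set t : R | 0 <= t] `*` [set: Omega S])
    (fun p => waiting i p.1 p.2).
Proof.
case: i.
  have := measurable_funB (measurable_funB (measurable_state class1)
    (measurable_busy act11)) (measurable_busy act12).
  by congr measurable_fun; apply/funext => p; rewrite waiting1E.
have := measurable_funB (measurable_state class2) (measurable_busy act22).
by congr measurable_fun; apply/funext => p; rewrite waiting2E.
Qed.

Lemma counts_mono f (c1 c2 : R) w : 0 <= c1 -> c1 <= c2 ->
  (driver f c1 w <= driver f c2 w)%N.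
Proof. exact: (poisson_monotone (driver_poisson dyn f)). Qed.

Lemma state_balance i t w : 0 <= t ->
  state i t w = state i 0 w + (counts nw (arrival i) t w)%:R
    - \sum_(a | class_of a == i) (counts nw (service a) t w)%:R
    - (counts nw (abandonment i) t w)%:R.
Proof.
move=> t0; have := X_balance dyn i w t0 => /(congr1 (fun z : int => z%:~R : R)).
by rewrite /state !intrB intrD rmorph_sum.
Qed.

Lemma path_tame (f : R -> Omega S -> R) T w (G : R) :
  measurable_fun ([set t : R | 0 <= t] `*` [set: Omega S])
    (fun p => f p.1 p.2) ->
  (forall t, 0 <= t <= T -> `|f t w| <= G) -> tame 0 T (f ^~ w).
Proof.
move=> mf fG; split; last by exists G.
apply: measurable_funS (measurable_path w mf); first exact: measurable_half_line.
by move=> t /=; rewrite in_itv /= => /andP[].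
Qed.

(** Jobs only enter by arrival, so a path is bounded by its initial value and
    the arrivals up to the horizon. *)
Lemma state_tame i T w : tame 0 T (state i ^~ w).
Proof.
pose G : R := state i 0 w + (driver (arrival i) (arrival_rate nw i * `|T|) w)%:R.
apply: (@path_tame _ _ _ G); first exact: measurable_state.
move=> t /andP[t0 tT]; rewrite ger0_norm ?state_ge0// state_balance//.
have l0 : 0 <= arrival_rate nw i := rate0 (arrival i).
have : (counts nw (arrival i) t w)%:R <= (driver (arrival i) (arrival_rate nw i * `|T|) w)%:R :> R.
  rewrite ler_nat; apply: counts_mono; rewrite /= ?mulr_ge0//.
  by rewrite ler_wpM2l// (le_trans tT)// ler_norm.
have : 0 <= \sum_(a | class_of a == i) (counts nw (service a) t w)%:R :> R.
  by apply: sumr_ge0.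
have : 0 <= (counts nw (abandonment i) t w)%:R :> R by [].
by rewrite /G; lra.
Qed.

Lemma busy_tame a T w : tame 0 T (busy a ^~ w).
Proof.
apply: (@path_tame _ _ _ (servers nw (pool_of a))%:R); first exact: measurable_busy.
by move=> t /andP[t0 _]; rewrite ger0_norm ?busy_ge0// busy_le.
Qed.

Lemma waiting_tame i T w : tame 0 T (waiting i ^~ w).
Proof.
case: i.
  have := tameB (tameB (state_tame class1 T w) (busy_tame act11 T w)) (busy_tame act12 T w).
  by congr tame; apply/funext => t; rewrite waiting1E.
have := tameB (state_tame class2 T w) (busy_tame act22 T w).
by congr tame; apply/funext => t; rewrite waiting2E.
Qed.

Lemma clock_serviceE a t w :
  clock nw (service a) t w = service_rate nw a * path_integral (busy a ^~ w) 0 t.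
Proof. by []. Qed.

Lemma clock_abandonmentE i t w : clock nw (abandonment i) t w =
  abandonment_rate nw i * path_integral (waiting i ^~ w) 0 t.
Proof. by []. Qed.

Lemma path_integral_ge0 (f : R -> R) b c : 0 <= b ->
  (forall t, 0 <= t -> 0 <= f t) -> 0 <= path_integral f b c.
Proof.
move=> b0 f0; apply: Rintegral_ge0 => t; rewrite /= in_itv /= => /andP[bt _].
by apply: f0; exact: le_trans bt.
Qed.

Lemma clock_ge0 f t w : 0 <= t -> 0 <= clock nw f t w.
Proof.
move=> t0; case: f => [i|a|i].
- by apply: mulr_ge0 => //; exact: (rate0 (arrival i)).
- rewrite clock_serviceE; apply: mulr_ge0; first exact: (rate0 (service a)).
  by apply: path_integral_ge0 => // s _; exact: busy_ge0.
- rewrite clock_abandonmentE; apply: mulr_ge0; first exact: (rate0 (abandonment i)).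
  by apply: path_integral_ge0 => // s; exact: waiting_ge0.
Qed.

Lemma measurable_path_integral (f : R -> Omega S -> R) t :
  measurable_fun ([set t : R | 0 <= t] `*` [set: Omega S])
    (fun p => f p.1 p.2) ->
  (forall t w, 0 <= t -> 0 <= f t w) ->
  measurable_fun setT (fun w => path_integral (f ^~ w) 0 t).
Proof.
move=> mf f0; rewrite /path_integral /Rintegral.
apply: (measurableT_comp (fine_measurable _)) => //.
exact: measurable_time_integral.
Qed.

Lemma measurable_clock f t :
  measurable_fun setT (clock nw f t : Omega S -> R).
Proof.
case: f => [i|a|i].
- exact: measurable_cst.
- apply: measurable_funM; first exact: measurable_cst.
  apply: (@measurable_path_integral (busy a)); first exact: measurable_busy.
  by move=> *; exact: busy_ge0.
- apply: measurable_funM; first exact: measurable_cst.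
  apply: (@measurable_path_integral (waiting i)); first exact: measurable_waiting.
  by move=> *; exact: waiting_ge0.
Qed.

(** The argument r is operational time elapsed since t. In physical time the
    increments after t have the rate of the flow; in operational time they have
    rate 1, as the chaining bounds require. *)
Definition restarted f t (r : R) w : nat :=
  (driver f (clock nw f t w + r) w - driver f (clock nw f t w) w)%N.

Lemma incrementE f t r w : increment nw f t r w = restarted f t (rate nw f * r) w.
Proof. by []. Qed.

Lemma measurable_restarted f t r : 0 <= t -> 0 <= r ->
  measurable_fun setT (restarted f t r).
Proof.
move=> t0 r0; have c0 w := clock_ge0 f w t0.
apply: measurable_fun_subn.
  apply: (measurable_random_time (driver_poisson dyn f)).
    by apply: measurable_funD; [exact: measurable_clock|exact: measurable_cst].
  by move=> w; rewrite addr_ge0.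
exact: (measurable_random_time (driver_poisson dyn f) (measurable_clock f t)).
Qed.

Lemma restarted_mono f t r1 r2 w : 0 <= t -> 0 <= r1 -> r1 <= r2 ->
  (restarted f t r1 w <= restarted f t r2 w)%N.
Proof.
move=> t0 r10 r12; apply: leq_sub2r; apply: counts_mono.
  by rewrite addr_ge0// clock_ge0.
by rewrite lerD2l.
Qed.

Lemma restarted0 f t w : restarted f t 0 w = 0%N.
Proof. by rewrite /restarted addr0 subnn. Qed.

Lemma restarted_difference f t r1 r2 w : 0 <= t -> 0 <= r1 -> r1 <= r2 ->
  (restarted f t r2 w - restarted f t r1 w)%N =
  (driver f (clock nw f t w + r2) w - driver f (clock nw f t w + r1) w)%N.
Proof.
move=> t0 r10 r12; rewrite /restarted subnBA ?subnK//; apply: counts_mono;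
  by rewrite ?clock_ge0// ?addr_ge0 ?clock_ge0// lerDl// (le_trans r10).
Qed.

Lemma path_difference_event (r1 r2 : R) n : 0 <= r1 -> 0 <= r2 ->
  <<s preimages [set t | 0 <= t] (fun (t : R) (path : R -> nat) => path t) >>
    [set path : R -> nat | (path r2 - path r1)%N = n].
Proof.
move=> r10 r20.
set G := preimages _ _.
have coord (r : R) : 0 <= r ->
    measurable_fun setT (fun path : g_sigma_algebraType G => path r).
  move=> r0 _ B mB; apply: sub_sigma_algebra; exists r => //.
  by exists B.
have := measurable_fun_subn (coord r2 r20) (coord r1 r10) measurableT.
by move=> /(_ [set n]); rewrite setTI; apply.
Qed.

(** The clock of an arrival flow is deterministic: this is an increment of the
    driver itself. *)
Lemma arrival_restarted_law i t r1 r2 n : 0 <= t -> 0 <= r1 -> r1 < r2 ->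
  Pr S [set w | (restarted (arrival i) t r2 w - restarted (arrival i) t r1 w)%N = n] =
  (poisson_pmf (r2 - r1) n)%:E.
Proof.
move=> t0 r10 r12; have l0 : 0 <= arrival_rate nw i * t.
  by apply: mulr_ge0 => //; exact: (rate0 (arrival i)).
have -> : r2 - r1 = (arrival_rate nw i * t + r2) - (arrival_rate nw i * t + r1).
  by ring.
rewrite -(poisson_increment_law (driver_poisson dyn (arrival i))); last 2 first.
- by rewrite addr_ge0.
- by rewrite ltrD2l.
congr (Pr S _); apply/seteqP; split => w /=;
  by rewrite restarted_difference// ltW.
Qed.

(** The clock is random and depends on the policy; the law after t is part of
    admissibility, where it is given in physical time. Hence the division by the
    rate. *)
Lemma service_restarted_law a t r1 r2 n : 0 < service_rate nw a ->
  0 <= t -> 0 <= r1 -> r1 < r2 ->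
  Pr S [set w | (restarted (service a) t r2 w - restarted (service a) t r1 w)%N = n] =
  (poisson_pmf (r2 - r1) n)%:E.
Proof.
move=> m0 t0 r10 r12; pose m := service_rate nw a.
have mr r : m * (r / m) = r by rewrite mulrC divfK// gt_eqF.
have r20 : 0 <= r2 by rewrite (le_trans r10)// ltW.
have e10 : 0 <= r1 / m by rewrite divr_ge0// ltW.
have e20 : 0 <= r2 / m by rewrite divr_ge0// ltW.
have := service_law adm a t0 (path_difference_event n e10 e20).
rewrite /= !mr (poisson_increment_law (driver_poisson dyn _))// => <-.
by congr (Pr S _); apply/seteqP; split => w /=; rewrite !incrementE /= !mr.
Qed.

(** Abandonment rates may vanish, so that these laws are kept in physical time. *)
Lemma abandonment_increment_law i t k n : 0 <= t ->
  0 < abandonment_rate nw i * k%:R ->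
  Pr S [set w | increment nw (abandonment i) t k%:R w = n] =
  (poisson_pmf (abandonment_rate nw i * k%:R) n)%:E.
Proof.
move=> t0 g0.
have := abandonment_law adm i t0 (path_difference_event n (lexx 0) (ler0n R k)).
rewrite /= mulr0 (poisson_increment_law (driver_poisson dyn _))// subr0 => <-.
congr (Pr S _); apply/seteqP; split => w /=;
  by rewrite (incrementE _ _ 0) mulr0 restarted0 subn0.
Qed.

Definition fluctuation p J f t w : R :=
  dyadic_excess p J (fun k => (restarted f t k%:R w)%:R - k%:R).

Lemma expectation_fluctuation p J f t : (8 <= p)%N -> 0 <= t ->
  (forall r1 r2 n, 0 <= r1 -> r1 < r2 ->
    Pr S [set w | (restarted f t r2 w - restarted f t r1 w)%N = n] =
    (poisson_pmf (r2 - r1) n)%:E) ->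
  (\int[Pr S]_w (fluctuation p J f t w)%:E <= (2 * poisson_moment_bound p)%:E)%E.
Proof.
move=> p8 t0 law.
apply: (expectation_dyadic_excess (D := fun k w => restarted f t k%:R w)) => //.
- by move=> k; exact: measurable_restarted.
- by move=> w k l kl; apply: restarted_mono; rewrite // ler_nat.
- by move=> k l n kl; rewrite law ?ltr_nat// natrB// ltnW.
Qed.

Lemma measurable_fluctuation p J f t : 0 <= t ->
  measurable_fun setT (fluctuation p J f t).
Proof.
move=> t0; apply: (@measurable_dyadic_excess _ _ _ (fun k w => restarted f t k%:R w)).
by move=> k; exact: measurable_restarted.
Qed.

(** The index k of the series is an upper bound for the integral of the queue
    from time t on: the increment at k counts what the flow does while that
    integral grows by k. *)
Definition overshoot (C : R) i t w : \bar R :=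
  exp_overshoot C (fun k => increment nw (abandonment i) t k%:R w).

Lemma measurable_overshoot C i t : 0 <= t -> measurable_fun setT (overshoot C i t).
Proof.
move=> t0.
apply: (@measurable_exp_overshoot _ _ _ _ (fun k w => increment nw (abandonment i) t k%:R w)).
move=> k; apply: measurable_restarted => //.
by apply: mulr_ge0 => //; exact: (rate0 (abandonment i)).
Qed.

Lemma expectation_overshoot C i t : 0 <= t ->
  abandonment_rate nw i * (expR 1 - 1) + 1 <= C ->
  (\int[Pr S]_w overshoot C i t w <= 2%:E)%E.
Proof.
move=> t0 gC; have g0 : 0 <= abandonment_rate nw i := rate0 (abandonment i).
apply: (expectation_exp_overshoot
  (N := fun k w => increment nw (abandonment i) t k%:R w) g0 gC).
- move=> k; apply: measurable_restarted => //.
  by apply: mulr_ge0.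
- by move=> k n gk; exact: abandonment_increment_law.
- by move=> k w gk; rewrite incrementE /= gk restarted0.
Qed.

Lemma counts_restarted f t s w : clock nw f t w <= clock nw f s w -> 0 <= t ->
  (counts nw f s w)%:R - (counts nw f t w)%:R =
  (restarted f t (clock nw f s w - clock nw f t w) w)%:R :> R.
Proof.
move=> ts t0; rewrite /restarted subrKC natrB//.
by apply: counts_mono; rewrite ?clock_ge0.
Qed.

(** A single random v serves all later times, as long as the clock has advanced
    by at most 2 ^ J. *)
Lemma fluctuation_bound p J f t w : (0 < p)%N -> 0 <= t ->
  exists v, [/\ 0 <= v, v ^+ p <= fluctuation p J f t w &
    forall s, clock nw f t w <= clock nw f s w ->
      clock nw f s w - clock nw f t w <= 2 ^+ J ->
      `|(counts nw f s w)%:R - (counts nw f t w)%:R -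
        (clock nw f s w - clock nw f t w)| <= 11 * Num.sqrt (2 ^+ J) * v + 1].
Proof.
move=> p0 t0.
have mono r s : 0 <= r -> r <= s -> (restarted f t r w <= restarted f t s w)%N.
  by move=> r0 rs; exact: restarted_mono.
have [v [v0 vp vb]] := dyadic_maximal_monotone J p0 mono.
exists v; split => // s ts sJ; rewrite counts_restarted//.
have := vb (clock nw f s w - clock nw f t w); rewrite restarted0 subr0.
by apply => //; rewrite subr_ge0.
Qed.

Lemma clock_abandonmentB i t s w : 0 <= t -> t <= s ->
  clock nw (abandonment i) s w - clock nw (abandonment i) t w =
  abandonment_rate nw i * path_integral (waiting i ^~ w) t s.
Proof.
move=> t0 ts; rewrite !clock_abandonmentE -mulrBr.
by rewrite (path_integral_split t0 ts (waiting_tame i s w)).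
Qed.

Lemma clock_serviceB a t s w : 0 <= t -> t <= s ->
  clock nw (service a) s w - clock nw (service a) t w =
  service_rate nw a * path_integral (busy a ^~ w) t s.
Proof.
move=> t0 ts; rewrite !clock_serviceE -mulrBr.
by rewrite (path_integral_split t0 ts (busy_tame a s w)).
Qed.

Lemma clock_mono f t s w : 0 <= t -> t <= s -> clock nw f t w <= clock nw f s w.
Proof.
move=> t0 ts; rewrite -subr_ge0; case: f => [i|a|i].
- by rewrite /= -mulrBr mulr_ge0 ?subr_ge0//; exact: (rate0 (arrival i)).
- rewrite clock_serviceB// mulr_ge0//; first exact: (rate0 (service a)).
  by apply: path_integral_ge0 => // u _; exact: busy_ge0.
- rewrite clock_abandonmentB// mulr_ge0//; first exact: (rate0 (abandonment i)).
  by apply: path_integral_ge0 => // u; exact: waiting_ge0.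
Qed.

(** Let k be the integral of the queue rounded up. At most N k jobs abandon,
    where N k is the increment at k, and l is the excess of N k over C * k. By x
    ^ p <= p! * exp x, the power l ^ p is controlled by the term of the
    overshoot at k. *)
Lemma overshoot_bound p C i t s w : (0 < p)%N -> 0 <= t -> t <= s -> 0 <= C ->
  exists l, [/\ 0 <= l, ((l ^+ p)%:E <= p`!%:R%:E * overshoot C i t w)%E &
    (counts nw (abandonment i) s w)%:R - (counts nw (abandonment i) t w)%:R <=
      C * (path_integral (waiting i ^~ w) t s + 1) + l].
Proof.
move=> p0 t0 ts C0; set IQ := path_integral _ t s.
have IQ0 : 0 <= IQ by apply: path_integral_ge0 => // u; exact: waiting_ge0.
pose k := (Num.truncn IQ).+1.
have IQk : IQ <= k%:R by rewrite ltW// truncnS_gt.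
have kIQ : k%:R <= IQ + 1 by rewrite -natr1 lerD2r truncn_le.
pose N := increment nw (abandonment i) t k%:R w.
pose l : R := Num.max 0 (N%:R - C * k%:R).
have l0 : 0 <= l by rewrite /l le_max lexx.
exists l; split => //.
- apply: (@le_trans _ _ (p`!%:R%:E * (expR (N%:R - C * k%:R))%:E)%E).
    rewrite -EFinM lee_fin /l; have [xx|xx] := leP 0 (N%:R - C * k%:R).
      exact: le_pow_expR.
    by rewrite expr0n gtn_eqF// mulr_ge0// expR_ge0.
  apply: lee_wpmul2l; first by rewrite lee_fin.
  exact: (exp_overshoot_ge C (fun k => increment nw (abandonment i) t k%:R w)).
- rewrite counts_restarted//; last exact: clock_mono.
  have g0 : 0 <= abandonment_rate nw i := rate0 (abandonment i).
  apply: (@le_trans _ _ N%:R).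
    rewrite ler_nat /N incrementE; apply: restarted_mono => //.
      by rewrite subr_ge0; exact: clock_mono.
    by rewrite clock_abandonmentB//= ler_wpM2l.
  have : N%:R - C * k%:R <= l by rewrite /l le_max lexx orbT.
  by have := ler_wpM2l C0 kIQ; lra.
Qed.

End system_paths.

(** * One window of the network *)

Section window_errors.
Context {R : realType}.

(** The integrals b of the busy servers and q of the queue add up to x + e * d.
    Up to noise the services amount to m * b = m * (x + e * d - q), which leaves
    the defect (lam - m * e) * d of the fluid balance and the queue term m * q. *)
Lemma class2_error (dX a s2 r lam d na m b ns rr x q e k Bq : R) :
  dX = a - s2 - r -> `|a - lam * d| <= na -> `|s2 - m * b| <= ns ->
  0 <= r <= rr -> x = b + q - e * d -> `|(lam - m * e) * d| <= k ->
  0 <= m * q <= Bq ->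
  `|dX + m * x| <= k + (na + ns) + rr + Bq.
Proof.
move=> -> an sn /andP[r0 r1] -> dk /andP[q0 q1].
have -> : a - s2 - r + m * (b + q - e * d) =
    (a - lam * d) - (s2 - m * b) + (lam - m * e) * d - r + m * q by ring.
by move: an sn dk; rewrite !ler_norml; lra.
Qed.

(** As for class 2, with two pools: pool 1 serves b1 = N * d - y at rate m1,
    pool 2 serves b2 = x + e * d - q - b1 at rate m2. The difference of the
    rates multiplies y. *)
Lemma class1_error (dX a s1 s2 r lam d na m1 m2 b1 b2 ns1 ns2 rr x q e k Bq y N : R) :
  dX = a - (s1 + s2) - r -> `|a - lam * d| <= na ->
  `|s1 - m1 * b1| <= ns1 -> `|s2 - m2 * b2| <= ns2 ->
  0 <= r <= rr -> x = b1 + b2 + q - e * d -> y = N * d - b1 ->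
  `|(lam - m1 * N - m2 * (e - N)) * d| <= k ->
  0 <= m2 * q <= Bq ->
  `|dX + m2 * x + (m2 - m1) * y| <= k + (na + ns1 + ns2) + rr + Bq.
Proof.
move=> -> an sn1 sn2 /andP[r0 r1] -> -> dk /andP[q0 q1].
have -> : a - (s1 + s2) - r + m2 * (b1 + b2 + q - e * d) + (m2 - m1) * (N * d - b1) =
    (a - lam * d) - (s1 - m1 * b1) - (s2 - m2 * b2)
    + (lam - m1 * N - m2 * (e - N)) * d - r + m2 * q by ring.
by move: an sn1 sn2 dk; rewrite !ler_norml; lra.
Qed.

Lemma error_budget (B C sq P l Iq M : R) :
  1 <= B -> 0 <= C -> 1 <= sq -> 0 <= P -> 0 <= l -> 0 <= Iq ->
  sq + P + l + Iq <= M ->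
  B * sq + (22 * B * P + 3) + (C * (Iq + 1) + l) + B * Iq <=
    (22 * B + C + 3) * M.
Proof.
move=> B1 C0 sq1 P0 l0 Iq0 M1.
have F0 : 0 <= 22 * B + C + 3 by lra.
apply: le_trans (ler_wpM2l F0 M1).
have := mulr_ge0 C0 P0; have := mulr_ge0 C0 l0; have := mulr_ge0 C0 Iq0.
have B0 : 0 <= B by lra.
have := mulr_ge0 B0 P0; have := mulr_ge0 B0 l0; have := mulr_ge0 B0 Iq0.
have sq0 : 0 <= sq by lra.
have := mulr_ge0 B0 sq0; have := ler_wpM2l C0 sq1.
by clear -sq1 l0 P0 Iq0; lra.
Qed.

Lemma unit_time_error (x d k : R) : 0 <= d <= 1 -> `|x| <= k -> `|x * d| <= k.
Proof.
move=> /andP[d0 d1] xk.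
by rewrite normrM (ger0_norm d0) (le_trans _ xk)// ler_piMr.
Qed.

Lemma le_affine_budget (B C h z sq D M : R) :
  0 <= B -> 0 <= h -> h <= 1 -> 0 <= z -> z + sq <= M ->
  0 <= sq -> 0 <= D -> 0 <= C ->
  2 * (B * z + B * h * (B * sq) + D * M) + C * (D * M) <=
  (2 * (B + B ^+ 2 + D) + C * D) * M.
Proof.
move=> B0 h0 h1 z0 M1 s0 D0 C0.
have zM : z <= M by lra.
have sM : sq <= M by lra.
have := ler_wpM2l B0 zM.
have : B * h * (B * sq) <= B ^+ 2 * M.
  rewrite (_ : B * h * (B * sq) = B ^+ 2 * (h * sq)); last by ring.
  rewrite ler_wpM2l ?exprn_ge0// (le_trans _ sM)// ler_piMl//.
by clear; lra.
Qed.

End window_errors.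

Section system_window.
Context {R : realType}.

(** What the argument uses of a network at a single index n. The last three
    fields bound by O(sqrt n) the defects, before the limit, in the fluid
    balance of each class and in the identity between total equilibrium and
    total number of servers. *)
Record well_scaled (nw : network R) (L : limit_parameters R) (n : nat) (c B : R)
    : Prop := WellScaled {
  scaled_service : forall a, c <= service_rate nw a <= B;
  scaled_arrival : forall i, arrival_rate nw i <= B * n%:R;
  scaled_abandonment : forall i, abandonment_rate nw i <= B;
  scaled_servers : forall j, (servers nw j)%:R <= B * n%:R;
  scaled_drift1 : `|arrival_rate nw class1
    - service_rate nw act11 * (servers nw pool1)%:R
    - service_rate nw act12
      * (n%:R * fluid_equilibrium L class1 - (servers nw pool1)%:R)|
    <= B * Num.sqrt n%:R;
  scaled_drift2 : `|arrival_rate nw class2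
    - service_rate nw act22 * (n%:R * fluid_equilibrium L class2)|
    <= B * Num.sqrt n%:R;
  scaled_pools : (servers nw pool1)%:R + (servers nw pool2)%:R
    - n%:R * fluid_equilibrium L class1 - n%:R * fluid_equilibrium L class2
    <= B * Num.sqrt n%:R
}.

Context (nw : network R) (S : system R) (L : limit_parameters R) (n p J : nat)
  (c B : R).
Hypotheses (dyn : network_dynamics nw S) (adm : admissible nw S)
  (rate0 : forall f, 0 <= rate nw f) (n0 : (0 < n)%N) (p0 : (0 < p)%N)
  (c0 : 0 < c) (B1 : 1 <= B) (scl : well_scaled nw L n c B)
  (J1 : B ^+ 2 * n%:R <= 2 ^+ J) (J2 : 2 ^+ J <= 4 * (B ^+ 2 * n%:R)).
Local Notation I := path_integral.
Local Notation sq := (Num.sqrt n%:R : R).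
Implicit Types (s t : R) (w : Omega S) (i : class).

Definition deviation i t w : R := state i t w - n%:R * fluid_equilibrium L i.

(** Short enough for a deviation to change within a window by a fraction of
    order B * h <= 1 / 16 only, and chosen so that c * h = 16 * (B * h) ^ 2. *)
Definition window_length : R := c / (16 * B ^+ 2).
(** At least g * (expR 1 - 1) + 1 for every abandonment rate g <= B, as
    [expectation_exp_overshoot] demands. *)
Definition overshoot_slope : R := B * expR 1 + 1.
(** The constant 22 * B comes from 11 * sqrt (2 ^ J) <= 22 * B * sqrt n in
    [fluctuation_bound]; 3 pays for the rounding errors of three flows. *)
Definition noise_factor : R := 22 * B + overshoot_slope + 3.
Definition class2_weight : R := 16 * B / c.
Definition window_factor : R :=
  2 * (B + B ^+ 2 + noise_factor) + (1 + 2 * class2_weight) * noise_factor.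
Definition contraction_rate : R := 1 - c * window_length / 4.
Definition lyapunov t w : R :=
  `|deviation class1 t w| + class2_weight * `|deviation class2 t w|.

Let h := window_length.

Lemma bound_gt0 : 0 < B. Proof. exact: lt_le_trans B1. Qed.

Lemma window_length_gt0 : 0 < h.
Proof. by rewrite divr_gt0// mulr_gt0// exprn_gt0// bound_gt0. Qed.

Lemma window_length_le1 : h <= 1.
Proof.
have cB : c <= B by have /andP[cm mB] := scaled_service scl act11; exact: le_trans mB.
rewrite ler_pdivrMr ?mul1r ?mulr_gt0 ?exprn_gt0 ?bound_gt0//.
by move: B1 cB; nra.
Qed.

Lemma sq_ge1 : 1 <= sq.
Proof. by rewrite -[leLHS]sqrtr1 ler_wsqrtr// ler1n. Qed.

Lemma sqrt_pow_le : Num.sqrt (2 ^+ J) <= 2 * B * sq.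
Proof.
have -> : 2 * B * sq = Num.sqrt (4 * (B ^+ 2 * n%:R)).
  rewrite mulrA sqrtrM ?mulr_ge0 ?exprn_ge0 ?(ltW bound_gt0)//.
  congr (_ * _); rewrite (_ : 4 * B ^+ 2 = (2 * B) ^+ 2); last by ring.
  by rewrite sqrtr_sqr ger0_norm// mulr_ge0// ltW// bound_gt0.
by rewrite ler_wsqrtr.
Qed.

Lemma arrival_clock_le i t s w : 0 <= t -> t <= s -> s <= t + h ->
  clock nw (arrival i) s w - clock nw (arrival i) t w <= 2 ^+ J.
Proof.
move=> t0 ts sh; rewrite /= -mulrBr; apply: le_trans J1.
have st : s - t <= 1 by have := window_length_le1; rewrite lerBlDl; move: sh; lra.
apply: (@le_trans _ _ (arrival_rate nw i)).
  by rewrite -[leRHS]mulr1 ler_wpM2l//; exact: (rate0 (arrival i)).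
apply: (le_trans (scaled_arrival scl i)).
by rewrite ler_wpM2r// expr2 ler_peMr// ltW// bound_gt0.
Qed.

Lemma service_clock_le a t s w : 0 <= t -> t <= s -> s <= t + h ->
  clock nw (service a) s w - clock nw (service a) t w <= 2 ^+ J.
Proof.
move=> t0 ts sh; rewrite clock_serviceB//; apply: le_trans J1.
have st : s - t <= 1 by have := window_length_le1; rewrite lerBlDl; move: sh; lra.
have /andP[cm mB] := scaled_service scl a.
have m0 : 0 <= service_rate nw a := rate0 (service a).
have Ib : I (busy a ^~ w) t s <= B * n%:R.
  have tb : tame t s (busy a ^~ w) by apply: tameS (busy_tame dyn adm a s w).
  apply: (@le_trans _ _ (I (fun=> B * n%:R) t s)).
    apply: le_path_integral => //; first exact: tame_cst.
    move=> u /andP[tu _]; apply: (le_trans (busy_le adm a w (le_trans t0 tu))).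
    exact: scaled_servers scl _.
  by rewrite path_integral_cst// ler_piMr// mulr_ge0// ltW// bound_gt0.
rewrite expr2 -mulrA ler_pM//.
by apply: path_integral_ge0 => // u _; exact: busy_ge0.
Qed.

(** The leading 1 stands, after multiplication by sqrt n, for the defects of the
    fluid balance and the rounding errors. *)
Definition window_noise (v : flow -> R) (l : class -> R) : R :=
  1 + (v (arrival class1) + v (arrival class2)) +
  (v (service act11) + v (service act12) + v (service act22)) +
  (l class1 + l class2).

(** The balance equations over [t, t + h] are brought into the form of
    [window_contraction]. The sizes v and l of the noise depend on the path; the
    bounds on their p-th powers are what survives in expectation. *)
Lemma system_window t w : 0 <= t -> exists (v : flow -> R) (l : class -> R),
  [/\ forall f, 0 <= v f /\ v f ^+ p <= fluctuation nw p J f t w,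
      forall i, 0 <= l i /\
        ((l i ^+ p)%:E <= p`!%:R%:E * overshoot nw overshoot_slope i t w)%E &
      let M := sq * window_noise v l +
        (I (waiting class1 ^~ w) t (t + h) + I (waiting class2 ^~ w) t (t + h)) in
      lyapunov (t + h) w <= contraction_rate * lyapunov t w + window_factor * M /\
      forall s, t <= s <= t + h ->
        `|deviation class1 s w| + `|deviation class2 s w|
          <= 4 * lyapunov t w + 2 * (window_factor * M)].
Proof.
move=> t0; have h0 := window_length_gt0; have h1 := window_length_le1.
have tht : t <= t + h by rewrite lerDl ltW.
have th0 : 0 <= t + h by exact: le_trans tht.
have C0 : 0 <= overshoot_slope by rewrite addr_ge0// mulr_ge0 ?expR_ge0 ?(ltW bound_gt0).
have [v vP] := choice (fun f => fluctuation_bound dyn adm rate0 J f w p0 t0).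
have [l lP] := choice (fun i => overshoot_bound dyn adm rate0 i w p0 t0 tht C0).
exists v, l; split.
- by move=> f; have [v0 vp _] := vP f.
- by move=> i; have [l0 lp _] := lP i.
set IQ1 := I (waiting class1 ^~ w) t (t + h).
set IQ2 := I (waiting class2 ^~ w) t (t + h).
move=> M.
have sq1 := sq_ge1.
have sqJ := sqrt_pow_le.
have b0 := bound_gt0.
have v0 f : 0 <= v f by have [] := vP f.
have l0 i : 0 <= l i by have [] := lP i.
have noise f s : t <= s <= t + h ->
    clock nw f s w - clock nw f t w <= 2 ^+ J ->
    `|(counts nw f s w)%:R - (counts nw f t w)%:R
      - (clock nw f s w - clock nw f t w)| <= 22 * B * (sq * v f) + 1.
  move=> /andP[ts sh] sJ; have [_ _ /(_ s)] := vP f.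
  move=> /(_ (clock_mono dyn adm rate0 f w t0 ts) sJ) /le_trans; apply.
  rewrite lerD2r; have := ler_wpM2r (v0 f) sqJ; lra.
have aband i s : t <= s <= t + h ->
    0 <= ((counts nw (abandonment i) s w)%:R
      - (counts nw (abandonment i) t w)%:R : R)
      <= overshoot_slope * (I (waiting i ^~ w) t (t + h) + 1) + l i.
  move=> /andP[ts sh]; have [_ _ lb] := lP i; apply/andP; split.
    rewrite subr_ge0 ler_nat; apply: (counts_mono dyn).
      exact: (clock_ge0 adm rate0).
    exact: (clock_mono dyn adm rate0).
  apply: le_trans lb; rewrite lerD2r ler_nat; apply: (counts_mono dyn).
    by apply: (clock_ge0 adm rate0); exact: le_trans ts.
  by apply: (clock_mono dyn adm rate0) => //; exact: le_trans ts.
pose x1 u := deviation class1 u w; pose x2 u := deviation class2 u w.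
pose y u := idle1 nw u w.
pose q u := waiting class1 u w + waiting class2 u w.
have tX i s : t <= s <= t + h -> tame t s (state i ^~ w).
  by move=> /andP[ts _]; apply: tameS (state_tame dyn rate0 i s w).
have tZ a s : t <= s <= t + h -> tame t s (busy a ^~ w).
  by move=> /andP[ts _]; apply: tameS (busy_tame dyn adm a s w).
have tQ i s : t <= s <= t + h -> tame t s (waiting i ^~ w).
  by move=> /andP[ts _]; apply: tameS (waiting_tame dyn adm rate0 i s w).
have thI : t <= t + h <= t + h by rewrite tht lexx.
have tx i s : t <= s <= t + h -> tame t s (deviation i ^~ w).
  by move=> sI; apply: tameB; [exact: tX|exact: tame_cst].
have ty s : t <= s <= t + h -> tame t s y.
  by move=> sI; apply: tameB; [exact: tame_cst|exact: tZ].
have tq : tame t (t + h) q by apply: tameD; exact: tQ.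
have IQ_le i s : t <= s <= t + h ->
    0 <= I (waiting i ^~ w) t s <= I (waiting i ^~ w) t (t + h).
  move=> sI; have /andP[ts sh] := sI; apply/andP; split.
    by apply: path_integral_ge0 => // u; exact: (waiting_ge0 adm).
  rewrite -subr_ge0 (path_integral_split ts sh (tQ i _ thI)).
  by apply: path_integral_ge0; [exact: le_trans ts|move=> u; exact: (waiting_ge0 adm)].
have IQ10 : 0 <= IQ1 by have /andP[] := IQ_le class1 _ thI.
have IQ20 : 0 <= IQ2 by have /andP[] := IQ_le class2 _ thI.
have ME : M = sq + (sq * v (arrival class1) + sq * v (arrival class2)) +
    (sq * v (service act11) + sq * v (service act12) + sq * v (service act22)) +
    (sq * l class1 + sq * l class2) + (IQ1 + IQ2).
  by rewrite /M /window_noise; ring.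
have NF0 : 0 <= noise_factor by rewrite !addr_ge0// mulr_ge0// ltW.
have sqv f : 0 <= sq * v f by rewrite mulr_ge0// (le_trans _ sq1).
have sql i : l i <= sq * l i by rewrite ler_peMl.
have ds s : t <= s <= t + h -> 0 <= s - t <= 1.
  by move=> /andP[ts sh]; rewrite subr_ge0 ts/=; move: sh h1; lra.
have sqB0 : 0 <= B * sq by rewrite mulr_ge0 ?(ltW b0)// (le_trans _ sq1).
have [m11I m12I m22I] := And3 (scaled_service scl act11)
   (scaled_service scl act12) (scaled_service scl act22).
have mQ a i s : t <= s <= t + h ->
    0 <= service_rate nw a * I (waiting i ^~ w) t s <= B * I (waiting i ^~ w) t (t + h).
  move=> sI; have /andP[i0 i1] := IQ_le i s sI.
  have /andP[cm mB] := scaled_service scl a.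
  have m0 : 0 <= service_rate nw a by exact: le_trans (ltW c0) cm.
  by rewrite mulr_ge0// ler_pM.
have x2E s : t <= s <= t + h ->
    `|x2 s - x2 t + service_rate nw act22 * I x2 t s| <= noise_factor * M.
  move=> sI; have /andP[ts sh] := sI; have /andP[d0 d1] := ds s sI.
  have s0 : 0 <= s by exact: le_trans ts.
  have noiseA := noise (arrival class2) s sI (arrival_clock_le class2 w t0 ts sh).
  have noiseS := noise (service act22) s sI (service_clock_le act22 w t0 ts sh).
  rewrite clock_serviceB//= in noiseS; rewrite /= -mulrBr in noiseA.
  have Xs := state_balance dyn class2 w s0; have Xt := state_balance dyn class2 w t0.
  rewrite !sum_class2 in Xs Xt.
  have -> : x2 s - x2 t = state class2 s w - state class2 t w.
    by rewrite /x2 /deviation; lra.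
  have -> : I x2 t s = I (busy act22 ^~ w) t s + I (waiting class2 ^~ w) t s
      - n%:R * fluid_equilibrium L class2 * (s - t).
    have -> : x2 = fun u => busy act22 u w + waiting class2 u w
        - n%:R * fluid_equilibrium L class2.
      by apply/funext => u; rewrite /x2 /deviation waiting2E; lra.
    rewrite path_integralB//; last exact: tame_cst.
      by rewrite path_integralD ?path_integral_cst//; [exact: tZ|exact: tQ].
    by apply: tameD; [exact: tZ|exact: tQ].
  apply: (@le_trans _ _ (B * sq +
      (22 * B * (sq * v (arrival class2)) + 1 + (22 * B * (sq * v (service act22)) + 1)) +
      (overshoot_slope * (IQ2 + 1) + l class2) + B * IQ2)).
    apply: (class2_error _ noiseA noiseS (aband class2 s sI) erefl _ (mQ act22 class2 s sI)).
    - by rewrite Xs Xt; ring.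
    - by apply: unit_time_error; [exact: ds|exact: scaled_drift2 scl].
  have := @error_budget R B overshoot_slope sq
    (sq * v (arrival class2) + sq * v (service act22)) (l class2) IQ2 M
    B1 C0 sq1 (addr_ge0 (sqv _) (sqv _)) (l0 _) IQ20.
  rewrite -/noise_factor => budget; apply: le_trans (budget _).
    by rewrite lerD2r lerD2r lerD2l; lra.
  have := sqv (arrival class1); have := sqv (service act11).
  have := sqv (service act12).
  have := sql class1; have := sql class2; have := l0 class1; have := l0 class2.
  by rewrite ME; lra.
have x1E s : t <= s <= t + h ->
    `|x1 s - x1 t + service_rate nw act12 * I x1 t s +
      (service_rate nw act12 - service_rate nw act11) * I y t s| <= noise_factor * M.
  move=> sI; have /andP[ts sh] := sI; have /andP[d0 d1] := ds s sI.
  have s0 : 0 <= s by exact: le_trans ts.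
  have noiseA := noise (arrival class1) s sI (arrival_clock_le class1 w t0 ts sh).
  have noiseS1 := noise (service act11) s sI (service_clock_le act11 w t0 ts sh).
  have noiseS2 := noise (service act12) s sI (service_clock_le act12 w t0 ts sh).
  rewrite clock_serviceB//= in noiseS1; rewrite clock_serviceB//= in noiseS2.
  rewrite /= -mulrBr in noiseA.
  have Xs := state_balance dyn class1 w s0; have Xt := state_balance dyn class1 w t0.
  rewrite !sum_class1 in Xs Xt.
  have -> : x1 s - x1 t = state class1 s w - state class1 t w.
    by rewrite /x1 /deviation; ring.
  have x1_int : I x1 t s = I (busy act11 ^~ w) t s + I (busy act12 ^~ w) t s
      + I (waiting class1 ^~ w) t s - n%:R * fluid_equilibrium L class1 * (s - t).
    have -> : x1 = fun u => busy act11 u w + busy act12 u w + waiting class1 u w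
        - n%:R * fluid_equilibrium L class1.
      by apply/funext => u; rewrite /x1 /deviation waiting1E; ring.
    have tZs := tameD (tZ act11 s sI) (tZ act12 s sI).
    have tZQ := tameD tZs (tQ class1 s sI).
    rewrite (path_integralB tZQ (tame_cst _ _ _)) (path_integralD tZs (tQ class1 s sI)).
    by rewrite (path_integralD (tZ act11 s sI) (tZ act12 s sI)) path_integral_cst.
  have y_int : I y t s = (servers nw pool1)%:R * (s - t) - I (busy act11 ^~ w) t s.
    by rewrite (path_integralB (tame_cst _ _ _) (tZ act11 s sI)) path_integral_cst.
  apply: (@le_trans _ _ (B * sq +
      (22 * B * (sq * v (arrival class1)) + 1 + (22 * B * (sq * v (service act11)) + 1)
        + (22 * B * (sq * v (service act12)) + 1)) +
      (overshoot_slope * (IQ1 + 1) + l class1) + B * IQ1)).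
    apply: (class1_error _ noiseA noiseS1 noiseS2 (aband class1 s sI)
      x1_int y_int _ (mQ act12 class1 s sI)).
    - by rewrite Xs Xt; ring.
    - by apply: unit_time_error; [exact: ds|exact: scaled_drift1 scl].
  have := @error_budget R B overshoot_slope sq
    (sq * v (arrival class1) + sq * v (service act11) + sq * v (service act12)) (l class1) IQ1 M
    B1 C0 sq1 (addr_ge0 (addr_ge0 (sqv _) (sqv _)) (sqv _)) (l0 _) IQ10.
  rewrite -/noise_factor => budget; apply: le_trans (budget _).
    by rewrite lerD2r lerD2r lerD2l; lra.
  have := sqv (arrival class2); have := sqv (service act22).
  have := sql class1; have := sql class2; have := l0 class1; have := l0 class2.
  by rewrite ME; lra.
(* Counting all jobs and all servers, x1 + x2 = q - y - y' + O(sqrt n) with y'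
   >= 0 the idleness of pool 2. *)
have yq s : t <= s <= t + h -> 0 <= q s /\ 0 <= y s <= q s - x1 s - x2 s + B * sq.
  move=> /andP[ts _]; have s0 : 0 <= s by exact: le_trans ts.
  split; first by apply: addr_ge0; exact: (waiting_ge0 adm).
  have := pool1_le adm w s0; have := pool2_le adm w s0; have := scaled_pools scl.
  rewrite /q /y /x1 /x2 /deviation /idle1 waiting1E waiting2E.
  by move=> ? ? ?; apply/andP; split; lra.
have qI : I q t (t + h) <= IQ1 + IQ2.
  by rewrite path_integralD//; exact: tQ.
have [V1 Vs] := window_contraction c0 m11I m12I m22I B1 erefl sqB0
  (tx class1 _ thI) (tx class2 _ thI) (ty _ thI) tq yq qI x2E x1E.
have rM : 2 * (B * (IQ1 + IQ2) + B * h * (B * sq) + noise_factor * M) +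
    (1 + 2 * class2_weight) * (noise_factor * M) <= window_factor * M.
  apply: le_affine_budget => //.
  - exact: ltW.
  - exact: ltW.
  - exact: addr_ge0.
  - have ll : 0 <= (sq * l class1 + sq * l class2).
      by rewrite addr_ge0// (le_trans _ (sql _)).
    have := addr_ge0 (sqv (arrival class1)) (sqv (arrival class2)).
    have := addr_ge0 (addr_ge0 (sqv (service act11)) (sqv (service act12))) (sqv (service act22)).
    by rewrite ME; lra.
  - by rewrite addr_ge0// mulr_ge0// divr_ge0// ?mulr_ge0// ltW.
split.
  by apply: (le_trans V1); rewrite lerD2l.
move=> s sI; apply: (le_trans (Vs s sI)).
by rewrite lerD2l ler_wpM2l.
Qed.

End system_window.

(** * One window in powers *)

Section power_paths.
Context {R : realType}.
Implicit Types (m a b t : R) (f : R -> R).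
Local Notation I := path_integral.

Lemma powR_le_pow m (p : nat) (x : R) : 0 <= m -> m <= p%:R -> 0 <= x ->
  x `^ m <= 1 + x ^+ p.
Proof.
move=> m0 mp x0; have [x1|x1] := leP x 1.
  apply: (@le_trans _ _ 1); last by rewrite lerDl exprn_ge0.
  have := ge0_ler_powR m0 (x0 : x \in Num.nneg) (ler01 : (1 : R) \in Num.nneg) x1.
  by rewrite powR1.
rewrite -powR_mulrn// (@le_trans _ _ (x `^ p%:R))// ?lerDr//.
by rewrite ler_powR// ltW.
Qed.

Lemma tame_powR m a b f : 0 <= m -> (forall t, a <= t <= b -> 0 <= f t) ->
  tame a b f -> tame a b (fun t => f t `^ m).
Proof.
move=> m0 f0 [mf [G fG]]; split.
  by apply: (measurableT_comp (measurable_powR _)).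
exists (`|G| `^ m) => t tab; rewrite ger0_norm ?powR_ge0//.
rewrite ge0_ler_powR ?nnegrE ?f0//.
by rewrite -(ger0_norm (f0 t tab)) (le_trans (fG t tab))// ler_norm.
Qed.

Lemma EFin_path_integral a b f : tame a b f ->
  (\int[lebesgue_measure]_(t in `[a, b]) (f t)%:E)%E = (I f a b)%:E.
Proof.
move=> tf; rewrite /path_integral /Rintegral fineK//.
by apply: integrable_fin_num => //; exact: tame_integrable.
Qed.

(** Jensen's inequality up to the factor 2 `^ m: integrate [le_truncated_powR]
    with c half of the integral of f. Over an interval of length at most 1 the
    constant c integrates to at most c, the other half. *)
Lemma powR_path_integral m a b f : 1 <= m -> a <= b -> b <= a + 1 ->
  (forall t, a <= t <= b -> 0 <= f t) -> tame a b f ->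
  I f a b `^ m <= 2 `^ m * I (fun t => f t `^ m) a b.
Proof.
move=> m1 ab ba f0 tf; have m0 : 0 <= m by lra.
have tm := tame_powR m0 f0 tf.
have I0 : 0 <= I f a b.
  by apply: Rintegral_ge0 => t; rewrite /= in_itv /=; exact: f0.
have Im0 : 0 <= I (fun t => f t `^ m) a b.
  by apply: Rintegral_ge0 => t _; exact: powR_ge0.
have [A0|A0] := eqVneq (I f a b) 0.
  by rewrite A0 powR0 ?mulr_ge0 ?powR_ge0//; lra.
pose c := I f a b / 2.
have c0 : 0 < c by rewrite divr_gt0// lt_neqAle eq_sym A0.
have Ac : I f a b = 2 * c by rewrite /c; field.
clearbody c.
have cI : c <= c `^ (1 - m) * I (fun t => f t `^ m) a b.
  have : I f a b <= I (fun t => c + c `^ (1 - m) * f t `^ m) a b.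
    apply: le_path_integral => //.
      by apply: tameD; [exact: tame_cst|exact: tameZ].
    by move=> t tab; rewrite [c `^ _ * _]mulrC; apply: le_truncated_powR => //; exact: f0.
  rewrite path_integralD ?path_integral_cst ?path_integralZ//; first last.
    by apply: tameZ.
    by exact: tame_cst.
  have : c * (b - a) <= c by rewrite ler_piMr ?(ltW c0)//; lra.
  by rewrite Ac; lra.
rewrite Ac powRM ?(ltW c0)// ler_wpM2l ?powR_ge0//.
have cm : c `^ (m - 1) * c `^ (1 - m) = 1.
  by rewrite -powRD ?(gt_eqF c0) ?implybT// addrC subrKA subrr powRr0.
have := ler_wpM2l (powR_ge0 c (m - 1)) cI.
rewrite mulrA cm mul1r mulrC mulr_powRB1 ?(ltW c0)//; lra.
Qed.

End power_paths.

Section power_window.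
Context {R : realType} (nw : network R) (S : system R) (L : limit_parameters R)
  (n p J : nat) (m c B : R).
Hypotheses (dyn : network_dynamics nw S) (adm : admissible nw S)
  (rate0 : forall f, 0 <= rate nw f) (n0 : (0 < n)%N) (p8 : (8 <= p)%N)
  (m1 : 1 <= m) (mp : m <= p%:R)
  (c0 : 0 < c) (B1 : 1 <= B) (scl : well_scaled nw L n c B)
  (J1 : B ^+ 2 * n%:R <= 2 ^+ J) (J2 : 2 ^+ J <= 4 * (B ^+ 2 * n%:R)).
Local Notation I := path_integral.
Local Notation sq := (Num.sqrt n%:R : R).
Implicit Types (s t : R) (w : Omega S) (i : class).
Local Notation h := (window_length c B).
Local Notation th := (contraction_rate c B).
Local Notation WF := (window_factor c B).

Definition fluctuations t w : R :=
  fluctuation nw p J (arrival class1) t w + fluctuation nw p J (arrival class2) t w +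
  (fluctuation nw p J (service act11) t w + fluctuation nw p J (service act12) t w +
   fluctuation nw p J (service act22) t w).

Definition noise t w : \bar R :=
  ((1 + fluctuations t w)%:E +
   (overshoot nw (overshoot_slope B) class1 t w +
    overshoot nw (overshoot_slope B) class2 t w))%E.

Definition queue_power t w : R :=
  Q_hat n class1 t w `^ m + Q_hat n class2 t w `^ m.

Definition state_power t w : R := X_hat_norm n L t w `^ m.

Definition lyapunov_hat t w : R := lyapunov L n c B t w / sq.

(** Chosen so that gain * (8 * v) `^ m = (1 - th) * v `^ m: the time integral of
    the state over a window uses up all that the contraction takes away from the
    power of v. *)
Definition gain : R := (1 - th) / 8 `^ m.
(** There are 10 summands in [noise_power_bound]. The 9 collects the units that
    arise: 1 from [le_powR_sum], 1 from the first summand and 7 from x `^ m <= 1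
    + x ^ p. *)
Definition noise_power_factor : R := 2 `^ (m *+ 10) * (9 + p`!%:R + 2 `^ m).
Definition power_factor : R :=
  (gain * (4 * WF) `^ m + (1 - th) `^ (1 - m) * WF `^ m) * noise_power_factor.

Lemma sq_gt0 : 0 < sq. Proof. by rewrite sqrtr_gt0 ltr0n. Qed.

Lemma Q_hat_ge0 i t w : 0 <= t -> 0 <= Q_hat n i t w.
Proof. by move=> t0; rewrite divr_ge0 ?sqrtr_ge0//; exact: (waiting_ge0 adm). Qed.

Lemma Q_hat_tame i T w : tame 0 T (Q_hat n i ^~ w).
Proof.
have := tameZ (sq^-1) (waiting_tame dyn adm rate0 i T w).
by congr tame; apply/funext => t; rewrite mulrC.
Qed.

Lemma X_hat_norm_ge0 t w : 0 <= X_hat_norm n L t w.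
Proof. exact: sqrtr_ge0. Qed.

Lemma X_hat_norm_le t w : X_hat_norm n L t w <=
  (`|deviation L n class1 t w| + `|deviation L n class2 t w|) / sq.
Proof.
have s0 := sq_gt0.
have rhs0 : 0 <= (`|deviation L n class1 t w| + `|deviation L n class2 t w|) / sq.
  by rewrite divr_ge0 ?addr_ge0// ltW.
rewrite -[leRHS]ger0_norm// -sqrtr_sqr ler_wsqrtr// sum_classes.
have XE i : X_hat n L i t w = deviation L n i t w / sq by [].
rewrite !XE !expr_div_n -mulrDl ler_wpM2r// ?invr_ge0 ?sqr_ge0//.
rewrite [leRHS]sqrrD !real_normK ?num_real//.
by rewrite lerD2r lerDl mulrn_wge0// mulr_ge0.
Qed.

Lemma X_hat_norm_tame T w : tame 0 T (X_hat_norm n L ^~ w).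
Proof.
have tx i : tame 0 T (X_hat n L i ^~ w).
  have := tameZ (sq^-1) (tameB (state_tame dyn rate0 i T w)
    (tame_cst 0 T (n%:R * fluid_equilibrium L i))).
  by congr tame; apply/funext => t; rewrite mulrC.
have [m1' [G1 X1]] := tx class1; have [m2' [G2 X2]] := tx class2.
split.
  have -> : (X_hat_norm n L ^~ w) = Num.sqrt \o
      (fun t => X_hat n L class1 t w ^+ 2 + X_hat n L class2 t w ^+ 2).
    by apply/funext => t; rewrite /= -(sum_classes (fun i => X_hat n L i t w ^+ 2)).
  apply: (measurableT_comp (continuous_measurable_fun (@sqrt_continuous R))).
  by apply: measurable_funD; exact: measurable_funX.
exists (Num.sqrt (G1 ^+ 2 + G2 ^+ 2)) => t tT.
rewrite ger0_norm ?sqrtr_ge0// ler_wsqrtr// (sum_classes (fun i => X_hat n L i t w ^+ 2)).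
rewrite -(real_normK (num_real (X_hat n L class1 t w)))
  -(real_normK (num_real (X_hat n L class2 t w))).
have G10 : 0 <= G1 := le_trans (normr_ge0 _) (X1 t tT).
have G20 : 0 <= G2 := le_trans (normr_ge0 _) (X2 t tT).
by apply: lerD; apply: lerXn2r; rewrite ?nnegrE ?X1 ?X2.
Qed.

Lemma rate_bounds : 0 < th < 1.
Proof.
have hgt := window_length_gt0 c0 B1.
have hle := window_length_le1 B1 scl.
have chE : c * h = (c / B) ^+ 2 / 16.
  by rewrite /window_length; field; rewrite gt_eqF// (bound_gt0 B1).
have cB : c <= B by have /andP[cm mB] := scaled_service scl act11; exact: le_trans mB.
have cB1 : 0 <= c / B <= 1.
  by rewrite divr_ge0 ?(ltW c0) ?(ltW (bound_gt0 B1))//= ler_pdivrMr ?mul1r// (bound_gt0 B1).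
have ch0 : 0 < c * h by rewrite mulr_gt0.
have ch1 : c * h <= 16^-1.
  rewrite chE ler_piMl//; have /andP[? ?] := cB1.
  by rewrite expr_le1.
by rewrite /contraction_rate; apply/andP; split; lra.
Qed.

Lemma window_factor_gt0 : 0 < WF.
Proof.
have b0 : 0 <= B := ltW (bound_gt0 B1).
have K0 : 0 <= class2_weight c B by rewrite divr_ge0 ?(ltW c0)// mulr_ge0.
have D0 : 0 <= noise_factor B by rewrite !addr_ge0 ?mulr_ge0 ?expR_ge0.
have B2 : 0 <= B ^+ 2 by rewrite exprn_ge0.
apply: ltr_wpDr; first by rewrite mulr_ge0// addr_ge0// mulr_ge0.
rewrite mulr_gt0// -addrA ltr_wpDr ?(bound_gt0 B1)//.
by rewrite addr_ge0.
Qed.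

Lemma gain_gt0 : 0 < gain.
Proof.
have /andP[_ th1] := rate_bounds.
by rewrite divr_gt0 ?subr_gt0// powR_gt0.
Qed.

Lemma power_factor_gt0 : 0 < power_factor.
Proof.
have g0 := gain_gt0; have W0 := window_factor_gt0.
apply: mulr_gt0.
  rewrite ltr_wpDr ?mulr_ge0 ?powR_ge0// mulr_gt0// powR_gt0// mulr_gt0//.
by rewrite mulr_gt0 ?powR_gt0// ltr_wpDr ?powR_ge0// ltr_wpDr.
Qed.

(** By x <= 4 * v + 2 * WF * k, the power of x is at most (8 * v) `^ m plus that
    of k; [powR_contraction] treats v'. *)
Lemma power_step (v v' x k : R) : 0 <= v -> 0 <= v' -> 0 <= k ->
  v' <= th * v + WF * k -> 0 <= x <= 4 * v + 2 * (WF * k) ->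
  gain * x `^ m + v' `^ m <= v `^ m +
    (gain * (4 * WF) `^ m + (1 - th) `^ (1 - m) * WF `^ m) * k `^ m.
Proof.
move=> v0 v'0 k0 v'v /andP[x0 xv].
have m0 : 0 <= m := le_trans ler01 m1.
have W0 := ltW window_factor_gt0.
have thI := rate_bounds; have /andP[th0 th1] := thI.
have Wk0 : 0 <= WF * k by rewrite mulr_ge0.
have xm : x `^ m <= 8 `^ m * v `^ m + (4 * WF) `^ m * k `^ m.
  apply: (@le_trans _ _ ((4 * v + 2 * (WF * k)) `^ m)).
    by rewrite ge0_ler_powR ?nnegrE// addr_ge0// mulr_ge0.
  apply: (le_trans (le_powRD m0 _ _)); rewrite ?mulr_ge0//.
  rewrite mulrDr -!powRM ?mulr_ge0// (_ : 2 * (4 * v) = 8 * v); last by ring.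
  by rewrite (_ : 2 * (2 * (WF * k)) = 4 * WF * k)//; ring.
have vm : v' `^ m <= th * v `^ m + (1 - th) `^ (1 - m) * WF `^ m * k `^ m.
  apply: (@le_trans _ _ ((th * v + WF * k) `^ m)).
    by rewrite ge0_ler_powR ?nnegrE// addr_ge0// mulr_ge0// ltW.
  apply: (le_trans (powR_contraction m1 thI v0 Wk0)).
  by rewrite powRM// mulrA.
have := ler_wpM2l (ltW gain_gt0) xm.
have -> : gain * (8 `^ m * v `^ m + (4 * WF) `^ m * k `^ m) =
  (1 - th) * v `^ m + gain * (4 * WF) `^ m * k `^ m.
  by rewrite /gain; field; rewrite gt_eqF// powR_gt0.
by lra.
Qed.

Lemma noise_power_bound (a1 a2 s1 s2 s3 l1 l2 q1 q2 f g : R) :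
  0 <= a1 -> 0 <= a2 -> 0 <= s1 -> 0 <= s2 -> 0 <= s3 -> 0 <= l1 -> 0 <= l2 ->
  0 <= q1 -> 0 <= q2 ->
  a1 ^+ p + a2 ^+ p + (s1 ^+ p + s2 ^+ p + s3 ^+ p) <= f ->
  l1 ^+ p + l2 ^+ p <= p`!%:R * g ->
  forall b, q1 `^ m + q2 `^ m <= 2 `^ m * b -> 0 <= b ->
  (1 + (a1 + a2) + (s1 + s2 + s3) + (l1 + l2) + (q1 + q2)) `^ m <=
    noise_power_factor * (1 + f + g + b).
Proof.
move=> a10 a20 s10 s20 s30 l10 l20 q10 q20 fE gE b bE b0.
have m0 : 0 <= m := le_trans ler01 m1.
have := @le_powR_sum R R [:: 1; a1; a2; s1; s2; s3; l1; l2; q1; q2] Num.norm m m0 (@normr_ge0 _ _).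
rewrite !big_cons !big_nil !ger0_norm// powR1 !addr0 /=.
rewrite (_ : 1 + (a1 + (a2 + (s1 + (s2 + (s3 + (l1 + (l2 + (q1 + q2)))))))) =
  1 + (a1 + a2) + (s1 + s2 + s3) + (l1 + l2) + (q1 + q2)); last by ring.
move/le_trans; apply; rewrite -mulrA ler_wpM2l ?powR_ge0//.
have pw x : 0 <= x -> x `^ m <= 1 + x ^+ p by exact: powR_le_pow.
have := pw _ a10; have := pw _ a20; have := pw _ s10; have := pw _ s20.
have := pw _ s30; have := pw _ l10; have := pw _ l20.
have F1 : 1 <= p`!%:R :> R by rewrite ler1n fact_gt0.
have P1 : 0 <= 2 `^ m :> R by exact: powR_ge0.
have f0 : 0 <= f.
  by apply: le_trans fE; rewrite !addr_ge0 ?exprn_ge0.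
have g0 : 0 <= g.
  have : 0 <= p`!%:R * g by apply: le_trans gE; rewrite addr_ge0 ?exprn_ge0.
  by rewrite pmulr_rge0// (lt_le_trans _ F1).
have F0 : 0 <= p`!%:R :> R by [].
have := mulr_ge0 F0 f0; have := mulr_ge0 F0 b0.
have := mulr_ge0 P1 f0; have := mulr_ge0 P1 g0.
by lra.
Qed.

Lemma overshoot_ge0 C i t w : (0 <= overshoot nw C i t w)%E.
Proof. exact: exp_overshoot_ge0. Qed.

Lemma lyapunov_hat_ge0 t w : 0 <= lyapunov_hat t w.
Proof.
rewrite divr_ge0 ?(ltW sq_gt0)// addr_ge0// mulr_ge0// divr_ge0 ?(ltW c0)//.
by rewrite mulr_ge0// ltW// (bound_gt0 B1).
Qed.

Lemma state_power_tame T w : tame 0 T (state_power ^~ w).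
Proof.
apply: tame_powR; first exact: le_trans ler01 m1.
  by move=> t _; exact: X_hat_norm_ge0.
exact: X_hat_norm_tame.
Qed.

Lemma Q_hat_power_tame i T w : tame 0 T (fun t => Q_hat n i t w `^ m).
Proof.
apply: tame_powR; first exact: le_trans ler01 m1.
  by move=> t /andP[t0 _]; exact: Q_hat_ge0.
exact: Q_hat_tame.
Qed.

Lemma queue_power_tame T w : tame 0 T (queue_power ^~ w).
Proof. by apply: tameD; exact: Q_hat_power_tame. Qed.

(** The drift inequality for the m-th power of the Lyapunov function, written
    pathwise and in integrated form. *)
Lemma window_power t w : 0 <= t ->
  ((gain * I (state_power ^~ w) t (t + h) + lyapunov_hat (t + h) w `^ m)%:E <=
   (lyapunov_hat t w `^ m + power_factor * I (queue_power ^~ w) t (t + h))%:E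
   + power_factor%:E * noise t w)%E.
Proof.
move=> t0.
have pf0 := power_factor_gt0.
have m0 : 0 <= m := le_trans ler01 m1.
have h0 := window_length_gt0 c0 B1; have h1 := window_length_le1 B1 scl.
have s0 := sq_gt0; have sI0 : 0 <= sq^-1 by rewrite invr_ge0 ltW.
have tth : t <= t + h by rewrite lerDl ltW.
have th1 : t + h <= t + 1 by rewrite lerD2l.
have [v [l [vP lP]]] := system_window dyn adm rate0 n0 (leq_trans (isT : 0 < 8)%N p8)
  c0 B1 scl J1 J2 w t0.
set IQ1 := I _ t (t + h); set IQ2 := I (waiting class2 ^~ w) t (t + h).
move=> [V1 Vs].
have IQ0 i : 0 <= I (waiting i ^~ w) t (t + h).
  by apply: path_integral_ge0 => // u; exact: (waiting_ge0 adm).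
pose M := sq * window_noise v l + (IQ1 + IQ2).
pose k := window_noise v l + (IQ1 / sq + IQ2 / sq).
have v0 f : 0 <= v f by have [] := vP f.
have l0 i : 0 <= l i by have [] := lP i.
have k0 : 0 <= k by rewrite !addr_ge0// mulr_ge0//; exact: IQ0.
have Mk : M / sq = k by rewrite /M /k; field; rewrite gt_eqF.
have v1 : lyapunov_hat (t + h) w <= th * lyapunov_hat t w + WF * k.
  by rewrite /lyapunov_hat -Mk !mulrA -mulrDl ler_wpM2r.
have xs s : t <= s <= t + h ->
    X_hat_norm n L s w <= 4 * lyapunov_hat t w + 2 * (WF * k).
  move=> sI; apply: (le_trans (X_hat_norm_le s w)).
  by rewrite /lyapunov_hat -Mk !mulrA -mulrDl ler_wpM2r// -mulrA; exact: Vs.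
set x := 4 * _ + _ in xs.
have x0 : 0 <= x.
  by rewrite addr_ge0// mulr_ge0 ?lyapunov_hat_ge0// mulr_ge0// ltW// window_factor_gt0.
have sub f : tame 0 (t + h) f -> tame t (t + h) f by exact: tameS.
have Ix : I (state_power ^~ w) t (t + h) <= x `^ m.
  apply: (@le_trans _ _ (I (fun=> x `^ m) t (t + h))).
    apply: le_path_integral; [exact/sub/state_power_tame|exact: tame_cst|].
    by move=> s sI; rewrite ge0_ler_powR ?nnegrE ?X_hat_norm_ge0// xs.
  by rewrite path_integral_cst// ler_piMr ?powR_ge0// addrAC subrr add0r.
have xx : 0 <= x <= 4 * lyapunov_hat t w + 2 * (WF * k) by rewrite x0 lexx.
have step := power_step (lyapunov_hat_ge0 t w) (lyapunov_hat_ge0 (t + h) w) k0 v1 xx.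
have qm i : (I (waiting i ^~ w) t (t + h) / sq) `^ m <=
    2 `^ m * I (fun u => Q_hat n i u w `^ m) t (t + h).
  have -> : I (waiting i ^~ w) t (t + h) / sq = I (Q_hat n i ^~ w) t (t + h).
    rewrite mulrC -path_integralZ; last exact/sub/(waiting_tame dyn adm rate0).
    by congr path_integral; apply/funext => u; rewrite mulrC.
  apply: powR_path_integral => //; last exact/sub/Q_hat_tame.
  by move=> u /andP[tu _]; apply: Q_hat_ge0; exact: le_trans tu.
have bE : I (queue_power ^~ w) t (t + h) =
    I (fun u => Q_hat n class1 u w `^ m) t (t + h) +
    I (fun u => Q_hat n class2 u w `^ m) t (t + h).
  by rewrite path_integralD//; exact/sub/Q_hat_power_tame.
have b0 : 0 <= I (queue_power ^~ w) t (t + h).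
  by apply: path_integral_ge0 => // u _; rewrite addr_ge0 ?powR_ge0.
move: (lP class1) (lP class2) => [_]; rewrite /noise.
move: (overshoot_ge0 (overshoot_slope B) class1 t w) (overshoot_ge0 (overshoot_slope B) class2 t w).
(* An infinite overshoot makes the right-hand side infinite. *)
move: (overshoot nw _ class1 t w) (overshoot nw _ class2 t w) => [y1| |] [y2| |]//; last 3 first.
- by move=> ? ? ? ? /=; rewrite gt0_muley ?lte_fin//= leey.
- by move=> ? ? ? ? /=; rewrite gt0_muley ?lte_fin//= leey.
- by move=> ? ? ? ? /=; rewrite gt0_muley ?lte_fin//= leey.
rewrite -!EFinM !lee_fin => y10 y20 lp1 [_ lp2].
have f1 f : v f ^+ p <= fluctuation nw p J f t w by have [] := vP f.
have fE : v (arrival class1) ^+ p + v (arrival class2) ^+ p +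
    (v (service act11) ^+ p + v (service act12) ^+ p + v (service act22) ^+ p) <=
    fluctuations t w.
  by rewrite /fluctuations !lerD.
have gE : l class1 ^+ p + l class2 ^+ p <= p`!%:R * (y1 + y2).
  by rewrite mulrDr lerD.
have qE : (IQ1 / sq) `^ m + (IQ2 / sq) `^ m <= 2 `^ m * I (queue_power ^~ w) t (t + h).
  by rewrite bE mulrDr lerD// qm.
have km := noise_power_bound (v0 _) (v0 _) (v0 _) (v0 _) (v0 _) (l0 _) (l0 _)
  (divr_ge0 (IQ0 class1) (ltW s0)) (divr_ge0 (IQ0 class2) (ltW s0)) fE gE qE b0.
apply: (@le_trans _ _ (gain * x `^ m + lyapunov_hat (t + h) w `^ m)).
  by rewrite lerD2r ler_wpM2l// ltW// gain_gt0.
apply: (le_trans step); rewrite -addrA lerD2l -mulrDr /power_factor -mulrA.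
rewrite ler_wpM2l//.
  by rewrite addr_ge0// mulr_ge0 ?powR_ge0// ltW// gain_gt0.
apply: (le_trans km); rewrite le_eqVlt; apply/orP; left; apply/eqP.
by rewrite /= ; ring.
Qed.

End power_window.

(** * Expectations over consecutive windows *)

Section expected_windows.
Context {R : realType} (nw : network R) (S : system R) (L : limit_parameters R)
  (n p J : nat) (m c B : R).
Hypotheses (dyn : network_dynamics nw S) (adm : admissible nw S)
  (rate0 : forall f, 0 <= rate nw f) (n0 : (0 < n)%N) (p8 : (8 <= p)%N)
  (m1 : 1 <= m) (mp : m <= p%:R)
  (c0 : 0 < c) (B1 : 1 <= B) (scl : well_scaled nw L n c B)
  (J1 : B ^+ 2 * n%:R <= 2 ^+ J) (J2 : 2 ^+ J <= 4 * (B ^+ 2 * n%:R)).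
Local Notation I := path_integral.
Implicit Types (s t : R) (w : Omega S) (i : class).
Local Notation h := (window_length c B).
Local Notation gain := (gain m c B).
Local Notation PF := (power_factor p m c B).
Local Notation Xm := (state_power L n m).
Local Notation Qm := (queue_power n m).
Local Notation noise := (noise nw p J B).
Local Notation V := (lyapunov_hat L n c B).
Local Notation half := ([set t : R | 0 <= t] `*` [set: Omega S]).

(** Five fluctuations contribute 2 * poisson_moment_bound p each, two overshoots
    2 each, and 1 is the constant in [noise]. *)
Definition mean_noise : R := 5 + 10 * poisson_moment_bound p.

Lemma path_integral_point (f : R -> R) a : I f a a = 0.
Proof. by rewrite /path_integral set_itv1 Rintegral_set1. Qed.

Lemma fluctuations_ge0 t w : 0 <= fluctuations nw p J t w.
Proof. by rewrite !addr_ge0// dyadic_excess_ge0. Qed.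

Lemma noise_ge0 t w : (0 <= noise t w)%E.
Proof.
rewrite /noise !adde_ge0 ?overshoot_ge0//.
by rewrite lee_fin addr_ge0// fluctuations_ge0.
Qed.

Lemma windows_telescope K w :
  ((gain * I (Xm ^~ w) 0 (K%:R * h) + V (K%:R * h) w `^ m)%:E <=
   (V 0 w `^ m + PF * I (Qm ^~ w) 0 (K%:R * h))%:E
   + PF%:E * \sum_(k < K) noise (k%:R * h) w)%E.
Proof.
have h0 := window_length_gt0 c0 B1.
elim: K => [|K IH].
  by rewrite !mul0r !path_integral_point !mulr0 add0r addr0 big_ord0 mule0 adde0.
set T := K%:R * h in IH *.
have T0 : 0 <= T by rewrite mulr_ge0// ltW.
have -> : K.+1%:R * h = T + h by rewrite -natr1 mulrDl mul1r.
have TTh : T <= T + h by rewrite lerDl ltW.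
have tX : tame 0 (T + h) (Xm ^~ w) by exact: (state_power_tame L n dyn rate0 m1).
have tQ : tame 0 (T + h) (Qm ^~ w) by exact: (queue_power_tame n dyn adm rate0 m1).
have X_split := path_integral_split T0 TTh tX.
have Q_split := path_integral_split T0 TTh tQ.
have step := window_power dyn adm rate0 n0 p8 m1 mp c0 B1 scl J1 J2 w T0.
have -> : I (Xm ^~ w) 0 (T + h) = I (Xm ^~ w) 0 T + I (Xm ^~ w) T (T + h).
  by rewrite -X_split subrKC.
have -> : I (Qm ^~ w) 0 (T + h) = I (Qm ^~ w) 0 T + I (Qm ^~ w) T (T + h).
  by rewrite -Q_split subrKC.
set I1 := I (Xm ^~ w) 0 T in IH *; set I2 := I (Xm ^~ w) T (T + h) in step *.
set b1 := I (Qm ^~ w) 0 T in IH *; set b2 := I (Qm ^~ w) T (T + h) in step *.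
apply: (@le_trans _ _ ((gain * I1 + V T w `^ m)%:E + ((PF * b2)%:E + PF%:E * noise T w))%E).
  have := leeD (lexx (gain * I1)%:E) step.
  by rewrite addeA -!EFinD addeA -EFinD mulrDr !addrA.
rewrite big_ord_recr /=.
rewrite [X in (_ <= _ + X)%E]ge0_muleDr ?noise_ge0//; last first.
  by apply: sume_ge0 => k _; exact: noise_ge0.
rewrite [PF * (_ + _)]mulrDr.
rewrite (_ : V 0 w `^ m + (PF * b1 + PF * b2) = (V 0 w `^ m + PF * b1) + PF * b2);
  last by rewrite addrA.
rewrite [X in (_ <= X + _)%E]EFinD addeACA.
exact: leeD.
Qed.

Lemma measurable_X_power :
  measurable_fun half (fun q => Xm q.1 q.2).
Proof.
have mx i : measurable_fun half (fun q => X_hat n L i q.1 q.2).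
  apply: measurable_funM => //; apply: measurable_funB => //.
  exact: (measurable_state dyn i).
apply: (measurableT_comp (measurable_powR _)).
have -> : (fun q : R * Omega S => X_hat_norm n L q.1 q.2) = Num.sqrt \o
    (fun q => X_hat n L class1 q.1 q.2 ^+ 2 + X_hat n L class2 q.1 q.2 ^+ 2).
  by apply/funext => q; rewrite /= -(sum_classes (fun i => X_hat n L i q.1 q.2 ^+ 2)).
apply: (measurableT_comp (continuous_measurable_fun (@sqrt_continuous R))).
by apply: measurable_funD; exact: measurable_funX.
Qed.

Lemma measurable_Q_power i :
  measurable_fun half (fun q => Q_hat n i q.1 q.2 `^ m).
Proof.
apply: (measurableT_comp (measurable_powR _)).
by apply: measurable_funM => //; exact: (measurable_waiting dyn i).
Qed.

Lemma measurable_queue_power : measurable_fun half (fun q => Qm q.1 q.2).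
Proof. by apply: measurable_funD; exact: measurable_Q_power. Qed.

Lemma queue_power_ge0 t w : 0 <= Qm t w.
Proof. by rewrite addr_ge0 ?powR_ge0. Qed.

Lemma measurable_noise t : 0 <= t -> measurable_fun setT (noise t : Omega S -> \bar R).
Proof.
move=> t0; apply: emeasurable_funD.
  apply/measurable_EFinP; apply: measurable_funD => //.
  by do ![apply: measurable_funD|exact: measurable_fluctuation].
by apply: emeasurable_funD; exact: measurable_overshoot.
Qed.

Lemma expectation_noise t : 0 <= t ->
  (\int[Pr S]_w noise t w <= mean_noise%:E)%E.
Proof.
move=> t0.
have C0 : 0 <= poisson_moment_bound p :> R.
  by rewrite !mulr_ge0 ?exprn_ge0 ?expR_ge0.
have mf f : measurable_fun setT (fun w => (fluctuation nw p J f t w)%:E).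
  by apply/measurable_EFinP; exact: measurable_fluctuation.
have f0 f w : (0 <= (fluctuation nw p J f t w)%:E)%E.
  by rewrite lee_fin dyadic_excess_ge0.
have mo i : measurable_fun setT (overshoot nw (overshoot_slope B) i t : Omega S -> \bar R).
  exact: measurable_overshoot.
have o0 i w : (0 <= overshoot nw (overshoot_slope B) i t w)%E.
  exact: overshoot_ge0.
have Ea i : (\int[Pr S]_w (fluctuation nw p J (arrival i) t w)%:E <=
    (2 * poisson_moment_bound p : R)%:E)%E.
  apply: expectation_fluctuation => // r1 r2 k r10 r12.
  exact: arrival_restarted_law.
have Es a : (\int[Pr S]_w (fluctuation nw p J (service a) t w)%:E <=
    (2 * poisson_moment_bound p : R)%:E)%E.
  apply: expectation_fluctuation => // r1 r2 k r10 r12.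
  apply: service_restarted_law => //.
  by have /andP[+ _] := scaled_service scl a; exact: lt_le_trans.
have Eo i : (\int[Pr S]_w overshoot nw (overshoot_slope B) i t w <= 2%:E)%E.
  apply: expectation_overshoot => //; rewrite lerD2r.
  have e1 : 0 <= expR 1 - 1 :> R by rewrite subr_ge0 (le_trans _ (expR_ge1Dx 1))// lerDl.
  apply: (@le_trans _ _ (B * (expR 1 - 1))).
    by rewrite ler_wpM2r// (scaled_abandonment scl).
  by rewrite ler_wpM2l ?(ltW (bound_gt0 B1))// gerBl.
under eq_integral do rewrite /noise /fluctuations !EFinD.
rewrite !ge0_integralD//; do ?[by move=> *; rewrite !adde_ge0
  | by do ![apply: emeasurable_funD => //]].
rewrite integral_cst// [X in (_ * X)%E](_ : _ = 1%E) ?mule1; last exact: probability_setT.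
pose E2 : \bar R := (2 * poisson_moment_bound p : R)%:E.
apply: (@le_trans _ _ (1%:E + (E2 + E2 + (E2 + E2 + E2)) + (2%:E + 2%:E))%E).
  by rewrite !leeD.
by rewrite /E2 -!EFinD lee_fin /mean_noise; lra.
Qed.

Definition time_total (g : R -> Omega S -> R) T : \bar R :=
  (\int[Pr S]_w \int[lebesgue_measure]_(s in `[0%R, T]) (g s w)%:E)%E.

Lemma le_time_total (g1 g2 : R -> Omega S -> R) (k T1 T2 : R) : 0 <= k ->
  measurable_fun half (fun q => g1 q.1 q.2) ->
  measurable_fun half (fun q => g2 q.1 q.2) ->
  T1 <= T2 ->
  (forall s w, 0 <= s -> 0 <= g1 s w <= k * g2 s w) ->
  (forall s w, 0 <= s -> 0 <= g2 s w) ->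
  (time_total g1 T1 <= k%:E * time_total g2 T2)%E.
Proof.
move=> k0 mg1 mg2 T12 g12 g20.
have itv_ge0 T s : `[0, T]%classic s -> 0 <= s by rewrite /= in_itv /= => /andP[].
have mt (g : R -> Omega S -> R) (T : R) : measurable_fun half (fun q => g q.1 q.2) ->
    (forall s w, 0 <= s -> 0 <= g s w) -> measurable_fun setT
    (fun w : Omega S => \int[lebesgue_measure]_(s in `[0%R, T]) (g s w)%:E)%E.
  by move=> mg g0; exact: measurable_time_integral.
have g10 s w : 0 <= s -> 0 <= g1 s w by move=> s0; have /andP[] := g12 s w s0.
have mpath (g : R -> Omega S -> R) (T : R) w : measurable_fun half (fun q => g q.1 q.2) ->
    measurable_fun `[0, T] (fun s => (g s w)%:E).
  move=> mg; apply/measurable_EFinP.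
  apply: measurable_funS (measurable_path w mg); first exact: measurable_half_line.
  exact: itv_ge0.
rewrite /time_total -ge0_integralZl_EFin//; last 2 first.
- by move=> w _; apply: integral_ge0 => s s0; rewrite lee_fin g20// (itv_ge0 T2).
- exact: mt.
apply: ge0_le_integral => //.
- by move=> w _; apply: integral_ge0 => s s0; rewrite lee_fin g10// (itv_ge0 T1).
- exact: mt.
- by apply: measurable_funeM; exact: mt.
move=> w _; rewrite -ge0_integralZl_EFin//; last 2 first.
- by move=> s s0; rewrite lee_fin g20// (itv_ge0 T2).
- exact: mpath.
have k2 s : 0 <= s -> (0 <= k%:E * (g2 s w)%:E)%E.
  by move=> s0; rewrite -EFinM lee_fin mulr_ge0// g20.
apply: (@le_trans _ _ (\int[lebesgue_measure]_(s in `[0%R, T1]) (k%:E * (g2 s w)%:E))%E).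
  apply: ge0_le_integral => //.
  - by move=> s s0; rewrite lee_fin g10// (itv_ge0 T1).
  - exact: mpath.
  - by apply: measurable_funeM; exact: mpath.
  - move=> s s0; rewrite -EFinM lee_fin.
    by have /andP[] := g12 s w (itv_ge0 T1 s s0).
apply: ge0_subset_integral => //.
- by apply: measurable_funeM; exact: mpath.
- by move=> s s0; apply: k2; exact: (itv_ge0 T2).
- by apply: subset_itvl; rewrite bnd_simp.
Qed.

Lemma time_total_mono (g : R -> Omega S -> R) (T1 T2 : R) :
  measurable_fun half (fun q => g q.1 q.2) ->
  (forall s w, 0 <= s -> 0 <= g s w) -> T1 <= T2 ->
  (time_total g T1 <= time_total g T2)%E.
Proof.
move=> mg g0 T12; have := @le_time_total g g 1 T1 T2 ler01 mg mg T12.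
by rewrite mul1e; apply => // s w s0; rewrite mul1r g0/=.
Qed.

Lemma X_power_ge0 s w : 0 <= Xm s w.
Proof. exact: powR_ge0. Qed.

Lemma initial_lyapunov : exists A, 0 <= A /\ forall w, V 0 w `^ m = A.
Proof.
have [x1 X1] := X_deterministic_start dyn class1.
have [x2 X2] := X_deterministic_start dyn class2.
exists (((`|x1%:R - n%:R * fluid_equilibrium L class1| + class2_weight c B *
  `|x2%:R - n%:R * fluid_equilibrium L class2|) / Num.sqrt n%:R) `^ m).
split; first exact: powR_ge0.
by move=> w; rewrite /lyapunov_hat /lyapunov /deviation /state X1 X2.
Qed.

Lemma time_total_windows A K : (forall w, V 0 w `^ m = A) -> 0 <= A ->
  (gain%:E * time_total Xm (K%:R * h) <=
   (A + PF * mean_noise * K%:R)%:E + PF%:E * time_total Qm (K%:R * h))%E.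
Proof.
move=> V0A A0; set T := K%:R * h.
have h0 := window_length_gt0 c0 B1.
have T0 : 0 <= T by rewrite mulr_ge0// ltW.
have g0 := ltW (gain_gt0 m c0 B1 scl).
have pf0 := ltW (power_factor_gt0 p m c0 B1 scl).
have mX : measurable_fun setT (fun w : Omega S =>
    \int[lebesgue_measure]_(s in `[0%R, T]) (Xm s w)%:E)%E.
  by apply: measurable_time_integral => //;
    [exact: measurable_X_power|move=> *; exact: X_power_ge0].
have mQ : measurable_fun setT (fun w : Omega S =>
    \int[lebesgue_measure]_(s in `[0%R, T]) (Qm s w)%:E)%E.
  by apply: measurable_time_integral => //;
    [exact: measurable_queue_power|move=> *; exact: queue_power_ge0].
have X0 w : (0 <= \int[lebesgue_measure]_(s in `[0%R, T]) (Xm s w)%:E)%E.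
  by apply: integral_ge0 => s _; rewrite lee_fin X_power_ge0.
have Q0 w : (0 <= \int[lebesgue_measure]_(s in `[0%R, T]) (Qm s w)%:E)%E.
  by apply: integral_ge0 => s _; rewrite lee_fin queue_power_ge0.
have kh (k : 'I_K) : 0 <= k%:R * h by rewrite mulr_ge0// ltW.
have mN : measurable_fun setT (fun w => \sum_(k < K) noise (k%:R * h) w)%E.
  by apply: emeasurable_sum => k; exact: measurable_noise.
have N0 w : (0 <= \sum_(k < K) noise (k%:R * h) w)%E.
  by apply: sume_ge0 => k _; exact: noise_ge0.
rewrite /time_total -ge0_integralZl_EFin//.
apply: (@le_trans _ _ (\int[Pr S]_w (A%:E + PF%:E * \sum_(k < K) noise (k%:R * h) w
    + PF%:E * \int[lebesgue_measure]_(s in `[0%R, T]) (Qm s w)%:E)%E)%E).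
  apply: ge0_le_integral => //.
  - by move=> w _; rewrite mule_ge0.
  - exact: measurable_funeM.
  - apply: emeasurable_funD; last exact: measurable_funeM.
    by apply: emeasurable_funD => //; exact: measurable_funeM.
  - move=> w _.
    have := windows_telescope K w; rewrite -/T V0A.
    rewrite (EFin_path_integral (state_power_tame L n dyn rate0 m1 T w)).
    rewrite (EFin_path_integral (queue_power_tame n dyn adm rate0 m1 T w)) -!EFinM.
    rewrite addeAC -EFinD; apply: le_trans.
    by rewrite lee_fin lerDl powR_ge0.
rewrite ge0_integralD//; first last.
- exact: measurable_funeM.
- by move=> w _; rewrite mule_ge0.
- by apply: emeasurable_funD => //; exact: measurable_funeM.
- by move=> w _; rewrite adde_ge0// mule_ge0.
rewrite [in leLHS]ge0_integralZl_EFin//; apply: leeD => //.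
rewrite ge0_integralD//; first last.
- exact: measurable_funeM.
- by move=> w _; rewrite mule_ge0.
rewrite integral_cst// [X in (_ * X)%E](_ : _ = 1%E) ?mule1; last exact: probability_setT.
rewrite EFinD; apply: leeD => //.
rewrite ge0_integralZl_EFin// -mulrA [leRHS]EFinM lee_wpmul2l//.
rewrite ge0_integral_sum//; last 2 first.
- by move=> k; exact: measurable_noise.
- by move=> k w _; exact: noise_ge0.
apply: (@le_trans _ _ (\sum_(k < K) mean_noise%:E)%E).
  by apply: lee_sum => k _; exact: expectation_noise.
by rewrite sumEFin lee_fin sumr_const card_ord mulr_natr.
Qed.

(** The horizon T is rounded up to a multiple of the window length, hence to at
    most T + 1. The constant A comes from the initial state, which is
    deterministic. *)
Lemma expected_power_bound : exists A, 0 <= A /\ forall T, 0 < T ->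
  (gain%:E * time_total Xm T <=
   (A + PF * mean_noise * (T / h + 1))%:E + PF%:E * time_total Qm (T + 1))%E.
Proof.
have [A [A0 VA]] := initial_lyapunov.
have h0 := window_length_gt0 c0 B1; have h1 := window_length_le1 B1 scl.
have g0 := ltW (gain_gt0 m c0 B1 scl).
have pf0 := ltW (power_factor_gt0 p m c0 B1 scl).
have D0 : 0 <= mean_noise.
  by rewrite addr_ge0// mulr_ge0// !mulr_ge0 ?exprn_ge0 ?expR_ge0.
exists A; split => // T T0.
pose K := (Num.truncn (T / h)).+1.
have Th0 : 0 <= T / h by rewrite divr_ge0 ?(ltW T0) ?(ltW h0).
have TK : T <= K%:R * h by rewrite -ler_pdivrMr// ltW// truncnS_gt.
have KT : K%:R <= T / h + 1 by rewrite -natr1 lerD2r truncn_le.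
have KT1 : K%:R * h <= T + 1.
  have := ler_wpM2r (ltW h0) KT; rewrite mulrDl mul1r divfK ?gt_eqF// => /le_trans; apply.
  by rewrite lerD2l.
apply: (@le_trans _ _ (gain%:E * time_total Xm (K%:R * h))%E).
  apply: lee_wpmul2l; first by rewrite lee_fin.
  apply: time_total_mono => //; first exact: measurable_X_power.
  by move=> s w _; exact: X_power_ge0.
apply: (le_trans (time_total_windows K VA A0)); apply: leeD.
  by rewrite lee_fin lerD2l ler_wpM2l// mulr_ge0.
apply: lee_wpmul2l; first by rewrite lee_fin.
apply: time_total_mono => //; first exact: measurable_queue_power.
by move=> s w _; exact: queue_power_ge0.
Qed.

End expected_windows.

(** * Parameters at a large index *)

Section scaling_constants.
Context {R : realType} (nw : nat -> network R) (L : limit_parameters R).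
Hypothesis std : standing_assumption nw L.

Lemma cvg_near_le (u : nat -> R) (l e : R) : u n @[n --> \oo] --> l -> 0 < e ->
  exists N, forall n, (N <= n)%N -> `|u n - l| <= e.
Proof.
move=> /cvgrPdist_le ul e0; have [N _ HN] := ul e e0.
by exists N => n Nn; rewrite distrC; exact: HN.
Qed.

(** The third identity is where critical load enters: at equilibrium both pools
    are exactly full. *)
Lemma fluid_balance :
  [/\ lambda L class1 = mu L act11 * nu L pool1 +
        mu L act12 * (fluid_equilibrium L class1 - nu L pool1),
      lambda L class2 = mu L act22 * fluid_equilibrium L class2 &
      fluid_equilibrium L class1 + fluid_equilibrium L class2 =
        nu L pool1 + nu L pool2].
Proof.
have m12 := mu_gt0 std act12; have m22 := mu_gt0 std act22.
have n2 := nu_gt0 std pool2; have crit := critical_load std.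
rewrite /=; split.
- by rewrite addrAC subrr add0r mulrCA mulfV ?gt_eqF// mulr1; ring.
- by rewrite mulrCA mulfV ?gt_eqF// mulr1.
- have -> : nu L pool2 = ((lambda L class1 - mu L act11 * nu L pool1) / (mu L act12 * nu L pool2)
    + lambda L class2 / (mu L act22 * nu L pool2)) * nu L pool2 by rewrite crit mul1r.
  by field; rewrite !gt_eqF.
Qed.

Lemma eventually_all (I : finType) (E : I -> nat -> Prop) :
  (forall i, exists N, forall n, (N <= n)%N -> E i n) ->
  exists N, forall n, (N <= n)%N -> forall i, E i n.
Proof.
move=> /choice[N NP]; exists (\max_i N i)%N => n Nn i.
by apply: NP; apply: leq_trans Nn; exact: leq_bigmax.
Qed.

Lemma eventually_and (A B : nat -> Prop) :
  (exists N, forall n, (N <= n)%N -> A n) ->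
  (exists N, forall n, (N <= n)%N -> B n) ->
  exists N, forall n, (N <= n)%N -> A n /\ B n.
Proof.
move=> [N1 H1] [N2 H2]; exists (maxn N1 N2) => n.
by rewrite geq_max => /andP[/H1 ? /H2].
Qed.

Lemma finite_bound (I : finType) (f : I -> R) : exists b : R, 0 <= b /\ forall i, `|f i| <= b.
Proof.
exists (\sum_i `|f i|); split; first exact: sumr_ge0.
by move=> i; rewrite (bigD1 i)//= lerDl sumr_ge0.
Qed.

(** With s = sqrt n, an error dm of order 1 / s in a rate, applied to a
    population x of order n, costs O(s); so does an error y of order s in a
    population, at a rate m. *)
Lemma scaled_drift_bound (b s n dl dm x y m : R) :
  0 <= b -> 0 < s -> s ^+ 2 = n -> `|dl| <= b * s -> `|s * dm| <= b ->
  `|x| <= b * n -> `|y| <= s -> 0 <= m <= b ->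
  [/\ `|dl| <= b * s, `|dm * x| <= b ^+ 2 * s & `|m * y| <= b * s].
Proof.
move=> b0 s0 sn dlb dmb xb ys /andP[m0 mb]; split => //; last first.
  by rewrite normrM (ger0_norm m0) ler_pM.
rewrite -(@ler_pM2l _ s)// -{1}(gtr0_norm s0) -normrM mulrA normrM.
apply: (@le_trans _ _ (b * (b * n))); first by rewrite ler_pM.
by rewrite -sn le_eqVlt; apply/orP; left; apply/eqP; ring.
Qed.

Lemma six_errors (b s x1 x2 x3 x4 x5 x6 : R) : 2 <= b -> 0 <= s ->
  `|x1| <= b * s -> `|x2| <= b ^+ 2 * s -> `|x3| <= b * s ->
  `|x4| <= b ^+ 2 * s -> `|x5| <= b ^+ 2 * s -> `|x6| <= b * s ->
  `|x1 - x2 - x3 - x4 + x5 + x6| <= 8 * b ^+ 2 * s.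
Proof.
move=> b2 s0; have b0 : 0 <= b by lra.
have := ler_wpM2r s0 (ler_wpM2l b0 b2); have := mulr_ge0 b0 s0.
by rewrite !ler_norml; lra.
Qed.

(** Substituting limits for parameters in each defect leaves a sum of errors as
    in [scaled_drift_bound], since the limits cancel by [fluid_balance]. *)
Lemma well_scaled_eventually : exists (c B : R) (N : nat),
  [/\ 0 < c, 1 <= B & forall n, (N <= n)%N -> (0 < n)%N ->
    well_scaled (nw n) L n c B].
Proof.
have [b1 [b10 lamb]] := finite_bound (lambda L).
have [b2 [b20 mub]] := finite_bound (mu L).
have [b3 [b30 nub]] := finite_bound (nu L).
have [b4 [b40 gamb]] := finite_bound (gamma L).
have [b5 [b50 lamhb]] := finite_bound (lambda_hat L).
have [b6 [b60 muhb]] := finite_bound (mu_hat L).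
have [b7 [b70 feb]] := finite_bound (fluid_equilibrium L).
(* One constant for all limits; the 2 leaves room for deviations from the
   limits by at most 1. *)
pose b := 2 + b1 + b2 + b3 + b4 + b5 + b6 + b7.
have b2' : 2 <= b by rewrite /b; lra.
pose c := Num.min (mu L act11) (Num.min (mu L act12) (mu L act22)) / 2.
have c_gt0 : 0 < c by rewrite divr_gt0// !lt_min !(mu_gt0 std).
have cmu a : c <= mu L a / 2.
  by rewrite /c ler_pM2r// !ge_min; case: a; rewrite lexx ?orbT.
have half_mu a : 0 < mu L a / 2 by rewrite divr_gt0// (mu_gt0 std).
have ev1 := eventually_all (fun i => cvg_near_le (@cvg_lambda_hat _ _ _ std i) ltr01).
have ev2 := eventually_all (fun a => cvg_near_le (@cvg_mu _ _ _ std a) (half_mu a)).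
have ev3 := eventually_all (fun a => cvg_near_le (@cvg_mu_hat _ _ _ std a) ltr01).
have ev4 := eventually_all (fun i => cvg_near_le (@cvg_gamma _ _ _ std i) ltr01).
have ev5 := eventually_all (fun j => cvg_near_le (@cvg_nu_hat _ _ _ std j) ltr01).
have [N HN] := eventually_and (eventually_and ev1 ev2)
  (eventually_and ev3 (eventually_and ev4 ev5)).
exists c, (8 * b ^+ 2), N; split => //.
  by nra.
move=> n /HN [[H1 H2] [H3 [H4 H5]]] n0 {HN ev1 ev2 ev3 ev4 ev5}.
set s : R := Num.sqrt n%:R in H1 H3 H5.
have s1 : 1 <= s by rewrite -[leLHS]sqrtr1 ler_wsqrtr// ler1n.
have s0 : 0 < s by exact: lt_le_trans s1.
have sn : s ^+ 2 = n%:R by rewrite sqr_sqrtr.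
have ssn : s <= n%:R by rewrite -sn expr2 ler_peMr// ltW.
have n1 : 1 <= n%:R :> R by rewrite ler1n.
have dl i : `|arrival_rate (nw n) i - n%:R * lambda L i| <= b * s.
  rewrite -ler_pdivrMr// -{1}(gtr0_norm s0) -normf_div.
  by have := H1 i; have := lamhb i; rewrite /b !ler_norml; lra.
have dm a : `|s * (service_rate (nw n) a - mu L a)| <= b.
  by have := H3 a; have := muhb a; rewrite /b !ler_norml; lra.
have dN j : `|(servers (nw n) j)%:R - n%:R * nu L j| <= s.
  rewrite -(@ler_pM2l _ s)// -expr2 sn.
  have -> : s * `|(servers (nw n) j)%:R - n%:R * nu L j| =
      `|s * ((servers (nw n) j)%:R / n%:R - nu L j)| * n%:R.
    rewrite normrM (gtr0_norm s0) -mulrA; congr (_ * _).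
    transitivity `|((servers (nw n) j)%:R / n%:R - nu L j) * n%:R|.
      congr `|_|; rewrite mulrBl (mulrC (nu L j)) divfK//.
      by rewrite pnatr_eq0 -lt0n.
    by rewrite normrM normr_nat.
  have := H5 j; rewrite subr0 => h5.
  by have := ler_wpM2r (ler0n R n) h5; rewrite mul1r.
have Nb j : (servers (nw n) j)%:R <= b * n%:R.
  have nb : nu L j <= b - 1 by have := nub j; rewrite /b ler_norml; lra.
  have := dN j; rewrite ler_norml => /andP[_].
  have := ler_wpM2r (ler0n R n) nb; rewrite mulrBl mul1r (mulrC _ n%:R); lra.
have eb i : `|n%:R * fluid_equilibrium L i| <= b * n%:R.
  rewrite normrM normr_nat mulrC ler_wpM2r//.
  by apply: (le_trans (feb i)); rewrite /b; lra.
have mb a : 0 <= mu L a <= b.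
  rewrite ltW ?(mu_gt0 std)//=.
  by have := mub a; rewrite /b ler_norml; lra.
have [bal1 bal2 bal3] := fluid_balance.
have bb : 2 * b <= 8 * b ^+ 2 by nra.
have b0 : 0 <= b by lra.
have bs0 : 0 <= b * s by rewrite mulr_ge0// ltW.
have bbs : 2 * s <= 8 * b ^+ 2 * s by rewrite ler_wpM2r ?(ltW s0)//; nra.
have bn0 : 0 <= b * n%:R by rewrite mulr_ge0.
have bbn : 2 * b * n%:R <= 8 * b ^+ 2 * n%:R by rewrite ler_wpM2r.
have sN j : `|(servers (nw n) j)%:R| <= b * n%:R :> R by rewrite normr_nat.
split.
- move=> a; have := H2 a; rewrite ler_norml => /andP[h1 h2].
  have cm := cmu a; have /andP[_ mba] := mb a.
  by apply/andP; split; move: h1 h2 cm mba bb; clear; lra.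
- move=> i; have := dl i; rewrite ler_norml => /andP[_ h1].
  have lb : lambda L i <= b by have := lamb i; rewrite /b ler_norml; lra.
  have := ler_wpM2r (ler0n R n) lb; rewrite (mulrC _ n%:R).
  have := ler_wpM2l b0 ssn; lra.
- move=> i; have := H4 i; have := gamb i; rewrite !ler_norml.
  have : b4 + 1 <= b by rewrite /b; lra.
  lra.
- by move=> j; have := Nb j; lra.
- have [h1 _ _] := scaled_drift_bound b0 s0 sn (dl class1)
    (dm act11) (sN pool1) (dN pool1) (mb act11).
  have [_ h2 h3] := scaled_drift_bound b0 s0 sn (dl class1)
    (dm act11) (sN pool1) (dN pool1) (mb act11).
  have [_ h4 h5] := scaled_drift_bound b0 s0 sn (dl class1)
    (dm act12) (sN pool1) (dN pool1) (mb act12).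
  have [_ h6 _] := scaled_drift_bound b0 s0 sn (dl class1)
    (dm act12) (eb class1) (dN pool1) (mb act12).
  have -> : arrival_rate (nw n) class1 - service_rate (nw n) act11 * (servers (nw n) pool1)%:R
      - service_rate (nw n) act12
        * (n%:R * fluid_equilibrium L class1 - (servers (nw n) pool1)%:R) =
    (arrival_rate (nw n) class1 - n%:R * lambda L class1)
    - (service_rate (nw n) act11 - mu L act11) * (servers (nw n) pool1)%:R
    - mu L act11 * ((servers (nw n) pool1)%:R - n%:R * nu L pool1)
    - (service_rate (nw n) act12 - mu L act12) * (n%:R * fluid_equilibrium L class1)
    + (service_rate (nw n) act12 - mu L act12) * (servers (nw n) pool1)%:R
    + mu L act12 * ((servers (nw n) pool1)%:R - n%:R * nu L pool1).
    by rewrite bal1; ring.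
  exact: (six_errors b2' (ltW s0)).
- have [h1 h2 _] := scaled_drift_bound b0 s0 sn (dl class2)
    (dm act22) (eb class2) (dN pool1) (mb act22).
  have -> : arrival_rate (nw n) class2
      - service_rate (nw n) act22 * (n%:R * fluid_equilibrium L class2) =
    (arrival_rate (nw n) class2 - n%:R * lambda L class2)
    - (service_rate (nw n) act22 - mu L act22) * (n%:R * fluid_equilibrium L class2).
    by rewrite bal2; ring.
  have z0 : `|0 : R| <= b * s by rewrite normr0.
  have z1 : `|0 : R| <= b ^+ 2 * s by rewrite normr0 mulr_ge0 ?exprn_ge0 ?(ltW s0).
  have := six_errors b2' (ltW s0) h1 h2 z0 z1 z1 z0.
  by rewrite !subr0 !addr0.
- have -> : (servers (nw n) pool1)%:R + (servers (nw n) pool2)%:R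
      - n%:R * fluid_equilibrium L class1 - n%:R * fluid_equilibrium L class2 =
    ((servers (nw n) pool1)%:R - n%:R * nu L pool1)
    + ((servers (nw n) pool2)%:R - n%:R * nu L pool2).
    have -> : fluid_equilibrium L class1 = nu L pool1 + nu L pool2 - fluid_equilibrium L class2.
      by rewrite -bal3; ring.
    by ring.
  have := dN pool1; have := dN pool2; rewrite -/s !ler_norml.
  by lra.
Qed.

End scaling_constants.

(** * Ergodic means *)

Section assembly.
Context {R : realType}.

Lemma dyadic_scale (x : R) : 1 <= x -> exists J : nat, x <= 2 ^+ J /\ 2 ^+ J <= 4 * x.
Proof.
move=> x1; pose k := Num.truncn x.
have kx : k%:R <= x by rewrite truncn_le (le_trans _ x1).
have xk : x < k.+1%:R by rewrite truncnS_gt.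
have k0 : (0 < k)%N by rewrite truncn_gt0.
have /andP[l1 l2] := trunc_log_bounds (isT : (1 < 2)%N) k0.
exists (trunc_log 2 k).+1; split.
  by rewrite -natrX (le_trans (ltW xk))// ler_nat.
rewrite exprS; have : (2 ^ trunc_log 2 k)%:R <= x by rewrite (le_trans _ kx)// ler_nat.
by rewrite natrX; lra.
Qed.

(** If the limsup l of the means of g is finite, these means are at most l + 1
    for large T, and there T + 1 <= 2 * T and A <= T. Hence the factor 2 in the
    constants, and no trace of A. If l = +oo the bound is trivial, and
    nonnegativity excludes -oo. *)
Lemma ergodic_limit (S : system R) (f g : R -> Omega S -> R) (A C k : R) :
  0 <= A -> 0 < C -> 0 < k ->
  (forall T, 0 < T -> (0 <= time_total f T)%E) ->
  (forall T, 0 < T -> (0 <= time_total g T)%E) ->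
  (forall T, 0 < T -> (time_total f T <= (A + C * (T + 1))%:E + k%:E * time_total g (T + 1))%E) ->
  (ergodic_mean f <= (1 + 2 * C + 2 * k)%:E + (2 * k)%:E * ergodic_mean g)%E.
Proof.
move=> A0 C0 k0 f0 g0 fg.
have k20 : 0 < 2 * k by rewrite mulr_gt0.
case E : (ergodic_mean g) => [l| |].
- have : (ergodic_mean g < (l + 1)%:E)%E by rewrite E lte_fin ltrDl.
  move=> /ereal_inf_lt[_ [V VF <-] Vl].
  have [M [_ HM]] := VF.
  have gV T : M < T -> (time_total g T <= (T * (l + 1))%:E)%E \/ T <= 0.
    move=> MT; have [T0|T0] := leP T 0; [by right|left].
    rewrite EFinM -lee_pdivrMl//; apply: le_trans (ltW Vl).
    by apply: ereal_sup_ubound; exists T => //; exact: HM.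
  apply: (@le_trans _ _ (1 + 2 * C + 2 * k * (l + 1))%:E); last first.
    by rewrite -EFinM -EFinD lee_fin; lra.
  pose M' := Num.max M (Num.max 1 A).
  rewrite /ergodic_mean limf_esupE.
  apply: (@le_trans _ _ (ereal_sup [set ((T^-1)%:E * time_total f T)%E | T in [set T | M' < T]])).
    apply: ereal_inf_lbound; exists [set T | M' < T] => //.
    by exists M'; split => //; exact: num_real.
  apply: ge_ereal_sup => _ [T /= MT <-].
  move: MT; rewrite /M' !gt_max => /and3P[MT T1 TA].
  have T0 : 0 < T by lra.
  have gT : (time_total g (T + 1) <= ((T + 1) * (l + 1))%:E)%E.
    have MT1 : M < T + 1 by lra.
    by have [//|h] := gV _ MT1; exfalso; move: h T0; clear; lra.
  have l1 : 0 <= l + 1.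
    have := le_trans (g0 (T + 1) ltac:(lra)) gT.
    by rewrite lee_fin pmulr_rge0//; lra.
  rewrite lee_pdivrMl//; apply: (le_trans (fg T T0)).
  apply: (@le_trans _ _ ((A + C * (T + 1))%:E + k%:E * ((T + 1) * (l + 1))%:E)%E).
    by rewrite leeD2l// lee_wpmul2l// lee_fin ltW.
  rewrite -!EFinM -EFinD lee_fin.
  have : 0 <= k * (l + 1) * (T - 1) by rewrite !mulr_ge0// ?(ltW k0)//; lra.
  have : 0 <= C * (T - 1) by rewrite mulr_ge0 ?(ltW C0)//; lra.
  by lra.
- by rewrite gt0_muley ?lte_fin// addey// leey.
- have : (0 <= ergodic_mean g)%E.
    rewrite /ergodic_mean limf_esupE; apply: le_ereal_inf_tmp => _ [V [M [_ HM]] <-].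
    pose T := Num.max (M + 1) 1.
    have T0 : 0 < T by rewrite lt_max ltr01 orbT.
    apply: (@le_trans _ _ ((T^-1)%:E * time_total g T)%E).
      by apply: mule_ge0; [rewrite lee_fin invr_ge0 ltW|exact: g0].
    by apply: ereal_sup_ubound; exists T => //; apply: HM; rewrite lt_max ltrDl ltr01.
  by rewrite E.
Qed.

Context (m : R) (xi : class -> R) (L : limit_parameters R).
Hypotheses (m1 : 1 <= m) (xi0 : forall i, 0 < xi i).

(** C is chosen before the system, so it depends neither on the policy nor on
    the initial state; A may depend on both, as it disappears in the ergodic
    mean. *)
Definition bounded_total (nw : network R) (n : nat) (C : R) : Prop :=
  forall S : system R, network_dynamics nw S -> admissible nw S ->
  exists A, 0 <= A /\ forall T, 0 < T ->
    (time_total (state_power (S:=S) L n m) T <=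
      (A + C * (T + 1))%:E + C%:E * time_total (queue_power (S:=S) n m) (T + 1))%E.

Lemma time_total_ge0 (S : system R) (g : R -> Omega S -> R) T :
  (forall s w, 0 <= g s w) -> (0 <= time_total g T)%E.
Proof.
by move=> g0; apply: integral_ge0 => w _; apply: integral_ge0 => s _; rewrite lee_fin.
Qed.

Lemma bounded_total_le nw n C C' : C <= C' -> bounded_total nw n C -> bounded_total nw n C'.
Proof.
move=> CC' bt S dyn adm; have [A [A0 HA]] := bt S dyn adm.
exists A; split => // T T0; apply: (le_trans (HA T T0)).
apply: leeD.
  by rewrite lee_fin lerD2l ler_wpM2r//; lra.
apply: lee_wpmul2r; last by rewrite lee_fin.
by apply: time_total_ge0 => s w; exact: queue_power_ge0.
Qed.

Lemma time_total_add1 (S : system R) (g : R -> Omega S -> R) T : 0 <= T ->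
  measurable_fun ([set t : R | 0 <= t] `*` [set: Omega S]) (fun q => g q.1 q.2) ->
  (forall s w, 0 <= s -> 0 <= g s w) ->
  time_total (fun s w => 1 + g s w) T = (T%:E + time_total g T)%E.
Proof.
move=> T0 mg g0.
have itv_ge0 s : `[0, T]%classic s -> 0 <= s by rewrite /= in_itv /= => /andP[].
have inner w : (\int[lebesgue_measure]_(s in `[0%R, T]) (1 + g s w)%:E =
    T%:E + \int[lebesgue_measure]_(s in `[0%R, T]) (g s w)%:E)%E.
  under eq_integral do rewrite EFinD.
  rewrite ge0_integralD//.
  - by rewrite integral_cst//= lebesgue_measure_itv /= lte_fin mul1e; move: T0;
      rewrite le_eqVlt => /predU1P[<-|->]; rewrite ?ltxx ?sube0.
  - by move=> s s0; rewrite lee_fin g0// itv_ge0.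
  - apply/measurable_EFinP.
    apply: measurable_funS (measurable_path w mg); first exact: measurable_half_line.
    exact: itv_ge0.
rewrite /time_total; under eq_integral do rewrite inner.
rewrite ge0_integralD//.
- by rewrite integral_cst// [X in (_ * X)%E](_ : _ = 1%E) ?mule1//; exact: probability_setT.
- by move=> w _; apply: integral_ge0 => s s0; rewrite lee_fin g0// itv_ge0.
- exact: measurable_time_integral.
Qed.

(** For fixed n the servers are finitely many, so that the state exceeds the
    queues by a bounded amount. *)
Lemma bounded_total_single nw n : (0 < n)%N -> (forall f, 0 <= rate nw f) ->
  exists C, 0 <= C /\ bounded_total nw n C.
Proof.
move=> n0 rate0; pose sq : R := Num.sqrt n%:R.
have s0 : 0 < sq by rewrite sqrtr_gt0 ltr0n.
have m0 : 0 <= m := le_trans ler01 m1.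
pose D : R := ((servers nw pool1)%:R + 2 * (servers nw pool2)%:R +
  `|n%:R * fluid_equilibrium L class1| + `|n%:R * fluid_equilibrium L class2|) / sq.
have D0 : 0 <= D by rewrite divr_ge0 ?(ltW s0)// !addr_ge0// mulr_ge0.
pose C := 2 `^ m * D `^ m + 4 `^ m.
have C0 : 0 <= C by rewrite addr_ge0 ?mulr_ge0 ?powR_ge0.
exists C; split => // S dyn adm; exists 0; split => // T T0.
have Xb s w : 0 <= s -> state_power (S:=S) L n m s w <= C * (1 + queue_power (S:=S) n m s w).
  move=> s_ge0.
  have Q0 i : 0 <= Q_hat n i s w by exact: (Q_hat_ge0 n adm).
  have Xle : X_hat_norm n L s w <= D + (Q_hat n class1 s w + Q_hat n class2 s w).
    apply: (le_trans (X_hat_norm_le L n0 s w)).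
    rewrite /D /Q_hat -!/(waiting _ _ _) -!mulrDl ler_wpM2r ?invr_ge0 ?(ltW s0)//.
    have dev i : `|deviation L n i s w| <= state i s w + `|n%:R * fluid_equilibrium L i|.
      by rewrite (le_trans (ler_normB _ _))// ger0_norm// state_ge0.
    have := dev class1; have := dev class2.
    have := waiting1E s w; have := waiting2E s w; rewrite /waiting.
    have := pool1_le adm w s_ge0; have := pool2_le adm w s_ge0.
    have := busy_ge0 act12 s w; have := busy_ge0 act22 s w; lra.
  apply: (@le_trans _ _ ((D + (Q_hat n class1 s w + Q_hat n class2 s w)) `^ m)).
    by rewrite ge0_ler_powR ?nnegrE ?X_hat_norm_ge0// !addr_ge0.
  apply: (le_trans (le_powRD m0 D0 (addr_ge0 (Q0 _) (Q0 _)))).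
  have h2 := le_powRD m0 (Q0 class1) (Q0 class2).
  rewrite -/(queue_power n m s w) in h2.
  have p0 : 0 <= 2 `^ m :> R by exact: powR_ge0.
  have e4 : 4 `^ m = 2 `^ m * 2 `^ m :> R by rewrite -powRM//; congr (_ `^ m); ring.
  have := ler_wpM2l p0 h2.
  have q0 : 0 <= queue_power (S:=S) n m s w by exact: queue_power_ge0.
  have := mulr_ge0 (mulr_ge0 p0 (powR_ge0 D m)) q0.
  have := powR_ge0 4 m.
  by rewrite /C e4; lra.
have mQ := measurable_queue_power n m dyn.
have mQ1 : measurable_fun ([set t : R | 0 <= t] `*` [set: Omega S])
    (fun q => 1 + queue_power (S:=S) n m q.1 q.2).
  by apply: measurable_funD.
have Q1 s w : 0 <= s -> 0 <= 1 + queue_power (S:=S) n m s w.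
  by move=> _; rewrite addr_ge0// queue_power_ge0.
have TT1 : T <= T + 1 by rewrite lerDl.
have := @le_time_total _ S (state_power (S:=S) L n m) (fun s w => 1 + queue_power (S:=S) n m s w)
  C T (T + 1) C0 (measurable_X_power L n m dyn) mQ1 TT1 _ Q1.
move=> /(_ _)/le_trans; apply.
  by move=> s w s_ge0; rewrite X_power_ge0 Xb.
rewrite add0r EFinM -ge0_muleDr ?lee_fin//; last 2 first.
- by rewrite addr_ge0// ltW.
- by apply: time_total_ge0 => s w; exact: queue_power_ge0.
apply: lee_wpmul2l; first by rewrite lee_fin.
rewrite time_total_add1// => [|s w _]; last exact: queue_power_ge0.
by rewrite addr_ge0// ltW.
Qed.

Definition large_constant (p : nat) (c B : R) : R :=
  (gain m c B)^-1 * power_factor p m c B * (mean_noise p / window_length c B + 1).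

(** The dyadic range 2 ^ J is fitted to the index, 2 ^ J being of order B ^ 2 *
    n, while the resulting constant is free of J and n. *)
Lemma bounded_total_large nw n p c B : (8 <= p)%N -> m <= p%:R -> (0 < n)%N ->
  (forall f, 0 <= rate nw f) -> 0 < c -> 1 <= B -> well_scaled nw L n c B ->
  bounded_total nw n (large_constant p c B).
Proof.
move=> p8 mp n0 rate0 c0 B1 scl S dyn adm.
have Bn1 : 1 <= B ^+ 2 * n%:R.
  apply: (@le_trans _ _ (1 * 1)); first by rewrite mulr1.
  by apply: ler_pM => //; [exact: exprn_ege1|rewrite ler1n].
have [J [J1 J2]] := dyadic_scale Bn1.
have [A [A0 HA]] := expected_power_bound dyn adm rate0 n0 p8 m1 mp c0 B1 scl J1 J2.
have g0 := gain_gt0 m c0 B1 scl; have pf0 := power_factor_gt0 p m c0 B1 scl.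
have h0 := window_length_gt0 c0 B1; have h1 := window_length_le1 B1 scl.
have mn0 : 0 <= mean_noise p :> R.
  by rewrite addr_ge0// mulr_ge0// !mulr_ge0 ?exprn_ge0 ?expR_ge0.
have q0 : 0 <= (gain m c B)^-1 * power_factor p m c B.
  by rewrite mulr_ge0 ?invr_ge0 ?(ltW g0) ?(ltW pf0).
have mh0 : 0 <= mean_noise p / window_length c B :> R by rewrite divr_ge0// ltW.
exists ((gain m c B)^-1 * A); split; first by rewrite mulr_ge0// invr_ge0 ltW.
move=> T T0; have tot0 : (0 <= time_total (queue_power (S:=S) n m) (T + 1))%E.
  by apply: time_total_ge0 => s w; exact: queue_power_ge0.
apply: (@le_trans _ _ ((gain m c B)^-1%:E * ((A + power_factor p m c B * mean_noise p *
    (T / window_length c B + 1))%:E + (power_factor p m c B)%:E *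
    time_total (queue_power (S:=S) n m) (T + 1)))%E).
  by rewrite lee_pdivlMl//; exact: HA.
have Th0 : 0 <= T / window_length c B := divr_ge0 (ltW T0) (ltW h0).
have pm0 : 0 <= power_factor p m c B * mean_noise p := mulr_ge0 (ltW pf0) mn0.
rewrite ge0_muleDr; last 2 first.
- by rewrite lee_fin addr_ge0// mulr_ge0// addr_ge0.
- by rewrite mule_ge0// lee_fin ltW.
apply: leeD; last first.
  rewrite muleA -EFinM; apply: lee_wpmul2r => //; rewrite lee_fin.
  by rewrite /large_constant ler_peMr// lerDr.
have Th : T / window_length c B + 1 <= (T + 1) / window_length c B.
  by rewrite mulrDl lerD2l mul1r invf_ge1.
have key : mean_noise p * (T / window_length c B + 1) <=
    (mean_noise p / window_length c B + 1) * (T + 1).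
  apply: (le_trans (ler_wpM2l mn0 Th)).
  by rewrite mulrCA [leRHS]mulrC ler_wpM2l ?lerDl//; lra.
rewrite -EFinM lee_fin mulrDr lerD2l /large_constant -[leRHS]mulrA.
by rewrite -[leLHS]/(_ * (_ * _ * _)) -mulrA mulrA ler_wpM2l.
Qed.

Lemma state_cost_of_bounded_total nw n (S : system R) C :
  network_dynamics nw S -> 0 < C ->
  (exists A, 0 <= A /\ forall T, 0 < T ->
    (time_total (state_power (S:=S) L n m) T <=
      (A + C * (T + 1))%:E + C%:E * time_total (queue_power (S:=S) n m) (T + 1))%E) ->
  (state_cost S n m L <= (1 + 2 * C + 2 * (C / Num.min (xi class1) (xi class2)))%:E +
     (2 * (C / Num.min (xi class1) (xi class2)))%:E * J S n m xi)%E.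
Proof.
move=> dyn C0 [A [A0 HA]].
set x := Num.min _ _; have x0 : 0 < x by rewrite lt_min !xi0.
have Q0 i s w : 0 <= Q_hat (S:=S) n i s w `^ m by exact: powR_ge0.
have cost0 s w : 0 <= running_cost m xi (fun i => Q_hat (S:=S) n i s w).
  by rewrite /running_cost sumr_ge0// => i _; rewrite mulr_ge0 ?Q0// ltW.
apply: (ergodic_limit A0 C0 (divr_gt0 C0 x0)).
- by move=> T _; apply: time_total_ge0 => s w; exact: powR_ge0.
- by move=> T _; apply: time_total_ge0.
move=> T T0; apply: (le_trans (HA T T0)); rewrite leeD2l//.
rewrite EFinM -muleA; apply: lee_wpmul2l; first by rewrite lee_fin ltW.
apply: le_time_total => //.
- by rewrite invr_ge0 ltW.
- exact: (measurable_queue_power n m dyn).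
- have -> : (fun q : R * Omega S => running_cost m xi (fun i => Q_hat n i q.1 q.2)) =
      (fun q => xi class1 * Q_hat n class1 q.1 q.2 `^ m + xi class2 * Q_hat n class2 q.1 q.2 `^ m).
    by apply/funext => q; rewrite /running_cost sum_classes.
  by apply: measurable_funD; apply: measurable_funM => //; exact: (measurable_Q_power n m dyn).
- move=> s w _; rewrite queue_power_ge0 /= ler_pdivlMl//.
  rewrite /running_cost sum_classes /queue_power mulrDr.
  by apply: lerD; rewrite ler_wpM2r ?Q0// /x ge_min lexx ?orbT.
Qed.

End assembly.

Theorem lemma8p1 (R : realType) (nw : nat -> network R)
    (L : limit_parameters R) (m : R) (xi : class -> R) :
  standing_assumption nw L -> 1 <= m -> (forall i, 0 < xi i) ->
  exists C1 C2 : R, forall S : nat -> system R,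
  (forall n, (0 < n)%N ->
     network_dynamics (nw n) (S n) /\ admissible (nw n) (S n)) ->
  forall n, (0 < n)%N ->
  (state_cost (S n) n m L <= C1%:E + C2%:E * J (S n) n m xi)%E.
Proof.
move=> std m1 xi0.
have [c [B [N [c0 B1 large]]]] := well_scaled_eventually std.
have b0 : 0 < B by exact: lt_le_trans B1.
pose p := (Num.truncn m + 8)%N.
have p8 : (8 <= p)%N by rewrite leq_addl.
have mp : m <= p%:R.
  have : m < (Num.truncn m).+1%:R by rewrite truncnS_gt.
  by rewrite /p natrD -natr1; lra.
have single n : exists C, 0 <= C /\ ((0 < n)%N -> bounded_total m L (nw n) n C).
  case: n => [|n]; first by exists 0.
  have [C [C0 HC]] := bounded_total_single L m1 (ltn0Sn n) (fun f => rate_ge0 std f (ltn0Sn n)).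
  by exists C.
have [Cs CsP] := choice single.
have Cs0 n : 0 <= Cs n by have [] := CsP n.
pose Cl := large_constant m p c B.
(* One constant for all indices: Cl from N on, one Cs k for each index k below
   N. *)
pose C := Num.max 1 Cl + \sum_(k < N) Cs k.
have C0 : 0 < C by rewrite ltr_wpDr ?sumr_ge0// lt_max ltr01.
exists (1 + 2 * C + 2 * (C / Num.min (xi class1) (xi class2))).
exists (2 * (C / Num.min (xi class1) (xi class2))).
move=> S HS n n0; have [dyn adm] := HS n n0.
apply: (state_cost_of_bounded_total xi0 dyn C0).
suff bt : bounded_total m L (nw n) n C by exact: bt.
have [nN|Nn] := ltnP n N.
  have [_ /(_ n0)] := CsP n; apply: bounded_total_le.
  rewrite /C (bigD1 (Ordinal nN))//= addrCA lerDl addr_ge0 ?sumr_ge0//.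
  by rewrite le_max ler01.
apply: (@bounded_total_le _ _ _ _ _ Cl).
  by rewrite /C (@le_trans _ _ (Num.max 1 Cl))// ?le_max ?lexx ?orbT// lerDl sumr_ge0.
apply: bounded_total_large => //; first by move=> f; exact: (rate_ge0 std f n0).
exact: large.
Qed.
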